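(* Let $\mathfrak C$ be a countable, finitely aligned higher rank graph. An ideal $I$ of the C*-algebra $C^*_r(I_l\ltimes\partial\Omega)$ of $\mathfrak C$ is gauge-invariant if and only if it is induced from an open invariant subspace of $\partial\Omega$, in the sense that $I=\langle C_0(U)\rangle=C^*_r(I_l\ltimes U)$ for some open, $(I_l\ltimes\partial\Omega)$-invariant subspace $U\subseteq\partial\Omega$.
   Context: A small category is given by its set of morphisms $\mathfrak C$ with identity morphisms $\mathfrak C^0\subseteq\mathfrak C$, domain and target maps $\mathfrak d,\mathfrak t$; $cd$ is defined iff $\mathfrak d(c)=\mathfrak t(d)$. A higher rank graph is a small category $\mathfrak C$ with a functor (degree map) $\mathbb d:\mathfrak C\to\mathbb Z_{\ge0}^k$ (for some $k\ge1$) with unique factorization: if $\mathbb d(c)=p+q$, there are unique $a,b\in\mathfrak C$ with $c=ab$, $\mathbb d(a)=p$, $\mathbb d(b)=q$. It is finitely aligned if for all $a,b\in\mathfrak C$ there is a finite $F\subseteq\mathfrak C$ with $a\mathfrak C\cap b\mathfrak C=\bigcup_{c\in F}c\mathfrak C$. Each $c\in\mathfrak C$ gives the partial bijection $\mathfrak d(c)\mathfrak C\to c\mathfrak C$, $x\mapsto cx$; $I_l$ is the smallest semigroup of partial bijections of $\mathfrak C$ containing these and closed under inverses; $\mathcal J=\{\mathrm{dom}(s):s\in I_l\}$ is its semilattice of idempotents (product = intersection). $\widehat{\mathcal J}$ is the space of non-zero multiplicative maps $\chi:\mathcal J\to\{0,1\}$ with $\chi(\emptyset)=0$ if $\emptyset\in\mathcal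 J$ (pointwise convergence). $\partial\Omega\subseteq\widehat{\mathcal J}$ is the closure of the set of $\chi$ with $\chi^{-1}(1)$ maximal. $s\in I_l$ acts by $\chi\mapsto s.\chi=\chi(s^{-1}\cdot s)$ on $\{\chi\in\partial\Omega:\chi(s^{-1}s)=1\}$. $I_l\ltimes\partial\Omega$ is the transformation groupoid of classes $[s,\chi]$ with $\chi(s^{-1}s)=1$, where $[s,\chi]=[t,\psi]$ iff $\chi=\psi$ and $se=te$ for some $e\in\mathcal J$ with $\chi(e)=1$; source $\chi$, range $s.\chi$; topology such that $\{[s,\chi]:\chi(s^{-1}s)=1\}$ is open and mapped homeomorphically by the source map onto $\{\chi\in\partial\Omega:\chi(s^{-1}s)=1\}$. In the present case this groupoid is Hausdorff étale and each of its elements is of the form $[cd^{-1},\chi]$ with $c,d\in\mathfrak C$, $\mathfrak d(c)=\mathfrak d(d)$. $C^*_r(I_l\ltimes\partial\Omega)$ is canonically the higher rank graph C*-algebra of $\mathfrak C$. The gauge action is the action $\gamma$ of the torus $\mathbb T^k$ given for $f\in C_c(I_l\ltimes\partial\Omega)$ by $\gamma_z(f)([cd^{-1},\chi])=z^{\mathbb d(c)-\mathbb d(d)}f([cd^{-1},\chi])$; an ideal $I$ (closed, two-sided) is gauge-invariant if $\gamma_z(I)=I$ for all $z\in\mathbb T^k$. $\langle C_0(U)\rangle$ is the ideal generated by $C_0(U)\subseteq C_0(\partial\Omega)$, and $I_l\ltimes U$ is the restriction of $I_l\ltimes\partial\Omega$ to $U$. *)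

(* Defs.v *)
From HB Require Import structures.
From mathcomp Require Import all_boot all_order all_algebra generic_quotient.
From mathcomp Require Import all_classical all_reals all_analysis.
From mathcomp Require Import complex ring.
Set Implicit Arguments.
Unset Strict Implicit.
Unset Printing Implicit Defensive.
Import Order.TTheory GRing.Theory Num.Theory.
Import numFieldNormedType.Exports.
Local Open Scope classical_set_scope.
Local Open Scope ring_scope.
Local Open Scope quotient_scope.

(* A small category presented by its morphisms.  [comp c d] is the product cd;
   its value is irrelevant unless [dm c = tg d]. *)
Record smallCat := SmallCat {
  mor :> Type;
  idm : set mor;
  dm : mor -> mor;
  tg : mor -> mor;
  comp : mor -> mor -> mor;
  dm_id : forall c, idm (dm c);
  tg_id : forall c, idm (tg c);
  dmI : forall v, idm v -> dm v = v;
  tgI : forall v, idm v -> tg v = v;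
  dm_comp : forall c d, dm c = tg d -> dm (comp c d) = dm d;
  tg_comp : forall c d, dm c = tg d -> tg (comp c d) = tg c;
  comp_dm : forall c, comp c (dm c) = c;
  comp_tg : forall c, comp (tg c) c = c;
  compA : forall b c d, dm b = tg c -> dm c = tg d ->
    comp b (comp c d) = comp (comp b c) d }.

Record hrGraph (k : nat) := HrGraph {
  hcat :> smallCat;
  deg : hcat -> {ffun 'I_k -> nat};
  deg_id : forall v, idm v -> deg v = 0;
  deg_comp : forall c d, dm c = tg d -> deg (comp c d) = deg c + deg d;
  deg_fact : forall c (p q : {ffun 'I_k -> nat}), deg c = p + q ->
    exists! ab : hcat * hcat,
      [/\ dm ab.1 = tg ab.2, c = comp ab.1 ab.2, deg ab.1 = p & deg ab.2 = q] }.

Section InverseSemigroup.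
Context {k : nat} (C : hrGraph k).

Definition rideal (a : C) : set C := [set comp a x | x in [set x | dm a = tg x]].

Definition finitely_aligned := forall a b : C, exists2 F : set C,
  finite_set F & rideal a `&` rideal b = \bigcup_(c in F) rideal c.

(* A partial map of C is identified with its graph: [s (x, y)] means s(x) = y. *)
Definition pmap := set (C * C).
Definition pcomp (s t : pmap) : pmap :=
  [set p | exists2 y, t (p.1, y) & s (y, p.2)].
Definition pinv (s : pmap) : pmap := [set p | s (p.2, p.1)].
Definition pdom (s : pmap) : set C := [set x | exists y, s (x, y)].
Definition ppre (s : pmap) (e : set C) : set C := [set x | exists2 y, s (x, y) & e y].
Definition lmul (c : C) : pmap := [set p | dm c = tg p.1 /\ p.2 = comp c p.1].

Inductive inIl : pmap -> Prop :=
| inIl_gen c : inIl (lmul c)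
| inIl_comp s t : inIl s -> inIl t -> inIl (pcomp s t)
| inIl_inv s : inIl s -> inIl (pinv s).

Lemma comp_lcan (a x y : C) : dm a = tg x -> dm a = tg y ->
  comp a x = comp a y -> x = y.
Proof.
move=> ax ay E.
have Ed : deg x = deg y.
  have := congr1 (@deg _ _) E; rewrite !deg_comp// => /ffunP D.
  by apply/ffunP => i; have := D i; rewrite !ffunE => /addnI.
have [ab [_ U]] := deg_fact (deg_comp ax).
have E1 : ab = (a, x) by apply: U.
have E2 : ab = (a, y) by apply: U; split.
by case: (etrans (esym E1) E2).
Qed.

Lemma inIl_pbij s : inIl s ->
  (forall x y y', s (x, y) -> s (x, y') -> y = y') /\
  (forall x x' y, s (x, y) -> s (x', y) -> x = x').
Proof.
elim=> [c|{}s t _ [sf si] _ [tf ti]|{}s _ [sf si]].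
- split=> [x y y' [/= _ ->] [/= _ ->]//|x x' y [/= cx ->] [/= cx' E]].
  exact: (comp_lcan cx cx').
- split=> [x y y' [u /= xu uy] [u' /= xu' uy']|x x' y [u /= xu uy] [u' /= xu' uy']].
    by move: uy'; rewrite -(tf _ _ _ xu xu'); exact: sf uy.
  by move: xu'; rewrite -(si _ _ _ uy uy'); exact: ti xu.
- by split=> [x y y'|x x' y] /=; [exact: si|exact: sf].
Qed.

Definition Il : Type := set_type inIl.
Definition mkIl s (h : inIl s) : Il := SigSub (mem_set h).
Lemma IlP (s : Il) : inIl (val s). Proof. exact: set_mem (valP s). Qed.
Definition Il_mul (s t : Il) : Il := mkIl (inIl_comp (IlP s) (IlP t)).
Definition Il_inv (s : Il) : Il := mkIl (inIl_inv (IlP s)).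
(* the partial bijection c d^-1 : dx |-> cx *)
Definition Il_frac (c d : C) : Il :=
  mkIl (inIl_comp (inIl_gen c) (inIl_inv (inIl_gen d))).

Definition inJ : set (set C) := [set pdom s | s in inIl].
Definition J : Type := set_type inJ.
Definition mkJ e (h : inJ e) : J := SigSub (mem_set h).
Lemma JP (e : J) : inJ (val e). Proof. exact: set_mem (valP e). Qed.

Lemma inJ_dom (s : Il) : inJ (pdom (val s)).
Proof. by exists (val s) => //; exact: IlP. Qed.

Lemma inJ_pre (s : Il) (e : J) : inJ (ppre (val s) (val e)).
Proof.
have [t ht <-] := JP e; exists (pcomp t (val s)).
  by apply: inIl_comp => //; exact: IlP.
apply/seteqP; split=> [x [z [y xy yz]]|x [y xy [z yz]]].
  by exists y => //; exists z.
by exists z, y.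
Qed.

Lemma inJ_cap (e f : J) : inJ (val e `&` val f).
Proof.
have [s hs <-] := JP e; have [t ht <-] := JP f.
exists (pcomp t (pcomp (pinv s) s)).
  exact: inIl_comp ht (inIl_comp (inIl_inv hs) hs).
have [_ si] := inIl_pbij hs.
apply/seteqP; split=> [x [z [/= y [/= u xu yu] yz]]|x [[u xu] [z xz]]].
  have E : x = y := si _ _ _ xu yu; subst y.
  by split; [exists u|exists z].
by exists z, x => //; exists u.
Qed.

Definition Jdom s : J := mkJ (inJ_dom s).
Definition Jpre s e : J := mkJ (inJ_pre s e).
Definition Jcap e f : J := mkJ (inJ_cap e f).

Definition Jmap := {ptws J -> bool}.

Definition characters : set Jmap := [set chi : Jmap | [/\ exists e, chi e,
  forall e f, chi (Jcap e f) = chi e && chi f &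
  forall e, val e = set0 -> chi e = false]].

Definition max_characters : set Jmap := [set chi : Jmap | characters chi /\
  forall psi : Jmap, characters psi -> (forall e, chi e -> psi e) -> psi = chi].

(* closure relative to the space of characters *)
Definition boundary : set Jmap := characters `&` closure max_characters.

(* s.chi; only meaningful when chi(s^-1 s) = 1 *)
Definition actJ (s : Il) (chi : Jmap) : Jmap := fun e => chi (Jpre s e).

Lemma J_eq (e f : J) : val e = val f -> e = f. Proof. exact: val_inj. Qed.

Lemma char_le (chi : Jmap) e f : characters chi ->
  val e `<=` val f -> chi e -> chi f.
Proof.
move=> [_ cM _] ef ce; have : chi (Jcap e f).
  by rewrite (_ : Jcap e f = e)//; apply: J_eq; rewrite /= setIidl.
by rewrite cM => /andP[].
Qed.

Lemma act_char s (chi : Jmap) : characters chi -> chi (Jdom s) -> characters (actJ s chi).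
Proof.
move=> [_ cM c0] cs; have [sf si] := inIl_pbij (IlP s); split.
- exists (Jdom (Il_inv s)); rewrite /actJ; apply: etrans cs; congr (chi _).
  apply: J_eq; apply/seteqP; split=> [x [y xy _]|x [y xy]]; first by exists y.
  by exists y => //; exists x.
- move=> e f; rewrite /actJ -cM; congr (chi _); apply: J_eq.
  apply/seteqP; split=> [x [y xy [ey fy]]|x [[y xy ey] [y' xy' fy]]].
    by split; exists y.
  by exists y => //; split=> //; rewrite (sf _ _ _ xy xy').
- move=> e e0; apply: c0; apply/seteqP; split=> // x [y _].
  by rewrite e0.
Qed.

Lemma actKV s (chi : Jmap) e : characters chi -> chi (Jdom s) ->
  actJ (Il_inv s) (actJ s chi) e = chi e.
Proof.
move=> [_ cM _] cs; rewrite /actJ.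
have [sf si] := inIl_pbij (IlP s).
have -> : Jpre s (Jpre (Il_inv s) e) = Jcap e (Jdom s).
  apply: J_eq; apply/seteqP; split=> [x [y xy [x' /= yx' ex']]|x [ex [y xy]]].
    by rewrite (si _ _ _ xy yx'); split=> //; exists y.
  by exists y => //; exists x.
by rewrite cM cs andbT.
Qed.

Lemma act_dom s (chi : Jmap) : chi (Jdom s) -> actJ s chi (Jdom (Il_inv s)).
Proof.
rewrite /actJ (_ : Jpre s _ = Jdom s)//; apply: J_eq.
apply/seteqP; split=> [x [y xy _]|x [y xy]]; first by exists y.
by exists y => //; exists x.
Qed.

Lemma Il_invK s : Il_inv (Il_inv s) = s.
Proof. by apply: val_inj; apply/seteqP; split=> -[x y]. Qed.

Lemma act_max s (chi : Jmap) : max_characters chi -> chi (Jdom s) ->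
  max_characters (actJ s chi).
Proof.
move=> [cc cmax] cs; split; first exact: act_char.
move=> psi pc cp.
have ps : psi (Jdom (Il_inv s)) by apply/cp/act_dom.
have E : actJ (Il_inv s) psi = chi.
  apply: cmax; first exact: act_char.
  move=> e ce; rewrite /actJ; apply: cp.
  by have := actKV e cc cs; rewrite /actJ => ->.
apply/funext => e; rewrite -E -{1}(Il_invK s).
by rewrite actKV.
Qed.

Lemma eval_continuous (e : J) : continuous (fun chi : Jmap => chi e).
Proof. exact: (@proj_continuous J (fun=> bool) e). Qed.

Lemma act_continuous s : continuous (actJ s : Jmap -> Jmap).
Proof.
move=> chi; apply/cvg_sup => e.
have sj : (fun f : J -> bool => f e) @` setT = setT.
  by apply/seteqP; split => // b _; exists (fun=> b).
apply/(cvg_image _ _ sj) => B nB.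
exists ((fun f : J -> bool => f e) @^-1` B); last exact: image_preimage.
exact: (@eval_continuous (Jpre s e) chi B nB).
Qed.

Lemma act_boundary s (chi : Jmap) : boundary chi -> chi (Jdom s) ->
  boundary (actJ s chi).
Proof.
move=> [cc clc] cs; split; first exact: act_char.
move=> B /act_continuous nB.
have {}nB : nbhs chi (actJ s @^-1` B) := nB.
have nD : nbhs chi [set psi : Jmap | psi (Jdom s)].
  by apply: (@eval_continuous (Jdom s) chi [set b | b]); rewrite /= cs; exact/principal_filterP.
have [psi [pm [pB ps]]] := clc _ (filterI nB nD).
by exists (actJ s psi); split=> //; exact: act_max.
Qed.

Definition bdry : Type := set_type boundary.
HB.instance Definition _ := Topological.copy bdry (set_type boundary).

Lemma bdryP (chi : bdry) : boundary (val chi). Proof. exact: set_mem (valP chi). Qed.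

Definition bdom (s : Il) : set bdry := [set chi | (val chi : Jmap) (Jdom s)].

(* The disjoint union over s of {chi | chi(s^-1 s) = 1}; its quotient below
   carries the topology for which each chi |-> [s,chi] is an open embedding. *)
Definition rep : Type := {s : Il & set_type (bdom s)}.
HB.instance Definition _ := Topological.copy rep {s : Il & set_type (bdom s)}.

Definition rep_elt (p : rep) : Il := projT1 p.
Definition rep_src (p : rep) : bdry := val (projT2 p).

Lemma rep_dom (p : rep) : (val (rep_src p) : Jmap) (Jdom (rep_elt p)).
Proof. by have := set_mem (valP (projT2 p)). Qed.

Lemma rep_ran_subproof (p : rep) : boundary (actJ (rep_elt p) (val (rep_src p))).
Proof. by apply: act_boundary (rep_dom p); exact: bdryP. Qed.

Definition rep_ran (p : rep) : bdry := SigSub (mem_set (rep_ran_subproof p)).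

Definition pid (e : set C) : pmap := [set p | e p.1 /\ p.1 = p.2].

Definition germ_eq (p q : rep) : bool := `[< rep_src p = rep_src q /\
  exists2 e : J, (val (rep_src p) : Jmap) e &
    pcomp (val (rep_elt p)) (pid (val e)) = pcomp (val (rep_elt q)) (pid (val e)) >].

Lemma pcomp_pid s e x y : pcomp s (pid e) (x, y) <-> e x /\ s (x, y).
Proof. by split=> [[z [/= ex <-]]//|[ex xy]]; exists x. Qed.

Lemma germ_eqP (p q : rep) : reflect (rep_src p = rep_src q /\
  exists2 e : J, (val (rep_src p) : Jmap) e & forall x y, val e x ->
    val (rep_elt p) (x, y) <-> val (rep_elt q) (x, y)) (germ_eq p q).
Proof.
apply: (iffP (asboolP _)) => -[E [e ce H]]; split=> //; exists e => //.
  move=> x y ex; split=> h.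
    have : pcomp (val (rep_elt p)) (pid (val e)) (x, y) by exact/pcomp_pid.
    by rewrite H => /pcomp_pid[].
  have : pcomp (val (rep_elt q)) (pid (val e)) (x, y) by exact/pcomp_pid.
  by rewrite -H => /pcomp_pid[].
apply/seteqP; split=> -[x y] /pcomp_pid[ex xy]; apply/pcomp_pid; split=> //.
  exact/H.
exact/H.
Qed.

Lemma germ_eq_refl : reflexive germ_eq.
Proof.
move=> p; apply/germ_eqP; split=> //.
by exists (Jdom (rep_elt p)) => //; exact: rep_dom.
Qed.

Lemma germ_eq_sym : symmetric germ_eq.
Proof.
suff H p q : germ_eq p q -> germ_eq q p by move=> p q; apply/idP/idP; exact: H.
move=> /germ_eqP[E [e ce H]]; apply/germ_eqP; split=> //; exists e; first by rewrite -E.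
by move=> x y ex; apply: iff_sym; exact: H.
Qed.

Lemma germ_eq_trans : transitive germ_eq.
Proof.
move=> q p r /germ_eqP[E [e ce H]] /germ_eqP[E' [f cf H']]; apply/germ_eqP.
split; first by rewrite E.
exists (Jcap e f).
  have [[_ cM _] _] := bdryP (rep_src p).
  by rewrite cM ce /= E.
by move=> x y [ex fx]; apply: (iff_trans (H _ _ ex)); exact: H'.
Qed.

Definition germ_equiv := EquivRel germ_eq germ_eq_refl germ_eq_sym germ_eq_trans.

Definition germ : Type := quotient_topology {eq_quot germ_equiv}.
HB.instance Definition _ := Topological.copy germ (quotient_topology {eq_quot germ_equiv}).

Definition mkgerm (p : rep) : germ := \pi_({eq_quot germ_equiv}) p.
Definition src (g : germ) : bdry := rep_src (repr (g : {eq_quot germ_equiv})).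
Definition ran (g : germ) : bdry := rep_ran (repr (g : {eq_quot germ_equiv})).

Lemma src_mkgerm p : src (mkgerm p) = rep_src p.
Proof.
rewrite /src /mkgerm; case: piP => q E.
by move/eqmodP: E => /germ_eqP[].
Qed.

Lemma ran_mkgerm p : ran (mkgerm p) = rep_ran p.
Proof.
rewrite /ran /mkgerm; case: piP => q /eqmodP/germ_eqP[E [e ce H]].
apply/val_inj/funext => f; rewrite /= /actJ -E.
have [[_ cM _] _] := bdryP (rep_src p).
suff K : Jcap (Jpre (rep_elt p) f) e = Jcap (Jpre (rep_elt q) f) e.
  by have := congr1 (val (rep_src p) : Jmap) K; rewrite !cM ce !andbT => ->.
apply: J_eq; apply/seteqP; split=> x [[y xy fy] ex]; split=> //; exists y => //.
  exact/H.
exact/H.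
Qed.

(* a b = g in the groupoid: [t, s.chi] [s, chi] = [ts, chi] *)
Definition gprod (a b g : germ) : Prop := exists p q r : rep,
  [/\ a = mkgerm p, b = mkgerm q & g = mkgerm r] /\
  [/\ rep_src p = rep_ran q, rep_src r = rep_src q &
      rep_elt r = Il_mul (rep_elt p) (rep_elt q)].

(* a unit is a germ [s^-1 s, chi] *)
Definition gunit (g : germ) : Prop := exists (s : Il) (p : rep),
  rep_elt p = Il_mul (Il_inv s) s /\ g = mkgerm p.

Definition invariant_set (U : set bdry) := forall g, U (src g) <-> U (ran g).

End InverseSemigroup.

Local Notation normc := ComplexField.Normc.normc.

Lemma esumZ_le (R : realType) (T : choiceType) (a : T -> \bar R) (M : R) : 0 <= M ->
  (forall t, 0 <= a t)%E ->
  (\esum_(t in [set: T]) (M%:E * a t)%E <= M%:E * \esum_(t in [set: T]) a t)%E.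
Proof.
move=> M0 a0; apply: ub_ereal_sup => _ [A [fA AT] <-].
rewrite -ge0_mule_fsumr//; apply: lee_wpmul2l; first by rewrite lee_fin.
by apply: esum_ge; exists A.
Qed.
Lemma sq_le (R : rcfType) (a : R[i]) (x y : R[i]) : normc (a * x + y) ^+ 2 <= 
  2 * normc a ^+ 2 * normc x ^+2 + 2 * normc y ^+ 2.
Proof.
case: a x y => [a b] [c d] [e f]; simpc.
rewrite /normc !sqr_sqrtr ?addr_ge0 ?sqr_ge0//.
rewrite -subr_ge0; set u := (X in 0 <= X).
have -> : u = (a * c - b * d - e) ^+ 2 + (a * d + b * c - f) ^+ 2 by rewrite /u; ring.
by rewrite addr_ge0 ?sqr_ge0.
Qed.

Section GroupoidAlgebra.
Context {k : nat} (C : hrGraph k) (R : realType).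
Notation G := (germ C).

Definition sqsum (xi : G -> R[i]) : \bar R :=
  \esum_(g in [set: G]) ((normc (xi g) ^+ 2)%:E).

Definition l2fun : {pred G -> R[i]} := [pred xi | sqsum xi < +oo]%E.

Lemma l2fun_submod_closed : submod_closed l2fun.
Proof.
have nn M (xi : G -> R[i]) (g : G) : 0 <= M ->
  (0 <= (M%:E * (normc (xi g) ^+ 2)%:E : \bar R))%E.
  by move=> M0; rewrite -EFinM lee_fin mulr_ge0// sqr_ge0.
split.
  rewrite inE /sqsum esum1 ?ltry// => g _.
  by rewrite [X in normc X](_ : _ = 0%C)// ComplexField.Normc.normc0 expr0n.
move=> a xi eta; rewrite !inE /sqsum => hx he.
pose M := 2 * normc a ^+ 2.
have nM : 0 <= M by rewrite mulr_ge0 // sqr_ge0.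
apply: (@le_lt_trans _ _ (\esum_(g in [set: G])
   ((M%:E * (normc (xi g) ^+ 2)%:E) + (2%:E * (normc (eta g) ^+ 2)%:E))%E)).
  by apply: le_esum => g _; rewrite -!EFinM -EFinD lee_fin; exact: sq_le.
rewrite esumD; [|by move=> *; exact: nn|by move=> *; exact: nn].
rewrite lte_add_pinfty//.
  apply: le_lt_trans (esumZ_le nM _) _ => [g|]; first by rewrite lee_fin sqr_ge0.
  by rewrite lte_mul_pinfty// lee_fin.
apply: le_lt_trans (esumZ_le _ _) _ => [//|g|]; first by rewrite lee_fin sqr_ge0.
by rewrite lte_mul_pinfty// lee_fin.
Qed.

HB.instance Definition _ :=
  GRing.isSubmodClosed.Build _ _ l2fun l2fun_submod_closed.

Record ell2 := Ell2 { ell2_val :> G -> R[i]; ell2P : ell2_val \in l2fun }.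
HB.instance Definition _ := [isSub for ell2_val].
HB.instance Definition _ := [Choice of ell2 by <:].
HB.instance Definition _ := [SubChoice_isSubLmodule of ell2 by <:].

Definition l2norm (xi : ell2) : R := Num.sqrt (fine (sqsum xi)).

Definition oper := ell2 -> ell2.
Definition op_le (T : oper) (M : R) := forall xi, l2norm (T xi) <= M * l2norm xi.
Definition bounded_op (T : oper) := linear T /\ exists M, op_le T M.

Definition op_closure (X : set oper) : set oper := [set T | bounded_op T /\
  forall e : R, 0 < e -> exists2 S, X S & op_le (T - S) e].

(* [regular f T]: T is convolution by f on l^2(G), the direct sum over chi of
   the regular representations on l^2(src^-1 chi). *)
Definition regular (f : G -> R[i]) (T : oper) := bounded_op T /\
  forall xi g, T xi g =
    \sum_(ab \in [set ab : G * G | gprod ab.1 ab.2 g]) (f ab.1 * xi ab.2).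

Definition supp (f : G -> R[i]) : set G := closure [set g | f g != 0].

Definition restriction (U : set (bdry C)) : set G :=
  [set g | U (src g) /\ U (ran g)].

(* C_c of the restriction to U, extended by zero *)
Definition Cc (U : set (bdry C)) : set (G -> R[i]) :=
  [set f | [/\ continuous (f : G -> R[i]^o), compact (supp f) &
               supp f `<=` restriction U]].

(* For open invariant U, the reduced C*-algebra of the restriction to U, in its
   canonical embedding induced by extending C_c-functions by zero: on
   l^2(src^-1 chi) such a function acts by its regular representation if chi is
   in U, and by 0 otherwise. *)
Definition Cred (U : set (bdry C)) : set oper :=
  op_closure [set T | exists2 f, Cc U f & regular f T].

Definition Cstar : set oper := Cred setT.

Definition closed_ideal (I : set oper) := [/\ I `<=` Cstar, I 0,
  forall a S T, I S -> I T -> I (a *: S + T),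
  forall S T, Cstar S -> I T -> I (S \o T) /\ I (T \o S) &
  op_closure I `<=` I].

Definition gen_ideal (X : set oper) : set oper :=
  [set T | forall I, closed_ideal I -> X `<=` I -> I T].

(* C_0(U), extended by zero to the boundary *)
Definition C0 (U : set (bdry C)) : set (bdry C -> R[i]) :=
  [set f | continuous (f : bdry C -> R[i]^o) /\
    forall e : R, 0 < e -> compact [set chi | e <= normc (f chi)] /\
                           [set chi | e <= normc (f chi)] `<=` U].

(* extension by zero from the unit space to the groupoid *)
Definition unit_ext (f : bdry C -> R[i]) (g : G) : R[i] :=
  if `[< gunit g >] then f (src g) else 0.

Definition C0_ops (U : set (bdry C)) : set oper :=
  [set T | exists2 f, C0 U f & regular (unit_ext f) T].

Definition torus : set ('I_k -> R[i]) := [set z | forall i, `|z i| = 1].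

Definition zpow (z : 'I_k -> R[i]) (c d : C) : R[i] :=
  \prod_i z i ^ ((deg c i)%:Z - (deg d i)%:Z).

(* f' = gamma_z(f); every germ is of the form [c d^-1, chi] *)
Definition gauge_fun (z : 'I_k -> R[i]) (f f' : G -> R[i]) :=
  forall (c d : C) (p : rep C), dm c = dm d -> rep_elt p = Il_frac c d ->
    f' (mkgerm p) = zpow z c d * f (mkgerm p).

(* T' = gamma_z(T), by continuous extension from C_c *)
Definition gauge_op (z : 'I_k -> R[i]) (T T' : oper) :=
  forall e : R, 0 < e -> exists f f' S S',
    [/\ Cc setT f, Cc setT f', gauge_fun z f f', regular f S & regular f' S'] /\
    op_le (T - S) e /\ op_le (T' - S') e.

Definition gauge_image (z : 'I_k -> R[i]) (I : set oper) : set oper :=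
  [set T' | Cstar T' /\ exists2 T, I T & gauge_op z T T'].

Definition gauge_invariant (I : set oper) :=
  forall z, torus z -> gauge_image z I = I.

End GroupoidAlgebra.

(* Main.v *)
(* Every operator in C*_r is determined by its kernel, the function on the
   groupoid read off from its values at the units.

   Let I be gauge-invariant and T in I.  The degree-zero part of the groupoid
   is principal, so a point of a compact set of non-units either has nonzero
   degree, and is killed by half the sum of the identity and a gauge
   automorphism with z^n = -1, or its source and range are separated by a
   compact open set, and it is killed by a compression with that set.  Hence
   the diagonal part of T is a limit of elements of I, and it is the
   multiplication by a function in C_0(U), where C_0(U) is the intersection of
   I with C_0 of the boundary.  It follows that the kernels of elements of I
   vanish outside the restriction to U.

   Conversely, an element of C*_r whose kernel vanishes there belongs to
   C*_r(I_l |x U).  This is exactness, made explicit: Schur multipliers phi_N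
   given by labels on the groupoid map C*_r into finite sums of slices, and on
   a compact set phi_N tends to 1.  A label of a germ g, for an offset p in a
   box, consists of a degree and of what remains of g after removing from
   ran g its longest prefix in a finite family of paths; the family is closed
   under minimal common extensions and under the exchange of prefixes, so
   that, for g h^-1 in the compact set, the labels of g and h agree at all
   offsets except near the boundary of the box, which is a Foelner set of
   degrees. *)
From mathcomp Require Import all_boot all_order all_algebra finmap.
From mathcomp Require Import all_classical all_reals all_analysis.
From mathcomp Require Import complex ring lra zify.
Require Import Defs.
Set Implicit Arguments.
Unset Strict Implicit.
Unset Printing Implicit Defensive.
Import Order.TTheory GRing.Theory Num.Theory.
Import numFieldNormedType.Exports.
Local Open Scope classical_set_scope.
Local Open Scope ring_scope.
Local Open Scope quotient_scope.
Local Notation normc := ComplexField.Normc.normc.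

(** * Square-summable functions and bounded operators *)

Arguments ell2_val : simpl never.

(** The hard inclusion is that of I in [Cred U]. The norm dominates the supremum of the kernel, but
    a uniformly small kernel gives a small operator only when it lives on a bounded number of
    slices; so a kernel vanishing off U cannot simply be cut off and estimated. The multipliers
    overcome this because they are contractions of all bounded operators: the matrix entry at (g, h)
    is scaled by the share of offsets at which the label of g is also a label of h. A vertex may
    receive infinitely many edges, so a prefix of prescribed degree need not exist and may take
    infinitely many values; only finite families of paths give locally constant labels supported on
    finitely many slices. Closing a family under exchange of prefixes alone would let degrees grow
    without end. The offsets prevent this: degree plus offset is invariant under exchange and stays
    bounded under minimal common extension. The price is the loss of the offsets that an exchange
    pushes out of the box. On the gauge side no integral over the torus is taken: for each
    approximant only a compact set of non-units has to be killed, and finitely many two-point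
    averages and compressions do that. *)

Section SquareSummable.
Context {k : nat} {C : hrGraph k} {R : realType}.
Notation G := (germ C).
Notation E2 := (ell2 C R).
Implicit Types (xi eta : E2) (f : G -> R[i]) (A : seq G).

Lemma normc_ge0 (x : R[i]) : 0 <= normc x.
Proof. by case: x => a b; exact: sqrtr_ge0. Qed.

Lemma normcD (x y : R[i]) : normc (x + y) <= normc x + normc y.
Proof. exact: le_normcD. Qed.

Lemma normcM (x y : R[i]) : normc (x * y) = normc x * normc y.
Proof. exact: ComplexField.Normc.normcM. Qed.

Lemma normc0 : normc (0 : R[i]) = 0.
Proof. exact: ComplexField.Normc.normc0. Qed.

Lemma normc1 : normc (1 : R[i]) = 1.
Proof. exact: ComplexField.Normc.normc1. Qed.

Lemma normc_eq0 (x : R[i]) : normc x = 0 -> x = 0.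
Proof. exact: ComplexField.Normc.eq0_normc. Qed.

Lemma normcB (x y : R[i]) : normc (x - y) = normc (y - x).
Proof. by rewrite -[RHS]normcN opprB. Qed.

Lemma normr_normc (x : R[i]) : `|x| = (normc x)%:C%C.
Proof. by rewrite normc_def; case: x. Qed.

Lemma ell2D xi eta g : (xi + eta : E2) g = xi g + eta g. Proof. by []. Qed.
Lemma ell2N xi g : (- xi : E2) g = - xi g. Proof. by []. Qed.
Lemma ell2B xi eta g : (xi - eta : E2) g = xi g - eta g. Proof. by []. Qed.
Lemma ell2Z a xi g : (a *: xi : E2) g = a * xi g. Proof. by []. Qed.
Lemma ell20 g : (0 : E2) g = 0. Proof. by []. Qed.

Lemma ell2_ext xi eta : (forall g, xi g = eta g) -> xi = eta.
Proof. by move=> H; apply: val_inj; apply/funext. Qed.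

Lemma ell2_sum (I : Type) (r : seq I) (P : pred I) (F : I -> E2) g :
  (\sum_(i <- r | P i) F i) g = \sum_(i <- r | P i) F i g.
Proof. by elim/big_rec2: _ => // i y1 y2 _ <-. Qed.

Lemma sum_le_sqsum f A : uniq A ->
  ((\sum_(g <- A) normc (f g) ^+ 2)%:E <= sqsum f)%E.
Proof.
move=> uA; apply: ereal_sup_ubound => /=.
exists [set` A]; first by split => //; exact: finite_seq.
by rewrite -fsbig_seq// sumEFin.
Qed.

Lemma sqsum_ub f c : (forall A, uniq A -> \sum_(g <- A) normc (f g) ^+ 2 <= c) ->
  (sqsum f <= c%:E)%E.
Proof.
move=> H; apply: ge_ereal_sup => _ [A [/finite_fsetP[B ->] _] <-].
by rewrite -fsbig_seq ?fset_uniq// sumEFin lee_fin; exact/H/fset_uniq.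
Qed.

Lemma sqsum_ge0 f : (0 <= sqsum f)%E.
Proof. by apply: esum_ge0 => g _; rewrite lee_fin sqr_ge0. Qed.

Lemma l2fun_ub f c : (forall A, uniq A -> \sum_(g <- A) normc (f g) ^+ 2 <= c) ->
  f \in l2fun (R := R) (C := C).
Proof. by move=> /sqsum_ub H; rewrite inE (le_lt_trans H)// ltry. Qed.

Lemma l2norm_ge0 xi : 0 <= l2norm xi.
Proof. exact: sqrtr_ge0. Qed.

Lemma l2norm_sqr xi : ((l2norm xi ^+ 2)%:E = sqsum xi)%E.
Proof.
have := ell2P xi; rewrite inE => xf.
rewrite /l2norm sqr_sqrtr; last by rewrite fine_ge0// sqsum_ge0.
by rewrite fineK// ge0_fin_numE// sqsum_ge0.
Qed.

Lemma sum_le_l2norm xi A : uniq A ->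
  \sum_(g <- A) normc (xi g) ^+ 2 <= l2norm xi ^+ 2.
Proof. by move=> uA; rewrite -lee_fin l2norm_sqr; exact: sum_le_sqsum. Qed.

Lemma l2norm_le xi c : 0 <= c ->
  (forall A, uniq A -> \sum_(g <- A) normc (xi g) ^+ 2 <= c ^+ 2) -> l2norm xi <= c.
Proof.
move=> c0 /sqsum_ub; rewrite -l2norm_sqr lee_fin.
by rewrite ler_pXn2r// nnegrE l2norm_ge0.
Qed.

Lemma l2norm_approx xi (e : R) : 0 < e -> exists2 A, uniq A &
  l2norm xi ^+ 2 - e < \sum_(g <- A) normc (xi g) ^+ 2.
Proof.
move=> e0; have fs : sqsum xi \is a fin_num by rewrite -l2norm_sqr.
have [_ [A [/finite_fsetP[B ->] _] <-]] := ub_ereal_sup_adherent e0 fs.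
have := l2norm_sqr xi; rewrite {1}/sqsum /esum => <-.
rewrite -fsbig_seq ?fset_uniq// sumEFin -EFinB lte_fin => H.
by exists B; first exact: fset_uniq.
Qed.

Lemma normc_le_l2norm xi g : normc (xi g) <= l2norm xi.
Proof.
have := @sum_le_l2norm xi [:: g] isT; rewrite big_seq1.
by rewrite ler_pXn2r// nnegrE ?normc_ge0 ?l2norm_ge0.
Qed.

Lemma l2norm_eq0 xi : l2norm xi <= 0 -> xi = 0.
Proof.
move=> H; apply: ell2_ext => g; apply: normc_eq0; apply/le_anti.
by rewrite normc_ge0 (le_trans (normc_le_l2norm _ _)).
Qed.

Lemma l2norm0 : l2norm (0 : E2) = 0.
Proof.
apply/le_anti; rewrite l2norm_ge0 andbT; apply: l2norm_le => // A _.
by rewrite big1 ?expr0n// => g _; rewrite normc0 expr0n.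
Qed.

Lemma l2normD xi eta : l2norm (xi + eta) <= l2norm xi + l2norm eta.
Proof.
have [x0|x0] := leP (l2norm xi) 0.
  by rewrite (l2norm_eq0 x0) add0r l2norm0 add0r.
have [y0|y0] := leP (l2norm eta) 0.
  by rewrite (l2norm_eq0 y0) addr0 l2norm0 addr0.
apply: l2norm_le => [|A uA]; first by rewrite addr_ge0 ?l2norm_ge0.
set a := l2norm xi in x0 *; set b := l2norm eta in y0 *.
(* Termwise (p + q)^2 <= (a + b)(p^2/a + q^2/b), the difference being (bp - aq)^2/(ab). Since a and
   b are the two norms, summation bounds the right side by (a + b)^2, so no inner product is
   needed. *)
apply: (@le_trans _ _ ((a + b) * ((\sum_(g <- A) normc (xi g) ^+ 2) / a +
    (\sum_(g <- A) normc (eta g) ^+ 2) / b))).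
  rewrite 2!big_distrl /= -big_split big_distrr /=; apply: ler_sum => g _.
  rewrite ell2D; apply: (@le_trans _ _ ((normc (xi g) + normc (eta g)) ^+ 2)).
    by rewrite ler_pXn2r ?nnegrE ?addr_ge0 ?normc_ge0// normcD.
  set p := normc (xi g); set q := normc (eta g).
  rewrite -subr_ge0 [X in 0 <= X](_ : _ = (b * p - a * q) ^+ 2 / (a * b)).
    by rewrite divr_ge0 ?sqr_ge0 ?mulr_ge0// ltW.
  by field; rewrite !gt_eqF.
rewrite expr2; apply: ler_wpM2l; first by rewrite addr_ge0// ltW.
apply: lerD; first by rewrite ler_pdivrMr// -expr2 sum_le_l2norm.
by rewrite ler_pdivrMr// -expr2 sum_le_l2norm.
Qed.

Lemma l2normZ a xi : l2norm (a *: xi) <= normc a * l2norm xi.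
Proof.
apply: l2norm_le => [|A uA]; first by rewrite mulr_ge0 ?l2norm_ge0 ?normc_ge0.
under eq_bigr do rewrite ell2Z normcM exprMn.
by rewrite -big_distrr exprMn ler_wpM2l ?sqr_ge0// sum_le_l2norm.
Qed.

Lemma l2normN xi : l2norm (- xi) = l2norm xi.
Proof.
suff H eta : l2norm (- eta) <= l2norm eta.
  by apply/le_anti; rewrite H -{1}(opprK xi) H.
by rewrite -scaleN1r (le_trans (l2normZ _ _))// normcN normc1 mul1r.
Qed.

(** Stated with an arbitrary constant so that limit arguments need not normalise their error; [c]
    may even be negative, whence the division by [|c| + 1]. *)
Lemma ell2_eqP xi eta c : (forall e : R, 0 < e -> l2norm (xi - eta) <= c * e) ->
  xi = eta.
Proof.
move=> H; apply/eqP; rewrite -subr_eq0; apply/eqP/l2norm_eq0.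
apply/ler_addgt0Pr => e e0; rewrite add0r.
have c1 : 0 < `|c| + 1 by rewrite ltr_pwDr.
apply: le_trans (H (e / (`|c| + 1)) _) _; first by rewrite divr_gt0.
rewrite mulrCA; apply: ler_piMr; first exact: ltW.
rewrite ler_pdivrMr// mul1r.
by rewrite (le_trans (ler_norm _))// lerDl.
Qed.

Lemma restr_subproof (P : G -> bool) xi :
  (fun g => if P g then xi g else 0) \in l2fun (R := R) (C := C).
Proof.
apply: (@l2fun_ub _ (l2norm xi ^+ 2)) => A uA; apply: le_trans (sum_le_l2norm xi uA).
by apply: ler_sum => g _; case: (P g) => //; rewrite normc0 expr0n sqr_ge0.
Qed.
Definition restr P xi : E2 := Ell2 (restr_subproof P xi).

Lemma restrE P xi g : restr P xi g = if P g then xi g else 0. Proof. by []. Qed.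

Lemma restr_linear P a xi eta : restr P (a *: xi + eta) = a *: restr P xi + restr P eta.
Proof.
apply: ell2_ext => g; rewrite ell2D ell2Z !restrE ell2D ell2Z.
by case: (P g) => //; rewrite mulr0 addr0.
Qed.

Lemma delta_subproof h : (fun g => (g == h)%:R) \in l2fun (R := R) (C := C).
Proof.
apply: (@l2fun_ub _ 1) => A uA; have [hA|hA] := boolP (h \in A).
  rewrite (bigD1_seq h)//= eqxx normc1 expr1n big1 ?addr0// => g /negPf ->.
  by rewrite normc0 expr0n.
rewrite big_seq big1 // => g gA; case: eqP => [E|_]; last by rewrite normc0 expr0n.
by rewrite -E gA in hA.
Qed.
Definition delta h : E2 := Ell2 (delta_subproof h).

Lemma deltaE h g : delta h g = (g == h)%:R. Proof. by []. Qed.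

Lemma l2norm_delta h : l2norm (delta h) <= 1.
Proof.
apply: l2norm_le => // A uA; have [hA|hA] := boolP (h \in A).
  rewrite (bigD1_seq h)//= deltaE eqxx normc1 expr1n big1 ?addr0// => g /negPf gh.
  by rewrite deltaE gh normc0 expr0n.
rewrite big_seq big1 ?expr1n// => g gA; rewrite deltaE.
case: eqP => [E|_]; last by rewrite normc0 expr0n.
by rewrite -E gA in hA.
Qed.

Lemma restr_delta P h : restr P (delta h) = if P h then delta h else 0.
Proof.
apply: ell2_ext => g; rewrite restrE deltaE.
case: (eqVneq g h) => [->|/negPf gh]; first by case: (P h); rewrite ?deltaE ?eqxx.
by case: (P g); case: (P h); rewrite ?deltaE ?gh.
Qed.

Lemma restr_fin A xi : uniq A -> restr (fun g => g \in A) xi = \sum_(g <- A) xi g *: delta g.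
Proof.
move=> uA; apply: ell2_ext => g; rewrite restrE ell2_sum.
have [gA|gA] := boolP (g \in A).
  rewrite (bigD1_seq g)//= ell2Z deltaE eqxx mulr1 big1 ?addr0// => h /negPf hg.
  by rewrite ell2Z deltaE eq_sym hg mulr0.
rewrite big_seq big1// => h hA; rewrite ell2Z deltaE; case: eqP => [E|_].
  by rewrite E hA in gA.
by rewrite mulr0.
Qed.

Lemma restr_approx xi (e : R) : 0 < e -> exists2 A, uniq A &
  l2norm (xi - restr (fun g => g \in A) xi) <= e.
Proof.
move=> e0; have [|A uA HA] := @l2norm_approx xi (e ^+ 2); first by rewrite exprn_gt0.
exists A => //; apply: l2norm_le => [|B uB]; first exact: ltW.
have E g : normc ((xi - restr (fun g => g \in A) xi) g) ^+ 2 =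
    if g \notin A then normc (xi g) ^+ 2 else 0.
  rewrite ell2B restrE; case: ifP => _ /=; last by rewrite subr0.
  by rewrite subrr normc0 expr0n.
under eq_bigr do rewrite E; rewrite -big_mkcond -big_filter.
have u : uniq (A ++ [seq g <- B | g \notin A]).
  rewrite cat_uniq uA filter_uniq// andbT; apply/hasPn => g.
  by rewrite mem_filter => /andP[].
have := sum_le_l2norm xi u; rewrite big_cat /=; lra.
Qed.

End SquareSummable.

(** * Bounded operators and norm closures *)

Section Operators.
Context {k : nat} {C : hrGraph k} {R : realType}.
Notation G := (germ C).
Notation E2 := (ell2 C R).
Notation op := (oper C R).
Implicit Types (xi eta : E2) (f : G -> R[i]) (A : seq G) (S T : op).

Lemma oper_addE S T xi : (S + T) xi = S xi + T xi. Proof. by []. Qed.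
Lemma oper_oppE T xi : (- T) xi = - T xi. Proof. by []. Qed.
Lemma oper_subE S T xi : (S - T) xi = S xi - T xi. Proof. by []. Qed.
Lemma oper_scaleE (a : R[i]) T xi : (a *: T) xi = a *: T xi. Proof. by []. Qed.
Lemma oper_zeroE xi : (0 : op) xi = 0. Proof. by []. Qed.
Definition operE := (oper_addE, oper_oppE, oper_scaleE, oper_zeroE).

Lemma linear_op0 T : linear T -> T 0 = 0.
Proof. by move=> lT; have := lT (-1) 0 0; rewrite !scaleN1r oppr0 addr0 addNr. Qed.

Lemma linear_opD T xi eta : linear T -> T (xi + eta) = T xi + T eta.
Proof. by move=> lT; have := lT 1 xi eta; rewrite !scale1r. Qed.

Lemma linear_opZ T a xi : linear T -> T (a *: xi) = a *: T xi.
Proof. by move=> lT; have := lT a xi 0; rewrite !addr0 (linear_op0 lT) addr0. Qed.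

Lemma linear_opB T xi eta : linear T -> T (xi - eta) = T xi - T eta.
Proof. by move=> lT; rewrite linear_opD// -scaleN1r linear_opZ// scaleN1r. Qed.

Lemma linear_op_sum T (I : Type) (r : seq I) (P : pred I) (F : I -> E2) : linear T ->
  T (\sum_(i <- r | P i) F i) = \sum_(i <- r | P i) T (F i).
Proof.
move=> lT; elim/big_rec2: _ => [|i y1 y2 _ <-]; first exact: linear_op0.
exact: linear_opD.
Qed.

Lemma op_le_trans T a b : a <= b -> op_le T a -> op_le T b.
Proof. by move=> ab H xi; rewrite (le_trans (H xi))// ler_wpM2r ?l2norm_ge0. Qed.

Lemma op_leD S T a b : op_le S a -> op_le T b -> op_le (S + T) (a + b).
Proof. by move=> HS HT xi; rewrite operE mulrDl (le_trans (l2normD _ _))// lerD. Qed.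

Lemma op_leN T a : op_le T a -> op_le (- T) a.
Proof. by move=> HT xi; rewrite operE l2normN. Qed.

Lemma op_leB S T a b : op_le S a -> op_le T b -> op_le (S - T) (a + b).
Proof. by move=> HS HT; apply: op_leD => //; exact: op_leN. Qed.

Lemma op_leC S T a : op_le (S - T) a -> op_le (T - S) a.
Proof. by move=> H; rewrite -opprB; exact: op_leN. Qed.

Lemma op_leZ (c : R[i]) T a : op_le T a -> op_le (c *: T) (normc c * a).
Proof.
move=> HT xi; rewrite operE (le_trans (l2normZ _ _))// -mulrA ler_wpM2l//.
exact: normc_ge0.
Qed.

Lemma op_le_comp S T a b : 0 <= a -> op_le S a -> op_le T b -> op_le (S \o T) (a * b).
Proof. by move=> a0 HS HT xi; rewrite (le_trans (HS _))// -mulrA ler_wpM2l. Qed.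

Lemma op_le_dist S T U a b : op_le (S - T) a -> op_le (T - U) b -> op_le (S - U) (a + b).
Proof.
by move=> H1 H2; have := op_leD H1 H2; rewrite addrA subrK.
Qed.

Lemma bounded_ex T : bounded_op T -> exists2 M, 0 <= M & op_le T M.
Proof.
move=> [_ [M H]]; exists `|M| => //; apply: op_le_trans H; exact: ler_norm.
Qed.

Lemma bounded_opD S T : bounded_op S -> bounded_op T -> bounded_op (S + T).
Proof.
move=> [lS [a Ha]] [lT [b Hb]]; split; last by exists (a + b); exact: op_leD.
by move=> c u v; rewrite !operE lS lT scalerDr addrACA.
Qed.

Lemma bounded_opZ c T : bounded_op T -> bounded_op (c *: T).
Proof.
move=> [lT [b Hb]]; split; last by exists (normc c * b); exact: op_leZ.
by move=> a u v; rewrite !operE lT scalerDr !scalerA mulrC.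
Qed.

Lemma bounded_opN T : bounded_op T -> bounded_op (- T).
Proof. by move=> bT; rewrite -scaleN1r; exact: bounded_opZ. Qed.

Lemma bounded_opB S T : bounded_op S -> bounded_op T -> bounded_op (S - T).
Proof. by move=> bS bT; apply: bounded_opD => //; exact: bounded_opN. Qed.

Lemma bounded_op0 : bounded_op (0 : op).
Proof.
split; first by move=> a u v; rewrite !operE scaler0 addr0.
by exists 0 => xi; rewrite operE l2norm0 mul0r.
Qed.

Lemma bounded_comp S T : bounded_op S -> bounded_op T -> bounded_op (S \o T).
Proof.
move=> bS bT; have [a a0 Ha] := bounded_ex bS; have [b _ Hb] := bounded_ex bT.
split; first by move=> c u v /=; rewrite (proj1 bT) (proj1 bS).
by exists (a * b); exact: op_le_comp.
Qed.

Lemma op_eqP S T c : (forall e : R, 0 < e -> op_le (S - T) (c * e)) -> S = T.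
Proof.
move=> H; apply/funext => xi; apply: (@ell2_eqP _ _ _ _ _ (c * l2norm xi)) => e e0.
by have := H e e0 xi; rewrite mulrAC.
Qed.

(** An operator from a pointwise formula. The default 0 is junk where the formula is not
    square-summable; [opfP] rules this case out. *)
Definition opf (F : E2 -> G -> R[i]) : op := fun xi => odflt 0 (insub (F xi)).

Lemma opfP F M : 0 <= M ->
  (forall a xi eta g, F (a *: xi + eta) g = a * F xi g + F eta g) ->
  (forall xi A, uniq A -> \sum_(g <- A) normc (F xi g) ^+ 2 <= (M * l2norm xi) ^+ 2) ->
  [/\ bounded_op (opf F), op_le (opf F) M & forall xi g, opf F xi g = F xi g].
Proof.
move=> M0 lF bF.
have E xi g : opf F xi g = F xi g.
  rewrite /opf; case: insubP => [u _ <-//|]; case/negP.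
  exact: l2fun_ub (bF xi).
have HM : op_le (opf F) M.
  move=> xi; apply: l2norm_le => [|A uA]; first by rewrite mulr_ge0// l2norm_ge0.
  by under eq_bigr do rewrite E; exact: bF.
split=> //; split; last by exists M.
by move=> a u v; apply: ell2_ext => g; rewrite ell2D ell2Z !E.
Qed.

(** Both operators are continuous and finite combinations of the [delta h] are dense, so the matrix
    determines the operator. *)
Lemma op_ext S T : bounded_op S -> bounded_op T ->
  (forall h g, S (delta h) g = T (delta h) g) -> S = T.
Proof.
move=> bS bT H; have bD := bounded_opB bS bT.
have [M M0 HM] := bounded_ex bD.
have D0 h : (S - T) (delta h) = 0.
  by apply: ell2_ext => g; rewrite operE ell2D operE ell2N H subrr.
apply/funext => xi; apply: (@ell2_eqP _ _ _ _ _ M) => e e0.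
have [A uA HA] := restr_approx xi e0; have lD := proj1 bD.
have Z : (S - T) (restr (fun g => g \in A) xi) = 0.
  rewrite restr_fin// (linear_op_sum _ _ _ lD) big1// => g _.
  by rewrite linear_opZ// D0 scaler0.
rewrite -[S xi - T xi]/((S - T) xi) -(subrK (restr (fun g => g \in A) xi) xi).
by rewrite linear_opD// Z addr0 (le_trans (HM _))// ler_wpM2l.
Qed.

Lemma sub_op_closure (X : set op) : X `<=` @bounded_op k C R -> X `<=` op_closure X.
Proof.
move=> Xb T XT; split; first exact: Xb.
by move=> e e0; exists T => // xi; rewrite subrr l2norm0 mulr_ge0 ?l2norm_ge0 ?ltW.
Qed.

Lemma op_closureK (X : set op) : op_closure (op_closure X) `<=` op_closure X.
Proof.
move=> T [bT HT]; split=> // e e0; have e2 : 0 < e / 2 by rewrite divr_gt0.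
have [S [_ HS] TS] := HT _ e2; have [U XU SU] := HS _ e2.
by exists U => //; have := op_le_dist TS SU; rewrite -splitr.
Qed.

Lemma op_closureS (X Y : set op) : X `<=` Y -> op_closure X `<=` op_closure Y.
Proof.
move=> XY T [bT HT]; split=> // e e0; have [S XS TS] := HT _ e0.
by exists S => //; exact: XY.
Qed.

Lemma op_closureP (X : set op) T c : bounded_op T ->
  (forall e : R, 0 < e -> exists2 S, X S & op_le (T - S) (c * e)) -> op_closure X T.
Proof.
move=> bT H; split=> // e e0.
have c0 : 0 < `|c| + 1 by rewrite ltr_pwDr.
have [S XS TS] := H (e / (`|c| + 1)) (divr_gt0 e0 c0).
exists S => //; apply: op_le_trans TS; rewrite mulrCA.
apply: ler_piMr; first exact: ltW.
by rewrite ler_pdivrMr// mul1r (le_trans (ler_norm _))// lerDl.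
Qed.

Lemma op_closure_lin (X : set op) :
  (forall a S T, X S -> X T -> X (a *: S + T)) ->
  forall a S T, op_closure X S -> op_closure X T -> op_closure X (a *: S + T).
Proof.
move=> lX a S T [bS HS] [bT HT]; apply: (@op_closureP _ _ (normc a + 1)).
  by apply: bounded_opD => //; exact: bounded_opZ.
move=> e e0; have [S' XS' SS'] := HS _ e0; have [T' XT' TT'] := HT _ e0.
exists (a *: S' + T'); first exact: lX.
rewrite opprD addrACA -scalerBr mulrDl mul1r; apply: op_leD => //.
exact: op_leZ.
Qed.

End Operators.

(** * Contractive Schur multipliers given by labels *)

Section Blocks.
Context {k : nat} {C : hrGraph k} {R : realType} {I : finType} {K : choiceType}.
Notation G := (germ C).
Notation E2 := (ell2 C R).
Notation op := (oper C R).
Implicit Types (xi eta : E2) (A : seq G) (T : op).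
Variable kap : I -> G -> option K.

Definition has_label (l : K) (h : G) : bool := [exists i, kap i h == Some l].

(** A Schur multiplier: by [block_delta] the entry of T at (g, h) is scaled by the share of indices
    i for which [kap i g] is a label of h. Restricting the vector instead of scaling entries lets
    the bound of T act on each label separately. *)
Definition block_val T xi (g : G) : R[i] := #|I|%:R^-1 *
  \sum_i (if kap i g is Some l then T (restr (has_label l) xi) g else 0).
Definition block T : op := opf (block_val T).

Lemma sqr_sum_le (a : I -> R) : (\sum_i a i) ^+ 2 <= #|I|%:R * \sum_i a i ^+ 2.
Proof.
have [I0|I0] := posnP #|I|.
  rewrite I0 mul0r big1 ?expr0n// => i _.
  by have := fintype0 i I0.
have n0 : 0 < #|I|%:R :> R by rewrite ltr0n.
set s := \sum_i a i; set q := \sum_i _.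
have : 0 <= \sum_i (a i - s / #|I|%:R) ^+ 2 by apply: sumr_ge0 => i _; exact: sqr_ge0.
under eq_bigr do rewrite sqrrB; rewrite !big_split /= sumrN -/q.
rewrite sumr_const sumrMnl -big_distrl /= -/s -mulr_natl.
rewrite [X in 0 <= X -> _](_ : _ = q - s ^+ 2 / #|I|%:R); last first.
  by field; rewrite gt_eqF.
by rewrite mulr1 subr_ge0 ler_pdivrMr// [q * _]mulrC.
Qed.

Lemma normc_sum (J : Type) (r : seq J) (P : pred J) (F : J -> R[i]) :
  normc (\sum_(j <- r | P j) F j) <= \sum_(j <- r | P j) normc (F j).
Proof.
elim/big_rec2: _ => [|i x y _ H]; first by rewrite normc0.
by rewrite (le_trans (normcD _ _))// lerD2l.
Qed.

Lemma normc_invn n : normc (n%:R^-1 : R[i]) = n%:R^-1.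
Proof.
rewrite ComplexField.Normc.normcV; congr (_^-1).
have : `|n%:R : R[i]| = n%:R by rewrite ger0_norm.
rewrite normr_normc.
by rewrite -(rmorph_nat (real_complex R)) => /complexI.
Qed.

(** A germ carries at most one label per index, so it survives in at most [#|I|] of the
    restrictions. *)
Lemma sum_restr_le (L : seq K) xi : uniq L ->
  \sum_(l <- L) l2norm (restr (has_label l) xi) ^+ 2 <= #|I|%:R * l2norm xi ^+ 2.
Proof.
move=> uL; rewrite -lee_fin -sumEFin EFinM l2norm_sqr.
under eq_bigr do rewrite l2norm_sqr.
rewrite -esum_sum; last by move=> *; rewrite lee_fin sqr_ge0.
apply: (le_trans _ (@esumZ_le R G (fun g => (normc (xi g) ^+ 2)%:E) #|I|%:R _ _)).
2: by rewrite ler0n.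
2: by move=> g; rewrite lee_fin sqr_ge0.
apply: le_esum => g _; rewrite sumEFin -EFinM lee_fin.
rewrite (bigID (has_label^~ g)) /= [X in _ + X]big1 ?addr0; last first.
  by move=> l /negPf nl; rewrite restrE nl normc0 expr0n.
under eq_bigr => l hl do rewrite restrE hl.
rewrite -big_filter big_const_seq count_predT iter_addr_0 -[leLHS]mulr_natl.
rewrite ler_wpM2r ?sqr_ge0// ler_nat.
rewrite cardE -(size_map (kap^~ g)) -(size_map (@Some K)).
apply: uniq_leq_size; first by rewrite map_inj_uniq ?filter_uniq//; move=> ? ? [].
move=> _ /mapP[l + ->]; rewrite mem_filter => /andP[/existsP[i /eqP <-] _].
by apply: map_f; rewrite mem_enum.
Qed.

Hypothesis kap_inj : forall g i j l, kap i g = Some l -> kap j g = Some l -> i = j.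

(** The norm does not grow: the square of the prefactor is [#|I|^-2], Cauchy-Schwarz over the
    indices costs one factor [#|I|], and the overlap of the restrictions ([sum_restr_le]) costs the
    other. By [kap_inj] a row g meets each label at most once, so no further multiplicity
    appears. *)
Lemma blockP T M : 0 <= M -> linear T -> op_le T M ->
  [/\ bounded_op (block T), op_le (block T) M &
      forall xi g, block T xi g = block_val T xi g].
Proof.
move=> M0 lT HT; apply: opfP => // [a xi eta g|xi A uA].
  rewrite /block_val mulrCA -mulrDr; congr (_ * _).
  rewrite big_distrr -big_split /=; apply: eq_bigr => i _.
  case: (kap i g) => [l|]; last by rewrite mulr0 addr0.
  by rewrite restr_linear lT ell2D ell2Z.
have [I0|I0] := posnP #|I|.
  rewrite big1 ?sqr_ge0// => g _; rewrite /block_val I0 invr0 mul0r.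
  by rewrite normc0 expr0n.
have n0 : 0 < #|I|%:R :> R by rewrite ltr0n.
(* The finitely many labels that occur in the rows from A. *)
pose L := undup (seq.pmap id [seq kap i g | g <- A, i <- enum I]).
apply: (@le_trans _ _ (#|I|%:R^-1 * \sum_(l <- L) \sum_(g <- A)
   normc (T (restr (has_label l) xi) g) ^+ 2)); last first.
  rewrite ler_pdivrMl// (@le_trans _ _ (\sum_(l <- L)
     (M * l2norm (restr (has_label l) xi)) ^+ 2))//.
    apply: ler_sum => l _; apply: le_trans (sum_le_l2norm _ uA) _.
    by rewrite ler_pXn2r ?nnegrE ?mulr_ge0 ?l2norm_ge0.
  under eq_bigr do rewrite exprMn; rewrite -big_distrr /= exprMn mulrCA.
  by rewrite ler_wpM2l ?sqr_ge0// sum_restr_le// undup_uniq.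
rewrite exchange_big big_distrr /= big_seq [leRHS]big_seq; apply: ler_sum => g gA.
rewrite /block_val normcM normc_invn exprMn expr2 -mulrA ler_pM2l ?invr_gt0//.
rewrite ler_pdivrMl//; apply: le_trans (_ : _ <= (\sum_i normc
   (if kap i g is Some l then T (restr (has_label l) xi) g else 0)) ^+ 2) _.
  rewrite ler_pXn2r ?nnegrE ?normc_ge0 ?sumr_ge0// => [|i _]; last exact: normc_ge0.
  exact: normc_sum.
apply: le_trans (sqr_sum_le _) _; rewrite ler_pM2l//.
pose F l := normc (T (restr (has_label l) xi) g) ^+ 2.
have E i : normc (if kap i g is Some l then T (restr (has_label l) xi) g else 0) ^+ 2
   = \sum_(l <- L | kap i g == Some l) F l.
  case E : (kap i g) => [l|]; last by rewrite normc0 expr0n big1.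
  have lL : l \in L.
    rewrite mem_undup mem_pmap; apply/mapP; exists (Some l) => //.
    by rewrite -E; apply/allpairsP; exists (g, i); rewrite mem_enum.
  rewrite (eq_bigl (pred1 l)); last by move=> m; rewrite eq_sym; apply/eqP/eqP => [[]|->].
  by rewrite -big_filter filter_pred1_uniq ?undup_uniq// big_seq1.
rewrite (eq_bigr _ (fun i _ => E i)) (exchange_big_dep xpredT)//=.
(* For a fixed label l at most one index contributes: two of them would contradict [kap_inj]. *)
apply: ler_sum => l _; rewrite -big_filter /=.
have [->|] := eqVneq [seq i <- index_enum I | kap i g == Some l] [::].
  by rewrite big_nil sqr_ge0.
case E2 : [seq i <- _ | _] => [|i s] // _; rewrite big_cons.
have := filter_uniq (fun i => kap i g == Some l) (index_enum_uniq I).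
have := mem_filter (fun i => kap i g == Some l) ^~ (index_enum I); rewrite E2 => Hm.
case: s E2 Hm => [|j s] E2 Hm; first by rewrite big_nil addr0.
have /andP[/eqP Hi _] : (kap i g == Some l) && (i \in index_enum I).
  by rewrite -Hm mem_head.
have /andP[/eqP Hj _] : (kap j g == Some l) && (j \in index_enum I).
  by rewrite -Hm !inE eqxx orbT.
by rewrite (kap_inj Hi Hj) /= mem_head.
Qed.

Lemma block_delta T h g : linear T ->
  block_val T (delta h) g = #|I|%:R^-1 *
  \sum_i (if kap i g is Some l then (has_label l h)%:R else 0) * T (delta h) g.
Proof.
move=> lT; congr (_ * _); apply: eq_bigr => i _.
case: (kap i g) => [l|]; last by rewrite mul0r.
rewrite restr_delta; case: has_label; first by rewrite mul1r.
by rewrite linear_op0// ell20 mul0r.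
Qed.

End Blocks.

(** * Boundary characters and germs *)

Lemma near_seq (T : topologicalType) (I : eqType) (x : T) (P : I -> T -> Prop) (s : seq I) :
  (forall i, i \in s -> \forall y \near x, P i y) ->
  \forall y \near x, forall i, i \in s -> P i y.
Proof.
elim: s => [|i s IH] H; first exact: filterE.
have H1 := H i (mem_head _ _).
have H2 : \forall y \near x, forall j, j \in s -> P j y.
  by apply: IH => j js; apply: H; rewrite inE js orbT.
apply: filterS2 H1 H2 => y Pi Ps j.
by rewrite inE => /orP[/eqP->//|/Ps].
Qed.

Section BoundaryCharacters.
Context {k : nat} {C : hrGraph k}.
Implicit Types (x y : bdry C) (e f : J C) (s t : Il C).

Definition ev x e : bool := (val x : Jmap C) e.

Lemma bdry_char x : characters (val x : Jmap C).
Proof. by have [] := bdryP x. Qed.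

Lemma ev_cap x e f : ev x (Jcap e f) = ev x e && ev x f.
Proof. by have [_ + _] := bdry_char x; exact. Qed.

Lemma ev_le x e f : val e `<=` val f -> ev x e -> ev x f.
Proof. exact: char_le (bdry_char x). Qed.

Lemma ev_ne x e : ev x e -> exists u, val e u.
Proof.
move=> xe; have [_ _ x0] := bdry_char x; apply: contrapT => /forallNP H.
have e0 : val e = set0 by apply/seteqP; split=> // u /H.
by move: (x0 e e0) xe; rewrite /ev => ->.
Qed.

Lemma ev_ex x : exists e, ev x e. Proof. by have [] := bdry_char x. Qed.

Lemma bdry_ext x y : (forall e, ev x e = ev y e) -> x = y.
Proof. by move=> H; apply: val_inj; apply/funext. Qed.

Lemma Jdom_ex e : exists s, e = Jdom s.
Proof. by have [s hs E] := JP e; exists (mkIl hs); apply: J_eq. Qed.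

(** If f met every member of chi, then chi and f would generate a filter of nonempty sets;
    maximality would make it equal to chi, so f would belong to chi. *)
Lemma max_char_disj (chi : Jmap C) f : max_characters chi -> ~~ chi f ->
  exists2 e, chi e & val e `&` val f = set0.
Proof.
move=> [cc cm] nf; apply: contrapT => H.
have ne e : chi e -> exists u, val e u /\ val f u.
  move=> ce; apply: contrapT => /forallNP H'; apply: H; exists e => //.
  by apply/seteqP; split=> // u /H'.
have [[e0 ce0] cM c0] := cc.
(* The filter generated by chi and f. *)
pose psi : Jmap C := fun g => `[< exists2 e, chi e & val (Jcap e f) `<=` val g >].
have psiE g e : chi e -> val e `&` val f `<=` val g -> psi g.
  by move=> ce sub; apply/asboolP; exists e.
have pc : characters psi.
  split.
  - by exists f; apply: psiE ce0 _ => u [].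
  - move=> g h; apply/idP/andP => [/asboolP[e ce sub]|[]].
      by split; apply: psiE ce _ => u /sub[].
    move=> /asboolP[e ce sub] /asboolP[e' ce' sub'].
    apply: (psiE _ (Jcap e e')); first by rewrite cM ce.
    by move=> u [[eu e'u] fu]; split; [exact: sub|exact: sub'].
  - move=> g g0; apply/negbTE/negP => /asboolP[e ce sub].
    by have [u [eu fu]] := ne e ce; have := sub u (conj eu fu); rewrite g0.
have E : psi = chi by apply: cm => // e ce; apply: psiE ce _ => u [].
by move: nf; rewrite -E => /negP; apply; apply: psiE ce0 _ => u [].
Qed.

Lemma nbhs_ev (chi : Jmap C) e : nbhs chi [set psi : Jmap C | psi e = chi e].
Proof.
have : nbhs (chi e) [set b | b = chi e] by apply/principal_filterP.
by move=> /(@Defs.eval_continuous _ _ e chi).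
Qed.

(* Boundary characters are prime with respect to finite unions: an ultrafilter
   avoiding every member of the cover would contain the empty set. *)
Lemma ev_cover x e (fs : seq (J C)) : ev x e ->
  (forall u, val e u -> exists2 f, f \in fs & val f u) ->
  exists2 f, f \in fs & ev x f.
Proof.
move=> xe cov; apply: contrapT => H.
have nf f : f \in fs -> ev x f = false.
  by move=> ffs; apply/negbTE/negP => xf; apply: H; exists f.
have [_ cl] := bdryP x.
have nB : nbhs (val x : Jmap C)
    [set psi : Jmap C | psi e /\ forall f, f \in fs -> psi f = false].
  have : nbhs (val x : Jmap C) [set psi : Jmap C | forall f, f \in fs -> psi f = false].
    apply: (near_seq (P := fun f (psi : Jmap C) => psi f = false)) => f /nf <-.
    exact: nbhs_ev.
  apply: filterS2 (@nbhs_ev (val x) e) => psi /= -> ?; split=> //.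
have [psi [pm [pe pf]]] := cl _ nB.
have [[_ pM p0] _] := pm.
have [e' [pe' ee' dis]] : exists e', [/\ psi e', val e' `<=` val e &
    forall f, f \in fs -> val e' `&` val f = set0].
  elim: fs pf {H cov nf nB} => [|f fs IH] pf; first by exists e; split.
  have [|e1 [p1 s1 d1]] := IH; first by move=> g gfs; apply: pf; rewrite inE gfs orbT.
  have [|e2 p2 d2] := @max_char_disj psi f pm.
    by rewrite pf// inE eqxx.
  exists (Jcap e1 e2); split; first by rewrite pM p1.
    by move=> u [/s1].
  move=> g; rewrite inE => /orP[/eqP->|/d1 d].
    by apply/seteqP; split=> // u [[_ u2] ug]; rewrite -d2.
  by apply/seteqP; split=> // u [[u1 _] ug]; rewrite -d.
have : psi e' = false.
  apply: p0; apply/seteqP; split=> // u eu.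
  by have [f ffs fu] := cov u (ee' u eu); rewrite -(dis f ffs).
by rewrite pe'.
Qed.

End BoundaryCharacters.

(** * Calculus of germs: translation, quotient, units *)

Section Germs.
Context {k : nat} {C : hrGraph k}.
Implicit Types (x y : bdry C) (e f : J C) (s t : Il C) (g h : germ C).

Lemma Il_fun s u v v' : val s (u, v) -> val s (u, v') -> v = v'.
Proof. exact: (proj1 (inIl_pbij (IlP s))). Qed.
Lemma Il_inj s u u' v : val s (u, v) -> val s (u', v) -> u = u'.
Proof. exact: (proj2 (inIl_pbij (IlP s))). Qed.

Lemma Il_mulE s t u v : val (Il_mul s t) (u, v) <-> exists2 w, val t (u, w) & val s (w, v).
Proof. by []. Qed.
Definition mk_rep s x (h : bdom s x) : rep C := existT _ s (SigSub (mem_set h)).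

Lemma bdom_ex x : exists s, bdom (Il_mul (Il_inv s) s) x.
Proof.
have [e xe] := ev_ex x; have [s E] := Jdom_ex e; exists s.
apply: ev_le xe; rewrite E => u [v uv]; exists u; exists v => //.
Qed.

(** A chosen idempotent defined at x. There need not be an identity in I_l (infinitely many vertices
    are allowed), so the unit germ at x has to be represented locally. *)
Definition uel x : Il C := Il_mul (Il_inv (projT1 (cid (bdom_ex x)))) (projT1 (cid (bdom_ex x))).
Lemma bdom_uel x : bdom (uel x) x.
Proof. by rewrite /uel; case: cid. Qed.
Lemma uelE x u v : val (uel x) (u, v) -> u = v.
Proof.
rewrite /uel; case: cid => s /= _ [w uw /= vw].
exact: Il_inj uw vw.
Qed.

(* [s, x], with the unit at x as junk value when x is outside the domain of s *)
Definition mk s x : germ C :=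
  if pselect (bdom s x) is left h then mkgerm (mk_rep h) else mkgerm (mk_rep (bdom_uel x)).

Lemma mkE s x (h : bdom s x) : mk s x = mkgerm (mk_rep h).
Proof. by rewrite /mk; case: pselect => // h'; congr (mkgerm (mk_rep _)); exact: Prop_irrelevance. Qed.

Lemma mkgerm_eq (p q : rep C) : mkgerm p = mkgerm q <-> germ_eq p q.
Proof. by split=> [/eqmodP//|H]; apply/eqmodP. Qed.

Lemma mk_eqP s t x y : bdom s x -> bdom t y -> mk s x = mk t y <->
  x = y /\ exists2 e, ev x e & forall u v, val e u -> val s (u, v) <-> val t (u, v).
Proof.
move=> hs ht; rewrite (mkE hs) (mkE ht) mkgerm_eq.
split=> [/germ_eqP|H]; first by [].
exact/germ_eqP.
Qed.

Lemma mk_eqI s t x e : bdom s x -> ev x e ->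
  (forall u v, val e u -> val s (u, v) <-> val t (u, v)) -> bdom t x /\ mk s x = mk t x.
Proof.
move=> hs xe H; have ht : bdom t x.
  have : ev x (Jcap e (Jdom s)) by rewrite ev_cap xe.
  by apply: ev_le => u [eu [v sv]]; exists v; apply/H.
by split=> //; apply/(mk_eqP hs ht); split=> //; exists e.
Qed.

Lemma src_mk s x : src (mk s x) = x.
Proof. by rewrite /mk; case: pselect => h; rewrite src_mkgerm /rep_src. Qed.

(** The action s.x made total; x is a junk value outside the domain. *)
Definition sact s x : bdry C :=
  if pselect (bdom s x) is left h then rep_ran (mk_rep h) else x.

Lemma ran_mk s x : bdom s x -> ran (mk s x) = sact s x.
Proof.
move=> h; rewrite /mk /sact; case: pselect => // h'; exact: ran_mkgerm.
Qed.

Lemma ev_sact s x e : bdom s x -> ev (sact s x) e = ev x (Jpre s e).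
Proof. by move=> h; rewrite /sact; case: pselect. Qed.

Definition gel g : Il C := rep_elt (repr (g : {eq_quot (germ_equiv C)})).

Lemma bdom_gel g : bdom (gel g) (src g). Proof. exact: rep_dom. Qed.

Lemma mk_gel g : mk (gel g) (src g) = g.
Proof.
have H p (h : bdom (rep_elt p) (rep_src p)) : mk_rep h = p.
  by case: p h => s x h; rewrite /mk_rep; congr existT; exact: val_inj.
by rewrite (mkE (bdom_gel g)) H; exact: (reprK (g : {eq_quot (germ_equiv C)})).
Qed.

Lemma ran_gel g : ran g = sact (gel g) (src g).
Proof. by rewrite -{1}(mk_gel g) ran_mk//; exact: bdom_gel. Qed.

Lemma bdom_mul s t x : bdom (Il_mul s t) x <-> bdom t x /\ bdom s (sact t x).
Proof.
have E : Jdom (Il_mul s t) = Jpre t (Jdom s).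
  apply: J_eq; apply/seteqP; split=> u.
    by move=> [v [w uw wv]]; exists w => //; exists v.
  by move=> [w uw [v wv]]; exists v; exists w.
rewrite /bdom /= E; split=> [H|[ht hs]]; last by move: hs; rewrite -/(ev _ _) ev_sact.
have ht : bdom t x by apply: ev_le H => u [w uw _]; exists w.
by split=> //; rewrite -/(ev _ _) ev_sact.
Qed.

Lemma sact_mul s t x : bdom (Il_mul s t) x -> sact (Il_mul s t) x = sact s (sact t x).
Proof.
move=> h; have [ht hs] := proj1 (bdom_mul _ _ _) h.
apply: bdry_ext => e; rewrite !ev_sact//; congr (ev x); apply: J_eq.
apply/seteqP; split=> u.
  by move=> [v [w uw wv] ev]; exists w => //; exists v.
by move=> [w uw [v wv] ev]; exists v => //; exists w.
Qed.

Lemma bdom_inv s x : bdom s x -> bdom (Il_inv s) (sact s x).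
Proof.
move=> h; rewrite /bdom /= -/(ev _ _) ev_sact//; apply: ev_le h => u [v uv].
by exists v => //; exists u.
Qed.

Lemma sactK s x : bdom s x -> sact (Il_inv s) (sact s x) = x.
Proof.
move=> h; have hi := bdom_inv h.
by apply: bdry_ext => e; have := actKV e (bdry_char x) h; rewrite !ev_sact.
Qed.

Lemma bdom_inv' s y : bdom (Il_inv s) y -> bdom s (sact (Il_inv s) y).
Proof. by move=> /bdom_inv; rewrite Il_invK. Qed.

Lemma sactVK s y : bdom (Il_inv s) y -> sact s (sact (Il_inv s) y) = y.
Proof. by move=> /sactK; rewrite Il_invK. Qed.

(* left translation [s, ran g] g *)
Definition gm s g : germ C := mk (Il_mul s (gel g)) (src g).

Lemma src_gm s g : src (gm s g) = src g. Proof. exact: src_mk. Qed.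

Lemma gm_mk s t x : bdom t x -> bdom s (sact t x) -> gm s (mk t x) = mk (Il_mul s t) x.
Proof.
move=> ht hs; rewrite /gm; set g := mk t x.
have E : src g = x by exact: src_mk.
have := mk_gel g; rewrite E => /(mk_eqP _ ht); rewrite -{1}E => /(_ (bdom_gel g)).
move=> [_ [e xe H]]; symmetry.
apply: (proj2 (mk_eqI _ xe _)); first exact/bdom_mul.
by move=> u v eu; split=> -[w uw wv]; exists w => //; exact/H.
Qed.

Lemma gm_bdom s g : bdom s (ran g) -> bdom (Il_mul s (gel g)) (src g).
Proof. by move=> h; apply/bdom_mul; rewrite -ran_gel; split=> //; exact: bdom_gel. Qed.

Lemma ran_gm s g : bdom s (ran g) -> ran (gm s g) = sact s (ran g).
Proof. by move=> /gm_bdom h; rewrite ran_mk// sact_mul// -ran_gel. Qed.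

Lemma Il_mulA s t r : Il_mul s (Il_mul t r) = Il_mul (Il_mul s t) r.
Proof.
apply: val_inj; apply/seteqP; split=> -[u v].
  by move=> [w [z uz zw] wv]; exists z => //; exists w.
by move=> [w uw [z wz zv]]; exists z => //; exists w.
Qed.

Lemma gm_gm s t g : bdom t (ran g) -> bdom s (sact t (ran g)) ->
  gm s (gm t g) = gm (Il_mul s t) g.
Proof.
move=> ht hs; rewrite {2}/gm gm_mk ?Il_mulA//; first exact: gm_bdom.
by rewrite sact_mul -?ran_gel//; exact: gm_bdom.
Qed.

Lemma gmK s g : bdom s (ran g) -> gm (Il_inv s) (gm s g) = g.
Proof.
move=> h; rewrite gm_gm//; last exact: bdom_inv.
rewrite /gm -[RHS]mk_gel; symmetry.
apply: (proj2 (mk_eqI _ (gm_bdom h) _)); first exact: bdom_gel.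
move=> u v [z [w uw wz]]; split=> [uv|].
  by exists w => //; exists z => //; rewrite -(Il_fun uw uv).
move=> [w' uw' [z' wz' vz']].
by have -> : v = w' by exact: (@Il_inj s v w' z' vz' wz').
Qed.

Definition un x : germ C := mk (uel x) x.

Lemma src_un x : src (un x) = x. Proof. exact: src_mk. Qed.

Lemma mk_un s x : bdom s x -> (forall u v, val s (u, v) -> u = v) -> mk s x = un x.
Proof.
move=> h hs; have xe : ev x (Jcap (Jdom s) (Jdom (uel x))).
  by rewrite ev_cap; apply/andP; split=> //; exact: bdom_uel.
apply: (proj2 (mk_eqI h xe _)) => u v [[a ua] [b ub]].
have Ea := hs _ _ ua; have Eb := uelE ub; subst a b; split=> uv.
  by rewrite -(hs _ _ uv).
by rewrite -(uelE uv).
Qed.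

Lemma sact_id s x : bdom s x -> (forall u v, val s (u, v) -> u = v) -> sact s x = x.
Proof.
move=> h hs; apply: bdry_ext => e; rewrite ev_sact//; apply/idP/idP.
  by apply: ev_le => u [v /hs ->].
move=> xe; have : ev x (Jcap e (Jdom s)) by rewrite ev_cap xe.
by apply: ev_le => u [eu [v uv]]; exists v => //; rewrite -(hs _ _ uv).
Qed.

Lemma ran_un x : ran (un x) = x.
Proof. by rewrite ran_mk; [apply: sact_id (@uelE x)|]; exact: bdom_uel. Qed.

Lemma gm_un s x : bdom s x -> gm s (un x) = mk s x.
Proof.
move=> h; have hu := bdom_uel x.
have E : sact (uel x) x = x by apply: sact_id (@uelE x).
rewrite gm_mk ?E//; symmetry; apply: (proj2 (mk_eqI (e := Jdom (uel x)) h _ _)) => //.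
move=> u v [w uw]; have Ew := uelE uw; subst w; split=> [uv|[w uw' wv]].
  by exists u.
by rewrite (Il_fun uw uw').
Qed.

(* g h^-1, meaningful when src g = src h *)
Definition gdiv g h : germ C := mk (Il_mul (gel g) (Il_inv (gel h))) (ran h).

Lemma src_gdiv g h : src (gdiv g h) = ran h. Proof. exact: src_mk. Qed.

Lemma gdiv_bdom g h : src g = src h -> bdom (Il_mul (gel g) (Il_inv (gel h))) (ran h).
Proof.
move=> E; apply/bdom_mul; rewrite ran_gel; split; first exact/bdom_inv/bdom_gel.
by rewrite sactK; [rewrite -E|]; exact: bdom_gel.
Qed.

Lemma ran_gdiv g h : src g = src h -> ran (gdiv g h) = ran g.
Proof.
move=> E; have H := gdiv_bdom E; rewrite ran_mk// sact_mul// !ran_gel.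
by rewrite sactK ?E//; exact: bdom_gel.
Qed.

Lemma gdivK g h : src g = src h -> gm (Il_mul (gel g) (Il_inv (gel h))) h = g.
Proof.
move=> E; have H := gdiv_bdom E; rewrite -[RHS]mk_gel /gm -E; symmetry.
apply: (proj2 (mk_eqI (bdom_gel g) (e := Jcap (Jdom (gel g)) (Jdom (gel h))) _ _)).
  by rewrite ev_cap; apply/andP; split; [|rewrite E]; exact: bdom_gel.
move=> u v [_ [w hw]]; split=> [uv|[w' hw' [u' uu' uv]]].
  by exists w => //; exists u.
by rewrite (Il_inj (hw' : val (gel h) (u, w')) uu').
Qed.

Lemma gdiv_gm s h : bdom s (ran h) -> gdiv (gm s h) h = mk s (ran h).
Proof.
move=> H; have E : src (gm s h) = src h by exact: src_gm.
have hb := gdiv_bdom E.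
have : gm (Il_mul (gel (gm s h)) (Il_inv (gel h))) h = gm s h by exact: gdivK.
set t := Il_mul _ _ in hb *; rewrite /gdiv -/t.
move=> /(mk_eqP (gm_bdom hb) (gm_bdom H)) [_ [e xe He]].
(* The neighbourhood e of [src h], on which the two products agree, is carried by h to a
   neighbourhood of [ran h]. *)
apply: (proj2 (mk_eqI (e := Jpre (Il_inv (gel h)) e) hb _ _)).
  rewrite -ev_sact; last by rewrite ran_gel; exact/bdom_inv/bdom_gel.
  by rewrite ran_gel sactK//; exact: bdom_gel.
move=> u v [w uw ew]; have wu : val (gel h) (w, u) := uw.
have := He w v ew; rewrite !Il_mulE => -[H1 H2].
split=> uv.
  have [u' wu' u'v] := H1 (ex_intro2 _ _ u wu uv).
  by rewrite -(Il_fun wu' wu).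
have [u' wu' u'v] := H2 (ex_intro2 _ _ u wu uv).
by rewrite -(Il_fun wu' wu).
Qed.

(** The working characterisation of the quotient: [gdiv] is defined through chosen representatives,
    whereas here any s may represent it. *)
Lemma gdiv_mkP s g h : src g = src h -> bdom s (ran h) ->
  gdiv g h = mk s (ran h) <-> g = gm s h.
Proof.
move=> E H; split=> [Eg|->]; last exact: gdiv_gm.
rewrite -{1}(gdivK E) /gm; have hb := gdiv_bdom E.
have [_ [e xe He]] := proj1 (mk_eqP hb H) Eg.
set t := Il_mul _ _ in hb xe He Eg *.
apply: (proj2 (mk_eqI (e := Jpre (gel h) e) (gm_bdom hb) _ _)).
  by rewrite -ev_sact; [rewrite -ran_gel|exact: bdom_gel].
move=> u v [w uw ew]; split=> -[w' uw' w'v]; exists w' => //.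
  by apply/He => //; rewrite -(Il_fun uw uw').
by apply/He => //; rewrite -(Il_fun uw uw').
Qed.

Lemma gdiv_un g : gdiv g (un (src g)) = g.
Proof.
have E : src g = src (un (src g)) by rewrite src_un.
have H : bdom (gel g) (ran (un (src g))) by rewrite ran_un; exact: bdom_gel.
apply: etrans (proj2 (gdiv_mkP E H) _) _.
  by rewrite gm_un ?mk_gel//; exact: bdom_gel.
by rewrite ran_un mk_gel.
Qed.

Lemma gdivv h : gdiv h h = un (ran h).
Proof.
have H := bdom_uel (ran h); apply/(gdiv_mkP erefl H).
rewrite -{1}(mk_gel h) /gm.
apply: (proj2 (mk_eqI (e := Jpre (gel h) (Jdom (uel (ran h)))) (bdom_gel h) _ _)).
  by rewrite -ev_sact -?ran_gel//; exact: bdom_gel.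
move=> u v [w uw [z wz]]; have Ez := uelE wz; subst z; split=> [uv|[w' uw' w'v]].
  by exists w => //; rewrite -(Il_fun uw uv).
by have <- : w' = v := uelE w'v.
Qed.

Lemma gdiv_inj g g' h : src g = src h -> src g' = src h -> gdiv g h = gdiv g' h -> g = g'.
Proof.
move=> E E' Eg; have H' := gdiv_bdom E'.
by rewrite -(gdivK E'); apply/(gdiv_mkP E H'); rewrite Eg.
Qed.

Lemma mkgermE (p : rep C) :
  mkgerm p = mk (rep_elt p) (rep_src p) /\ bdom (rep_elt p) (rep_src p).
Proof.
have h : bdom (rep_elt p) (rep_src p) := rep_dom p.
split=> //; rewrite (mkE h); congr mkgerm.
by case: p h => s x h; rewrite /mk_rep; congr existT; exact: val_inj.
Qed.

(** Solves ah = g for a, which shows that convolution by f has the matrix f(g h^-1). *)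
Lemma gprodP a h g : gprod a h g <-> src g = src h /\ a = gdiv g h.
Proof.
split=> [[p [q [r [[-> -> ->] [E1 E2 E3]]]]]|[E ->]].
  have [Ep hp] := mkgermE p; have [Eq hq] := mkgermE q; have [Er hr] := mkgermE r.
  rewrite !src_mkgerm; split=> //; rewrite Ep Eq Er E3 E2.
  have sq : sact (rep_elt q) (rep_src q) = rep_src p by rewrite E1 -ran_mk// -Eq ran_mkgerm.
  have hp' : bdom (rep_elt p) (sact (rep_elt q) (rep_src q)) by rewrite sq.
  by rewrite -gm_mk// gdiv_gm ?ran_mk// sq.
have hg := gdiv_bdom E; set s := Il_mul _ _ in hg.
have h3 := gm_bdom hg.
exists (mk_rep hg), (mk_rep (bdom_gel h)), (mk_rep h3); split; split => //.
- by rewrite -mkE.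
- by rewrite -mkE mk_gel.
- by rewrite -mkE -[LHS](gdivK E).
by rewrite -ran_mkgerm -mkE mk_gel.
Qed.

Lemma gunitP g : gunit g <-> g = un (src g).
Proof.
split=> [[s [p [E ->]]]|->].
  have [-> h0] := mkgermE p.
  rewrite src_mk; apply: mk_un => // u v; rewrite E => -[w uw vw].
  exact: Il_inj uw vw.
rewrite /un; exists (projT1 (cid (bdom_ex (src g)))), (mk_rep (bdom_uel (src g))).
by split=> //; rewrite -mkE.
Qed.

Definition ginv g : germ C := gdiv (un (src g)) g.

Lemma src_ginv g : src (ginv g) = ran g. Proof. exact: src_gdiv. Qed.
Lemma ran_ginv g : ran (ginv g) = src g.
Proof. by rewrite ran_gdiv ?ran_un// src_un. Qed.

End Germs.

(** * Paths and fractions *)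

Section Paths.
Context {k : nat} {C : hrGraph k}.
Implicit Types (a b c d f w x y : C).

Lemma ffun_natD (p q : {ffun 'I_k -> nat}) i : (p + q) i = (p i + q i)%N.
Proof. by rewrite ffunE. Qed.

Lemma ffun_natI (p q r : {ffun 'I_k -> nat}) : p + q = p + r -> q = r.
Proof. by move=> /ffunP D; apply/ffunP => i; have := D i; rewrite !ffunE => /addnI. Qed.

(** Unique factorization in its usable form: the degree of the first factor already fixes both
    factors. *)
Lemma comp_inj a x a' x' : dm a = tg x -> dm a' = tg x' -> deg a = deg a' ->
  comp a x = comp a' x' -> a = a' /\ x = x'.
Proof.
move=> ax ax' Ed E; have Ex : deg x = deg x'.
  by have := congr1 (@deg _ C) E; rewrite !deg_comp// Ed => /ffun_natI.
have [ab [_ U]] := deg_fact (deg_comp ax).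
have E1 : ab = (a, x) by apply: U.
have E2 : ab = (a', x') by apply: U; split; rewrite //= ?Ed ?Ex.
by move: (etrans (esym E1) E2) => -[].
Qed.

Lemma prefix_ex c (p : {ffun 'I_k -> nat}) : (forall i, (p i <= deg c i)%N) ->
  exists a x, [/\ dm a = tg x, c = comp a x & deg a = p].
Proof.
move=> H; have E : deg c = p + [ffun i => (deg c i - p i)%N].
  by apply/ffunP => i; rewrite !ffunE; apply/esym/subnKC.
by have [[a x] [[/= h1 h2 h3 _] _]] := deg_fact E; exists a, x.
Qed.

Lemma ridealE a c : rideal a c <-> exists w, dm a = tg w /\ c = comp a w.
Proof. by split=> [[w /= aw <-]|[w [aw ->]]]; exists w. Qed.

Lemma rideal_comp a w : dm a = tg w -> rideal a (comp a w).
Proof. by move=> h; exists w. Qed.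

Lemma dm_tg_dm a : dm a = tg (dm a). Proof. by rewrite (tgI (dm_id a)). Qed.

Lemma rideal_refl a : rideal a a.
Proof. by exists (dm a); rewrite /= -?dm_tg_dm ?comp_dm. Qed.

Lemma rideal_trans a b c : rideal a b -> rideal b c -> rideal a c.
Proof.
move=> [w /= aw <-] [z /= bz <-]; rewrite -compA//; last by rewrite -bz dm_comp.
apply: rideal_comp; rewrite tg_comp//; last by rewrite -bz dm_comp.
Qed.

Lemma deg_rideal a c i : rideal a c -> (deg a i <= deg c i)%N.
Proof. by move=> [w /= aw <-]; rewrite deg_comp// ffunE leq_addr. Qed.

Lemma rideal_eq a c : rideal a c -> deg a = deg c -> a = c.
Proof.
move=> [w /= aw Ec] E; have H : comp a w = comp c (dm c) by rewrite comp_dm.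
by have [] := comp_inj aw (dm_tg_dm c) E H.
Qed.

(** Factor b at the degree of a; both a and this prefix of b are prefixes of c of the same degree,
    hence equal. *)
Lemma rideal_le a b c : rideal a c -> rideal b c ->
  (forall i, (deg a i <= deg b i)%N) -> rideal a b.
Proof.
move=> [w /= aw Ec] [z /= bz Ec'] /prefix_ex[a' [y [ay Eb Ea]]].
subst b; have yz : dm y = tg z by rewrite -bz dm_comp.
have E : comp a' (comp y z) = comp a w by rewrite compA// Ec' Ec.
have [|<- _] := comp_inj _ aw Ea E; first by rewrite tg_comp.
exact: rideal_comp.
Qed.

Lemma rideal_cancel b x y : dm b = tg x -> dm b = tg y ->
  rideal (comp b x) (comp b y) -> rideal x y.
Proof.
move=> bx b_y [w /= xw E]; have xw' : dm x = tg w by rewrite -xw dm_comp.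
rewrite -compA// in E.
have := comp_inj _ b_y erefl E; rewrite tg_comp// => /(_ bx)[_ <-].
exact: rideal_comp.
Qed.

Definition tail a c : C :=
  if pselect (rideal a c) is left h then projT1 (cid (proj1 (ridealE a c) h)) else c.

Lemma tailP a c : rideal a c -> dm a = tg (tail a c) /\ c = comp a (tail a c).
Proof. by rewrite /tail; case: pselect => // h _; case: cid. Qed.

Definition mce a b f := [/\ rideal a f, rideal b f &
  deg f = [ffun i => maxn (deg a i) (deg b i)]].

Lemma mce_ex a b c : rideal a c -> rideal b c -> exists2 f, mce a b f & rideal f c.
Proof.
move=> ac bc; have [|f [z [fz Ec Ef]]] := @prefix_ex c [ffun i => maxn (deg a i) (deg b i)].
  by move=> i; rewrite ffunE geq_max !deg_rideal.
have fc : rideal f c by rewrite Ec; exact: rideal_comp.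
exists f => //; split=> //.
  by apply: rideal_le ac fc _ => i; rewrite Ef ffunE leq_maxl.
by apply: rideal_le bc fc _ => i; rewrite Ef ffunE leq_maxr.
Qed.

(** Such an f lies in gC for some g of the finite set given by alignment; g is itself a common
    extension, so its degree is at least that of f, and f = g. *)
Lemma mce_finite a b : finitely_aligned C -> finite_set [set f | mce a b f].
Proof.
move=> /(_ a b)[F finF E]; apply: sub_finite_set finF => f [af bf Ef].
have : (rideal a `&` rideal b) f by [].
rewrite E => -[g Fg gf]; suff -> : f = g by [].
have [ag bg] : (rideal a `&` rideal b) g by rewrite E; exists g => //; exact: rideal_refl.
apply/esym; apply: rideal_eq => //; apply/ffunP => i; apply/eqP.
by rewrite eqn_leq deg_rideal// Ef ffunE geq_max !deg_rideal.
Qed.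

End Paths.

(** * Fractions, the degree cocycle and isotropy *)

Section Fractions.
Context {k : nat} {C : hrGraph k}.
Hypothesis halign : finitely_aligned C.
Implicit Types (x y : bdry C) (e f : J C) (s t : Il C) (g h : germ C) (c d u v w : C).

(** The right ideal cC, written as the domain of c^-1 so that it is visibly an element of J. *)
Definition cyl c : J C := Jdom (Il_inv (mkIl (inIl_gen c))).

Lemma cylE c u : val (cyl c) u <-> rideal c u.
Proof. by split=> [[w [/= cw ->]]|[w /= cw <-]]; [exact: rideal_comp|exists w]. Qed.

Lemma fracE c d u v : val (Il_frac c d) (u, v) <->
  exists w, [/\ dm d = tg w, u = comp d w, dm c = tg w & v = comp c w].
Proof.
split=> [[w [/= h1 h2] [/= h3 h4]]|[w [h1 h2 h3 h4]]]; first by exists w.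
by exists w.
Qed.

Lemma bdom_frac c d x : dm c = dm d -> bdom (Il_frac c d) x <-> ev x (cyl d).
Proof.
move=> cd; rewrite /bdom /= -/(ev _ _); suff -> : Jdom (Il_frac c d) = cyl d by [].
apply: J_eq; apply/seteqP; split=> u.
  by move=> [v /fracE[w [h1 -> h3 h4]]]; apply/cylE/rideal_comp.
by move=> /cylE[w /= h <-]; exists (comp c w); apply/fracE; exists w; rewrite cd.
Qed.

(** Finite alignment enters in the product: a point passing through q1 q2^-1 and then p1 p2^-1 goes
    through a common extension of q1 and p2, hence through one of their finitely many minimal ones,
    and each of these contributes one fraction. *)
Lemma Il_union_frac (s : pmap C) : inIl s -> exists P : set (C * C),
  [/\ finite_set P, forall p, P p -> dm p.1 = dm p.2 &
   forall u v, s (u, v) <-> exists2 p, P p & val (Il_frac p.1 p.2) (u, v)].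
Proof.
elim=> [c|{}s t _ [P [finP dP HP]] _ [Q [finQ dQ HQ]]|{}s _ [P [finP dP HP]]].
- exists [set (c, dm c)]; split=> [|_ ->|u v]; first exact: finite_set1.
    by rewrite /= (dmI (dm_id c)).
  split=> [[/= cu ->]|[_ -> /fracE[w /= [h1 -> h3 ->]]]].
    exists (c, dm c) => //; apply/fracE; exists u => /=; split=> //.
      by rewrite (dmI (dm_id c)).
    by rewrite cu comp_tg.
  by rewrite (dmI (dm_id c)) in h1; rewrite h1 comp_tg.
(* If f = q1 r = p2 r', the part of the product that passes through f is (p1 r')(q2 r)^-1. *)
- pose F (p q : C * C) (f : C) : C * C := (comp p.1 (tail p.2 f), comp q.2 (tail q.1 f)).
  exists (\bigcup_(pq in P `*` Q) F pq.1 pq.2 @` [set f | mce pq.2.1 pq.1.2 f]); split.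
  + apply: bigcup_finite; first exact: finite_setX.
    by move=> pq _; apply: finite_image; exact: mce_finite.
  + move=> _ [[p q] [/= Pp Qq] [f [qf pf _] <-]] /=.
    have [h1 E1] := tailP pf; have [h2 E2] := tailP qf.
    have h3 : dm p.1 = tg (tail p.2 f) by rewrite dP.
    have h4 : dm q.2 = tg (tail q.1 f) by rewrite -dQ.
    by rewrite (dm_comp h3) (dm_comp h4) -(dm_comp h1) -(dm_comp h2) -E1 -E2.
  + move=> u v; split.
      move=> [m /= /HQ[q Qq /fracE[w [h1 -> h3 E3]]] /HP[p Pp /fracE[z [h4 E4 h5 ->]]]].
      have [f mf fm] : exists2 f, mce q.1 p.2 f & rideal f m.
        by apply: mce_ex; [rewrite E3|rewrite E4]; exact: rideal_comp.
      have [fz Em] := tailP fm; set r := tail f m in fz Em.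
      have [qf pf _] := mf; have [h6 E6] := tailP qf; have [h7 E7] := tailP pf.
      have h8 : dm (tail q.1 f) = tg r by rewrite -fz E6 dm_comp// -E6.
      have h9 : dm (tail p.2 f) = tg r by rewrite -fz E7 dm_comp// -E7.
      exists (F p q f); first by exists (p, q) => //; exists f.
      apply/fracE; exists r; rewrite /F /=.
      have Ew : w = comp (tail q.1 f) r.
        apply: (@comp_lcan _ _ q.1) => //; first by rewrite tg_comp.
        by rewrite -E3 compA// -E6.
      have Ez : z = comp (tail p.2 f) r.
        apply: (@comp_lcan _ _ p.2) => //; first by rewrite tg_comp.
        by rewrite -E4 compA// -E7.
      have q2 : dm q.2 = tg (tail q.1 f) by rewrite -dQ.
      have p1 : dm p.1 = tg (tail p.2 f) by rewrite dP.
      by rewrite Ew Ez !compA// !dm_comp.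
  + move=> [_ [[p q] [/= Pp Qq] [f [qf pf _] <-]] /fracE[r /= [h1 -> h3 ->]]].
    have [h6 E6] := tailP qf; have [h7 E7] := tailP pf.
    have q2 : dm q.2 = tg (tail q.1 f) by rewrite -dQ.
    have p1 : dm p.1 = tg (tail p.2 f) by rewrite dP.
    rewrite dm_comp// in h1; rewrite dm_comp// in h3.
    exists (comp f r).
      apply/HQ; exists q => //; apply/fracE; exists (comp (tail q.1 f) r).
      rewrite !tg_comp//; split=> //; first by rewrite compA.
      by rewrite compA// -E6.
    apply/HP; exists p => //; apply/fracE; exists (comp (tail p.2 f) r).
    rewrite !tg_comp//; split=> //; last by rewrite compA.
    by rewrite compA// -E7.
- exists ((fun p => (p.2, p.1)) @` P); split.
  + exact: finite_image.
  + by move=> _ [p Pp <-]; rewrite /= dP.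
  + move=> u v; split=> [/HP[p Pp /fracE[w [h1 h2 h3 h4]]]|].
      by exists (p.2, p.1); [exists p|apply/fracE; exists w].
    move=> [_ [p Pp <-] /fracE[w [/= h1 h2 h3 h4]]].
    by apply/HP; exists p => //; apply/fracE; exists w.
Qed.

(** The domain of s is covered by the cylinders of finitely many denominators, and x, being prime
    for finite covers, lies in one of them. *)
Lemma germ_frac s x : bdom s x -> exists c d, [/\ dm c = dm d, ev x (cyl d),
  forall w, dm d = tg w -> val s (comp d w, comp c w) & mk s x = mk (Il_frac c d) x].
Proof.
move=> h; have [P [finP dP HP]] := Il_union_frac (IlP s).
have finI := finite_image (fun p : C * C => cyl p.2) finP.
have [fs Efs] := proj1 (finite_seqP _) finI.
have [|f ffs xf] := @ev_cover _ _ x (Jdom s) fs h.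
  move=> u [v /HP[p Pp /fracE[w [h1 E1 h3 E3]]]].
  exists (cyl p.2); last by rewrite E1; apply/cylE/rideal_comp.
  have : ((fun p : C * C => cyl p.2) @` P) (cyl p.2) by exists p.
  by rewrite Efs.
have : ((fun p : C * C => cyl p.2) @` P) f by rewrite Efs.
move=> [[c d] Pcd /= Ef]; exists c, d; have cd := dP _ Pcd; rewrite -Ef in xf.
have H w : dm d = tg w -> val s (comp d w, comp c w).
  move=> dw; apply/HP; exists (c, d) => //; apply/fracE; exists w.
  by rewrite /= in cd; rewrite cd.
split=> //; apply: (proj2 (mk_eqI h xf _)) => u v /cylE[w /= dw <-].
split=> [uv|]; last by move=> /fracE[w' [h1 -> _ ->]]; exact: H.
rewrite -(Il_fun (H w dw) uv); apply/fracE; exists w.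
by rewrite /= in cd; rewrite cd.
Qed.

Definition degdiff u v : {ffun 'I_k -> int} := [ffun i => (deg v i)%:Z - (deg u i)%:Z].

Lemma degdiff_comp c d w : dm c = tg w -> dm d = tg w ->
  degdiff (comp d w) (comp c w) = degdiff d c.
Proof. by move=> h1 h2; apply/ffunP => i; rewrite !ffunE !deg_comp// !ffun_natD; lia. Qed.

Lemma degdiff_ex s x : bdom s x -> exists n, exists2 e, ev x e &
  forall u v, val e u -> val s (u, v) -> degdiff u v = n.
Proof.
move=> h; have [c [d [cd xd H _]]] := germ_frac h; exists (degdiff d c), (cyl d) => //.
move=> u v /cylE[w /= dw <-] uv; rewrite -(Il_fun (H w dw) uv).
by rewrite degdiff_comp// cd.
Qed.

(** The degree cocycle with values in Z^k: d(c) - d(d) on [c d^-1, x] ([dg_frac]). Defining it by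
    the degree difference of points and images avoids checking independence of the fraction. *)
Definition dg g : {ffun 'I_k -> int} :=
  projT1 (cid (degdiff_ex (bdom_gel g))).

Lemma dg_mkP s x : bdom s x -> exists2 e, ev x e &
  forall u v, val e u -> val s (u, v) -> degdiff u v = dg (mk s x).
Proof.
move=> h; rewrite /dg; case: cid => n /=; set g := mk s x => -[e].
rewrite src_mk => xe He; have := mk_gel g; rewrite src_mk => E.
have hg : bdom (gel g) x by have := bdom_gel g; rewrite src_mk.
have [_ [f xf Hf]] := proj1 (mk_eqP hg h) E.
exists (Jcap e f); first by rewrite ev_cap xe.
by move=> u v [eu fu] uv; apply: He => //; apply/Hf.
Qed.

Lemma dg_mk s x e n : bdom s x -> ev x e ->
  (forall u v, val e u -> val s (u, v) -> degdiff u v = n) -> dg (mk s x) = n.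
Proof.
move=> h xe He; have [f xf Hf] := dg_mkP h.
have : ev x (Jcap (Jcap e f) (Jdom s)) by rewrite !ev_cap xe xf.
by move=> /ev_ne[u [[eu fu] [v uv]]]; rewrite -(He u v)// (Hf u v).
Qed.

Lemma dg_frac c d x : dm c = dm d -> ev x (cyl d) ->
  dg (mk (Il_frac c d) x) = degdiff d c.
Proof.
move=> cd xd; apply: (dg_mk (e := cyl d)) => //; first exact/bdom_frac.
by move=> u v _ /fracE[w [h1 -> h2 ->]]; rewrite degdiff_comp.
Qed.

Lemma dg_loc s x : bdom s x -> exists2 e, ev x e &
  forall y, ev y e -> bdom s y /\ dg (mk s y) = dg (mk s x).
Proof.
move=> h; have [e xe He] := dg_mkP h; exists (Jcap e (Jdom s)); first by rewrite ev_cap xe.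
move=> y; rewrite ev_cap => /andP[ye ys]; split=> //.
exact: dg_mk ye He.
Qed.

Lemma dg_gm s g : bdom s (ran g) -> dg (gm s g) = dg (mk s (ran g)) + dg g.
Proof.
move=> h; have [e xe He] := dg_mkP h; have [f xf Hf] := dg_mkP (bdom_gel g).
apply: (dg_mk (e := Jcap f (Jpre (gel g) e))); first exact: gm_bdom.
  by rewrite ev_cap xf -ev_sact -?ran_gel//; exact: bdom_gel.
move=> u v [fu [w uw ew]] [w' uw' w'v].
rewrite -(Il_fun uw uw') in w'v; have {}He := He _ _ ew w'v; have {}Hf := Hf _ _ fu uw.
rewrite mk_gel in Hf; rewrite -He -Hf.
by apply/ffunP => i; rewrite !ffunE /=; lia.
Qed.

Lemma dg_gdiv g h : src g = src h -> dg (gdiv g h) = dg g - dg h.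
Proof.
move=> E; have := dg_gm (gdiv_bdom E); rewrite gdivK// => ->.
by rewrite addrK.
Qed.

Lemma dg_un x : dg (un x) = 0.
Proof. by have := @dg_gdiv (un x) (un x) erefl; rewrite gdivv ran_un subrr. Qed.

(** Write g = [c d^-1, x] with c and d of equal degree. As x is fixed, it lies in both cylinders, so
    c and d have a common extension; its prefix of that degree is unique, hence c = d. *)
Lemma isotropy_trivial g : dg g = 0 -> ran g = src g -> g = un (src g).
Proof.
move=> dg0 rs; have h := bdom_gel g.
have [c [d [cd xd H E]]] := germ_frac h; rewrite mk_gel in E.
have hf := proj2 (bdom_frac (src g) cd) xd.
have Ed : deg d = deg c.
  have := dg_frac cd xd; rewrite -E dg0 => /ffunP D.
  apply/ffunP => i; have := D i; rewrite !ffunE => /esym/eqP.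
  by rewrite subr_eq0 => /eqP[].
have xc : ev (src g) (cyl c).
  rewrite -rs E ran_mk// ev_sact//; apply: ev_le xd => u /cylE[w /= dw <-].
  exists (comp c w); first by apply/fracE; exists w; rewrite cd.
  by apply/cylE/rideal_comp; rewrite cd.
have : ev (src g) (Jcap (cyl c) (cyl d)) by rewrite ev_cap xc.
move=> /ev_ne[u [/cylE[w /= cw <-] /cylE[z /= dz /esym E']]].
have [Ecd _] := comp_inj cw dz (esym Ed) E'.
rewrite {1}E; apply: mk_un => // a b /fracE[y [_ -> _ ->]]; by rewrite Ecd.
Qed.

Lemma nonunit_sep g : dg g = 0 -> g != un (src g) -> exists e, ev (ran g) e != ev (src g) e.
Proof.
move=> dg0 /eqP nu; apply: contrapT => /forallNP H; apply: nu; apply: isotropy_trivial => //.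
by apply: bdry_ext => e; apply/eqP; have /negP := H e; rewrite negbK.
Qed.

Lemma ev_mce x c d : ev x (cyl c) -> ev x (cyl d) -> exists2 f, mce c d f & ev x (cyl f).
Proof.
move=> xc xd; have xcd : ev x (Jcap (cyl c) (cyl d)) by rewrite ev_cap xc.
have [fs Efs] := proj1 (finite_seqP _) (finite_image cyl (mce_finite c d halign)).
have [u [/cylE cu /cylE du]|e ees xe] := ev_cover xcd (fs := fs).
  have [m mm mu] := mce_ex cu du; exists (cyl m); last exact/cylE.
  have : (cyl @` [set f | mce c d f]) (cyl m) by exists m.
  by rewrite Efs.
have : (cyl @` [set f | mce c d f]) e by rewrite Efs.
by move=> [m mm Em]; exists m => //; rewrite Em.
Qed.

Lemma frac_common c d c' d' x : dm c = dm d -> dm c' = dm d' ->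
  ev x (cyl d) -> ev x (cyl d') -> exists a b, [/\ dm d = tg a, dm d' = tg b,
  comp d a = comp d' b & ev x (cyl (comp d a))].
Proof.
move=> cd cd' xd xd'; have [m [[a /= da Ea] [b /= db Eb] _] xm] := ev_mce xd xd'.
by exists a, b; split=> //; rewrite Ea ?Eb.
Qed.

(* Two fractions with the same denominator either agree or agree nowhere, so
   the set of x with [s, x] = [t, x] is closed in the common domain. *)
Lemma mk_neq_loc s t x : bdom s x -> bdom t x -> mk s x <> mk t x ->
  exists2 e, ev x e & forall y, ev y e -> [/\ bdom s y, bdom t y & mk s y <> mk t y].
Proof.
move=> hs ht; have [c [d [cd xd H _]]] := germ_frac hs.
have [c' [d' [cd' xd' H' _]]] := germ_frac ht => ne.
have [a [b [da db E xe]]] := frac_common cd cd' xd xd'.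
have ca : dm c = tg a by rewrite cd.
have cb : dm c' = tg b by rewrite cd'.
have ab : dm a = dm b by rewrite -(dm_comp da) E dm_comp.
have Hs w : dm a = tg w -> val s (comp (comp d a) w, comp (comp c a) w).
  by move=> aw; rewrite -!compA//; apply: H; rewrite tg_comp.
have Ht w : dm a = tg w -> val t (comp (comp d a) w, comp (comp c' b) w).
  by move=> aw; rewrite E -!compA -?ab//; apply: H'; rewrite tg_comp -?ab.
have nE : comp c a <> comp c' b.
  move=> Ecc; apply: ne; apply: (proj2 (mk_eqI hs xe _)) => u v /cylE[w /= + <-].
  rewrite dm_comp// => aw; have h1 := Hs w aw; have h2 := Ht w aw.
  by split=> uv; [rewrite -(Il_fun h1 uv) Ecc|rewrite -(Il_fun h2 uv) -Ecc].
exists (Jcap (cyl (comp d a)) (Jcap (Jdom s) (Jdom t))).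
  by rewrite !ev_cap xe /=; apply/andP; split; [exact: hs|exact: ht].
move=> y; rewrite !ev_cap => /and3P[y1 y2 y3]; split=> // /(mk_eqP y2 y3)[_ [f yf Hf]].
have : ev y (Jcap f (cyl (comp d a))) by rewrite ev_cap yf.
move=> /ev_ne[u [fu /cylE[w /= + E']]]; subst u; rewrite dm_comp// => aw.
have {}Hf := proj1 (Hf _ _ fu) (Hs w aw); have Ecc := Il_fun Hf (Ht w aw).
have dcb : deg (comp c a) = deg (comp c' b).
  have := congr1 (@deg _ C) Ecc.
  by rewrite deg_comp ?dm_comp// [in RHS]deg_comp ?dm_comp -?ab// ![_ + deg w]addrC => /ffun_natI.
have [] := comp_inj _ _ dcb Ecc; rewrite ?dm_comp -?ab//.
Qed.

End Fractions.

(** * A finite family of paths closed under exchange of prefixes *)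

Section FiniteClosure.
Context {k : nat} {C : hrGraph k}.
Hypothesis halign : finitely_aligned C.
Variables (L : set (C * C)) (N : nat).
Hypothesis finL : finite_set L.
Hypothesis symL : forall a b, L (a, b) -> L (b, a).
Implicit Types (a b c d e f w y : C) (p q : {ffun 'I_k -> nat}).

Definition box p := forall i, (p i < N)%N.

(* The least family, indexed by a box of offsets, which contains the legs of L
   and is closed under minimal common extensions and under the exchange of
   prefixes b -> a for (a, b) in L; an exchange preserves degree plus offset. *)
Inductive fam : {ffun 'I_k -> nat} -> C -> Prop :=
| fam_base p a b : box p -> L (a, b) -> fam p b
| fam_mce p c d f : fam p c -> fam p d -> mce c d f -> fam p f
| fam_move p q a b w : L (a, b) -> box p -> deg a + p = deg b + q ->
    dm b = tg w -> dm a = tg w -> fam q (comp b w) -> fam p (comp a w).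

(** The induction measure: unchanged by an exchange ([tsz_move]) and strictly larger on proper
    extensions ([tsz_eq]). *)
Definition tsz (pc : {ffun 'I_k -> nat} * C) : nat := (\sum_i (deg pc.2 i + pc.1 i))%N.

Lemma tsz_rideal p c f : rideal c f -> (tsz (p, c) <= tsz (p, f))%N.
Proof. by move=> cf; apply: leq_sum => i _; rewrite leq_add2r deg_rideal. Qed.

Lemma tsz_eq p c f : rideal c f -> tsz (p, c) = tsz (p, f) -> c = f.
Proof.
move=> cf E; apply: rideal_eq => //; apply/ffunP => i; apply/eqP.
have H j : true -> (deg c j + p j <= deg f j + p j ?= iff (deg c j == deg f j))%N.
  by move=> _; split; [rewrite leq_add2r deg_rideal|rewrite eqn_add2r].
have [_] := leqif_sum H; rewrite /tsz/= in E; rewrite E eqxx => /esym/forallP; exact.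
Qed.

Lemma tsz_move p q a b w : deg a + p = deg b + q -> dm b = tg w -> dm a = tg w ->
  tsz (p, comp a w) = tsz (q, comp b w).
Proof.
move=> /ffunP E bw aw; apply: eq_bigr => i _ /=; rewrite !deg_comp// !ffun_natD.
by have := E i; rewrite !ffun_natD; lia.
Qed.

Lemma fam_box p c : fam p c -> box p.
Proof. by elim. Qed.

(** In each coordinate degree plus offset stays at most M + N: true for the legs of L, preserved by
    the maximum of degrees in a minimal common extension, and constant under exchange. *)
Lemma fam_bound : exists B, forall p c, fam p c -> (tsz (p, c) < B)%N.
Proof.
have [s Es] := proj1 (finite_seqP _) (finite_image (fun ab : C * C => deg ab.2) finL).
pose M := (\sum_(q <- s) \sum_i q i)%N.
have HM a b i : L (a, b) -> (deg b i <= M)%N.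
  move=> Lab; have : ((fun ab : C * C => deg ab.2) @` L) (deg b) by exists (a, b).
  rewrite Es /= => bs; rewrite /M (big_rem _ bs) /= (bigD1 i)//=.
  by rewrite -addnA leq_addr.
have H p c : fam p c -> forall i, (deg c i + p i <= M + N)%N.
  elim=> {p c} [p a b bp Lab i|p c d f _ IHc _ IHd [_ _ Ef] i|p q a b w _ _ /ffunP E bw aw _ IH i].
  - by rewrite leq_add ?(HM a b)// ltnW.
  - by rewrite Ef ffunE; have := IHc i; have := IHd i; lia.
  - have := IH i; have := E i; rewrite !deg_comp// !ffun_natD; lia.
exists (\sum_(i < k) (M + N)).+1 => p c Fc; rewrite ltnS; apply: leq_sum => i _.
exact: H.
Qed.

Lemma finite_box (D : {ffun 'I_k -> nat}) : finite_set [set q : {ffun 'I_k -> nat} |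
  forall i, (q i < D i)%N].
Proof.
pose m := (\sum_i D i)%N.
apply: (@sub_finite_set _ _ ((fun r : {ffun 'I_k -> 'I_m.+1} => [ffun i => r i : nat]) @` setT)).
  move=> q Hq; exists [ffun i => inord (q i)] => //; apply/ffunP => i.
  rewrite !ffunE inordK// ltnS (leq_trans (ltnW (Hq i)))//.
  by rewrite /m (bigD1 i)//= leq_addr.
exact/finite_image/finite_finset.
Qed.

(** There is at most one suffix for each degree of the complementary prefix. *)
Lemma finite_suffix c : finite_set [set w | exists2 e, dm e = tg w & c = comp e w].
Proof.
apply: (@sub_finite_set _ _ (\bigcup_(q in [set q : {ffun 'I_k -> nat} |
    forall i, (q i < [ffun i => (deg c i).+1] i)%N])
    [set w | exists e, [/\ dm e = tg w, c = comp e w & deg e = q]])).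
  move=> w [e ew Ec]; exists (deg e); last by exists e.
  by move=> i /=; rewrite ffunE ltnS Ec; apply/deg_rideal/rideal_comp.
apply: bigcup_finite; first exact: finite_box.
move=> q _; have [[w0 [e0 [h1 h2 h3]]]|H] := pselect (exists w, exists e,
    [/\ dm e = tg w, c = comp e w & deg e = q]).
  apply: (@sub_finite_set _ _ [set w0]); last exact: finite_set1.
  move=> w [e [ew Ec Eq]]; rewrite -Eq in h3; rewrite Ec in h2.
  by have [] := comp_inj ew h1 (esym h3) h2.
apply: (@sub_finite_set _ _ set0); last exact: finite_set0.
by move=> w Hw; apply: H; exists w.
Qed.

Let level n := [set pc : {ffun 'I_k -> nat} * C | fam pc.1 pc.2 /\ (tsz pc < n)%N].

(** Candidates for size n that involve no exchange at that size: legs of L, and minimal common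
    extensions of smaller members. The set [shifted n] below holds a smaller member followed by a
    suffix of such a candidate; both are finite once [level n] is. *)
Let minim n : set ({ffun 'I_k -> nat} * C) :=
  (fun qx : {ffun 'I_k -> nat} * (C * C) => (qx.1, qx.2.2)) @` ([set p | box p] `*` L) `|`
  \bigcup_(xy in level n `*` level n) (fun f => (xy.1.1, f)) @` [set f | mce xy.1.2 xy.2.2 f].

Let shifted n : set ({ffun 'I_k -> nat} * C) :=
  (fun xw : ({ffun 'I_k -> nat} * C) * C => (xw.1.1, comp xw.1.2 xw.2)) @`
  ((level n `*` \bigcup_(m in minim n) [set w | exists2 e, dm e = tg w & m.2 = comp e w])
   `&` [set xw | dm xw.1.2 = tg xw.2]).

(** Exchanges keep the size, so chains of them at size n are a priori unbounded. The invariant that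
    tames them: whatever prefix is exchanged, the tail carried along remains a suffix of one of the
    finitely many paths in [minim n]. *)
Lemma levelS n p y : fam p y -> tsz (p, y) = n -> (minim n `|` shifted n) (p, y).
Proof.
elim=> {p y} [p a b bp Lab _|p c d f Fc IHc Fd IHd mf En|p q a b w Lab bp E bw aw Fy IH En].
- by left; left; exists (p, (a, b)).
- have [cf df _] := mf.
  have [Ec|nc] := eqVneq (tsz (p, c)) n.
    by have <- : c = f; [apply: (@tsz_eq p) => //; rewrite Ec En|exact: IHc].
  have [Ed|nd] := eqVneq (tsz (p, d)) n.
    by have <- : d = f; [apply: (@tsz_eq p) => //; rewrite Ed En|exact: IHd].
  left; right; exists ((p, c), (p, d)); last by exists f.
  split; split=> //=; rewrite -?En; first by have := tsz_rideal p cf; lia.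
  by have := tsz_rideal p df; lia.
have bq := fam_box Fy.
have Fa : fam p a by apply: (@fam_base _ b) => //; exact: symL.
have Fb : fam q b by exact: (@fam_base _ a).
have Eab : tsz (p, a) = tsz (q, b).
  by apply: eq_bigr => i _; move/ffunP/(_ i): E; rewrite !ffun_natD.
have En' : tsz (q, comp b w) = n by rewrite -En; apply/esym/tsz_move.
(* If b already has size n, then w is an identity and the new path is the leg a itself. *)
have [Eb|nb] := eqVneq (tsz (q, b)) n.
  have H : b = comp b w by apply: (@tsz_eq q); [exact: rideal_comp|rewrite Eb].
  have [_ Ew] := comp_inj bw (dm_tg_dm b) erefl (etrans (esym H) (esym (comp_dm b))).
  left; left; exists (p, (b, a)); first by split=> //; exact: symL.
  by congr (_, _); rewrite /= Ew bw -aw comp_dm.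
have lb : (tsz (q, b) < n)%N.
  by rewrite ltn_neqAle nb -En' tsz_rideal//; exact: rideal_comp.
have la : level n (p, a) by split=> //; rewrite Eab.
have key : minim n (q, comp b w) -> shifted n (p, comp a w).
  move=> My; exists ((p, a), w) => //; split=> //; split=> //.
  by exists (q, comp b w) => //; exists b.
right; have [/key//|[[[q' e] v] /= [[[Fe le] [m Mm [e0 e0v Em]]] /= ev] [Eq Ey]]] := IH En'.
(* Now b w = e v with e smaller and v a suffix of m. Cut at the minimal common extension f = b w1 =
   e v1, so that b w = f r. If f has full size, b w is in [minim]; otherwise a w = (a w1) r with
   [a w1] a smaller member and r a suffix of v, hence of m. *)
subst q'; have [f mf fy] : exists2 f, mce b e f & rideal f (comp b w).
  by apply: mce_ex; [|rewrite -Ey]; exact: rideal_comp.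
have [bf ef _] := mf; have Ff : fam q f by apply: fam_mce Fb Fe mf.
have [Ef|nf] := eqVneq (tsz (q, f)) n.
  apply: key; right; exists ((q, b), (q, e)) => //.
  exists f => //; congr (_, _); apply: (@tsz_eq q) => //.
  by rewrite Ef.
have lf : (tsz (q, f) < n)%N by rewrite ltn_neqAle nf -En' tsz_rideal.
move/ridealE: bf => [w1 [bw1 Ef1]]; move/ridealE: ef => [v1 [ev1 Ef2]].
move/ridealE: fy => [r [fr Er]].
have w1r : dm w1 = tg r by rewrite -fr Ef1 dm_comp.
have v1r : dm v1 = tg r by rewrite -fr Ef2 dm_comp.
have aw1 : dm a = tg w1 by rewrite aw -bw.
have Ew : w = comp w1 r.
  by apply: (comp_lcan bw); rewrite ?tg_comp// compA// -Ef1.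
have Ev : v = comp v1 r.
  by apply: (comp_lcan ev); rewrite ?tg_comp// compA// -Ef2 Ey.
exists ((p, comp a w1), r); last by rewrite /= Ew compA.
split=> /=; last by rewrite dm_comp.
split=> /=.
  split; first by apply: fam_move Lab bp E bw1 aw1 _; rewrite -Ef1.
  by rewrite (tsz_move E)// -Ef1.
exists m => //; exists (comp e0 v1); first by rewrite dm_comp// e0v Ev tg_comp.
by rewrite Em Ev compA// e0v Ev tg_comp.
Qed.

Lemma finite_level n : finite_set (level n).
Proof.
elim: n => [|n IH].
  by apply: (@sub_finite_set _ _ set0) => // pc [].
have finM : finite_set (minim n).
  rewrite finite_setU; split.
    apply/finite_image/finite_setX => //.
    apply: sub_finite_set (finite_box [ffun=> N]) => q bq i; rewrite ffunE.
    exact: bq.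
  apply: bigcup_finite; first exact: finite_setX.
  by move=> xy _; apply/finite_image/mce_finite.
apply: (@sub_finite_set _ _ (level n `|` (minim n `|` shifted n))).
  move=> [p y] [/= Fy]; rewrite ltnS leq_eqVlt => /orP[/eqP E|l]; last by left.
  by right; exact: levelS.
rewrite finite_setU; split=> //; rewrite finite_setU; split=> //.
rewrite /shifted; apply: finite_image.
apply: finite_setIl; apply: finite_setX => //; apply: bigcup_finite => // m _.
exact: finite_suffix.
Qed.

Lemma finite_fam p : finite_set [set c | fam p c].
Proof.
have [B HB] := fam_bound.
apply: (@sub_finite_set _ _ (snd @` level B)); last exact/finite_image/finite_level.
by move=> c Fc; exists (p, c) => //; split=> //; exact: HB.
Qed.

End FiniteClosure.

(** * Topology of the boundary and of the groupoid *)

(** Compactness as an induction principle, replacing the extraction of finite subcovers. If P failed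
    on A, the sets B with P (A minus B) would form a proper filter, and P near a cluster point
    contradicts it. *)
Lemma compact_ind (T : topologicalType) (A : set T) (P : set T -> Prop) :
  compact A -> P set0 -> (forall V W, P V -> W `<=` V -> P W) ->
  (forall V W, P V -> P W -> P (V `|` W)) ->
  (forall x, A x -> exists2 V, nbhs x V & P V) -> P A.
Proof.
move=> cA P0 PS PU loc; apply: contrapT => nP.
pose F : set_system T := [set B | P (A `\` B)].
have FF : ProperFilter F.
  apply: Build_ProperFilter_ex.
    move=> B FB; apply: contrapT => /forallNP nB; apply: nP; apply: PS FB _.
    by move=> x Ax; split=> // /nB.
  split; first by rewrite /F /= setDT.
    by move=> B D FB FD; rewrite /F /= setDIr; exact: PU.
  by move=> B D BD FB; apply: PS FB _ => x [Ax nD]; split=> // /BD.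
have [|p [Ap cl]] := cA F FF; first by rewrite /F /= setDv.
have [V nV PV] := loc p Ap.
have FV : F (~` V) by apply: PS PV _ => x [_ /contrapT].
by have [x []] := cl _ _ FV nV.
Qed.

Section BoundaryTopology.
Context {k : nat} {C : hrGraph k}.
Implicit Types (x y : bdry C) (e : J C) (s t : Il C) (V Z K U : set (bdry C)).

Lemma val_bdry_continuous : continuous (val : bdry C -> Jmap C).
Proof. exact: initial_continuous. Qed.

Lemma near_ev x e : \forall y \near x, ev y e = ev x e.
Proof. by have := val_bdry_continuous (nbhs_ev (val x) e). Qed.

Definition Zc e : set (bdry C) := [set x | ev x e].

Lemma open_ev e (b : bool) : open [set x | ev x e = b].
Proof.
rewrite openE => x /= xb; apply: filterS (near_ev x e) => y; by rewrite /= => ->.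
Qed.

Lemma open_Zc e : open (Zc e). Proof. exact: open_ev. Qed.

Lemma closed_Zc e : closed (Zc e).
Proof.
rewrite -[Zc e]setCK; apply: open_closedC.
rewrite (_ : ~` _ = [set x | ev x e = false]); first exact: open_ev.
by apply/seteqP; split=> x; rewrite /Zc /=; [move=> /negP/negbTE|move=> ->].
Qed.

(** By Tychonoff, once the boundary characters with value 1 at e are closed in the cube. Each
    character axiom involves finitely many coordinates and so passes to limits; the condition at e
    keeps the limit nonzero. *)
Lemma compact_Zc e : compact (Zc e).
Proof.
pose B : set (Jmap C) := [set chi | boundary chi /\ chi e].
have cB : compact B.
  have cT : compact [set: Jmap C].
    have := @tychonoff (J C) (fun=> bool) (fun=> setT) (fun=> bool_compact).
    by rewrite (_ : [set f | _] = setT)//; apply/seteqP; split.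
  apply: (subclosed_compact _ cT) => // chi cl; split; last first.
    by have [psi [[_ pe] /= <-]] := cl _ (nbhs_ev chi e).
  split.
    split.
    - by exists e; have [psi [[_ pe] /= <-]] := cl _ (nbhs_ev chi e).
    - move=> f g; have [psi [[[[_ pM _] _] _] /= [[E1 E2] E3]]] :=
        cl _ (filterI (filterI (nbhs_ev chi f) (nbhs_ev chi g)) (nbhs_ev chi (Jcap f g))).
      by rewrite -E1 -E2 -E3 pM.
    - move=> f f0; have [psi [[[[_ _ p0] _] _] /= E]] := cl _ (nbhs_ev chi f).
      by rewrite -E p0.
  move=> V nV; move: nV; rewrite nbhsE => - [Q [oQ Qchi] QV].
  have [psi [[[_ clp] _] Qp]] := cl _ (open_nbhs_nbhs (conj oQ Qchi)).
  have [m [mm Qm]] := clp _ (open_nbhs_nbhs (conj oQ Qp)).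
  by exists m; split=> //; exact: QV.
(* Compactness is transferred from the cube to the subtype: the image filter clusters at a boundary
   character. *)
move=> F FF FZ.
have FB : F (val @^-1` B).
  by apply: filterS FZ => x xe; split; [exact: bdryP|exact: xe].
have [p [[Bp pe] cl]] := cB (val @ F) _ FB.
exists (SigSub (mem_set Bp)); split=> // A V FA; rewrite nbhsE => -[Q [[Q' oQ' <-] Qp] QV].
have FA' : F (val @^-1` (val @` A)) by apply: filterS FA => x Ax; exists x.
have [_ [[x Ax <-] Q'x]] := cl _ Q' FA' (open_nbhs_nbhs (conj oQ' Qp)).
by exists x; split=> //; exact: QV.
Qed.

(** Obtained from compactness: inside [Zc e0] the complement of an open neighbourhood is compact and
    each of its points differs from x at some e, so finitely many e separate all of them from x. *)
Lemma nbhs_bdry x V : nbhs x V ->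
  exists es : seq (J C), forall y, (forall e, e \in es -> ev y e = ev x e) -> V y.
Proof.
move=> nV; have [e0 xe0] := ev_ex x.
move: (nV); rewrite nbhsE => - [Q [oQ Qx] QV].
have cA : compact (Zc e0 `\` Q).
  apply: (subclosed_compact _ (compact_Zc (e := e0))); last by move=> y [].
  by apply: closedI; [exact: closed_Zc|exact: open_closedC].
have [es Hes] : exists es : seq (J C), forall y, (Zc e0 `\` Q) y ->
    exists2 e, e \in es & ev y e <> ev x e.
  apply: (compact_ind (P := fun W => exists es : seq (J C), forall y, W y ->
    exists2 e, e \in es & ev y e <> ev x e)) cA _ _ _ _.
  - by exists [::].
  - by move=> W W' [es H] sW; exists es => y /sW/H.
  - move=> W W' [es H] [es' H']; exists (es ++ es') => y [/H|/H'] [e ees ne].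
      by exists e => //; rewrite mem_cat ees.
    by exists e => //; rewrite mem_cat ees orbT.
  - move=> y [_ nQy]; have [e ne] : exists e, ev y e <> ev x e.
      apply: contrapT => /forallNP H; apply: nQy; rewrite (_ : y = x)//.
      by apply: bdry_ext => e; have /contrapT := H e.
    exists [set z | ev z e = ev y e]; first exact: near_ev.
    by exists [:: e] => z /= E; exists e; rewrite ?inE// E.
exists (e0 :: es) => y Hy; apply: QV; apply: contrapT => nQ.
have [|e ees] := Hes y.
  by split=> //; rewrite /Zc /= Hy ?inE ?eqxx.
by apply; apply: Hy; rewrite inE ees orbT.
Qed.

Lemma near_evs x (es : seq (J C)) : \forall y \near x, forall e, e \in es -> ev y e = ev x e.
Proof.
by apply: near_seq => e _; exact: near_ev.
Qed.

Lemma cvg_to_bdry (T : topologicalType) (f : T -> bdry C) (x : T) :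
  (forall e, \forall y \near x, ev (f y) e = ev (f x) e) -> f @ x --> f x.
Proof.
move=> H V /nbhs_bdry[es Hes].
have n := near_seq (s := es) (fun e _ => H e).
by apply: filterS n => y /Hes.
Qed.

Definition cko Z := [/\ compact Z, open Z & closed Z].

Lemma cko_Zc e : cko (Zc e).
Proof. by split; [exact: compact_Zc|exact: open_Zc|exact: closed_Zc]. Qed.

Lemma cko_bdom s : cko (bdom s). Proof. exact: cko_Zc. Qed.

Lemma cko0 : cko set0.
Proof. by split; [exact: compact0|exact: open0|exact: closed0]. Qed.

Lemma ckoU Z Z' : cko Z -> cko Z' -> cko (Z `|` Z').
Proof.
move=> [c1 o1 d1] [c2 o2 d2].
by split; [exact: compactU|exact: openU|exact: closedU].
Qed.

Lemma ckoI Z U : cko Z -> open U -> closed U -> cko (Z `&` U).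
Proof.
move=> [c1 o1 d1] o2 d2; split; [|exact: openI|exact: closedI].
by apply: (subclosed_compact _ c1) => //; exact: closedI.
Qed.

Lemma cko_nbhs x U : nbhs x U -> exists Z, [/\ cko Z, Z x & Z `<=` U].
Proof.
move=> /nbhs_bdry[es Hes]; have [e0 xe0] := ev_ex x.
have H : open [set y | forall e, e \in es -> ev y e = ev x e] /\
         closed [set y | forall e, e \in es -> ev y e = ev x e].
  elim: es {Hes} => [|e es [op1 cl1]].
    rewrite (_ : [set _ | _] = setT); first by split; [exact: openT|exact: closedT].
    by apply/seteqP; split.
  rewrite (_ : [set _ | _] = [set y | ev y e = ev x e] `&`
      [set y | forall e, e \in es -> ev y e = ev x e]); last first.
    apply/seteqP; split=> y /=.
      move=> H; split; first by apply: H; rewrite inE eqxx.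
      by move=> f fes; apply: H; rewrite inE fes orbT.
    by move=> [H1 H2] f; rewrite inE => /orP[/eqP->|/H2].
  split; first by apply: openI => //; exact: open_ev.
  apply: closedI => //.
  rewrite (_ : [set _ | _] = ~` [set y | ev y e = ~~ ev x e]).
    by apply: open_closedC; exact: open_ev.
  apply/seteqP; split=> y /=; first by move=> ->; case: (ev x e).
  by case: (ev y e); case: (ev x e) => //; case.
exists (Zc e0 `&` [set y | forall e, e \in es -> ev y e = ev x e]); split.
- by apply: ckoI; [exact: cko_Zc|by case: H|by case: H].
- by split.
- by move=> y [_ /Hes].
Qed.

Lemma cko_cover K U : compact K -> open U -> K `<=` U ->
  exists Z, [/\ cko Z, K `<=` Z & Z `<=` U].
Proof.
move=> cK oU KU; apply: (compact_ind (P := fun K => exists Z,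
  [/\ cko Z, K `<=` Z & Z `<=` U])) cK _ _ _ _.
- by exists set0; split=> //; exact: cko0.
- by move=> V W [Z [cZ VZ ZU]] WV; exists Z; split=> // x /WV/VZ.
- move=> V W [Z [cZ VZ ZU]] [Z' [cZ' VZ' ZU']]; exists (Z `|` Z'); split.
  + exact: ckoU.
  + by move=> x [/VZ|/VZ']; [left|right].
  + by move=> x [/ZU|/ZU'].
- move=> x Kx; have nU : nbhs x U by apply: open_nbhs_nbhs; split=> //; exact: KU.
  have [Z [cZ Zx ZU]] := cko_nbhs nU; exists Z; last by exists Z; split.
  by apply: open_nbhs_nbhs; split=> //; case: cZ.
Qed.

Lemma near_bdom s x : bdom s x -> \forall y \near x, bdom s y.
Proof. by move=> h; apply: filterS (near_ev x (Jdom s)) => y; rewrite /bdom /= -/(ev _ _) => ->. Qed.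

Lemma sact_cvg s x : bdom s x -> sact s @ x --> sact s x.
Proof.
move=> h; apply: cvg_to_bdry => e; near=> y; rewrite !ev_sact//; last first.
  by near: y; exact: near_bdom.
by near: y; exact: near_ev.
Unshelve. all: by end_near. Qed.

End BoundaryTopology.

(** * Topology of the groupoid: slices, units, the Hausdorff property *)

Section GermTopology.
Context {k : nat} {C : hrGraph k}.
Implicit Types (x y : bdry C) (e : J C) (s t : Il C) (V Z K U : set (bdry C)).
Implicit Types (g h : germ C) (W : set (germ C)).

Lemma open_germ W : open W <-> forall s, open [set x | bdom s x /\ W (mk s x)].
Proof.
have E s : [set z : set_type (bdom s) | W (mkgerm (existT _ s z))] =
    val @^-1` [set x | bdom s x /\ W (mk s x)].
  apply/seteqP; split=> z /=.
    move=> Wz; have hz : bdom s (val z) := set_mem (valP z); split=> //.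
    by rewrite (mkE hz) /mk_rep; congr (W (mkgerm (existT _ _ _))): Wz; exact: val_inj.
  move=> [hz]; rewrite (mkE hz) /mk_rep => Wz.
  by congr (W (mkgerm (existT _ _ _))): Wz; exact: val_inj.
have -> : open W <-> open [set p : rep C | W (mkgerm p)] by [].
rewrite sigT_openP; split=> H s.
  have [Q oQ EQ] := H s; rewrite (_ : [set x | _] = Q `&` bdom s).
    by apply: openI => //; exact: open_Zc.
  apply/seteqP; split=> x.
    move=> [hx Wx]; split=> //; have : (val @^-1` Q) (SigSub (mem_set hx) : set_type (bdom s)).
      by rewrite EQ /= -mkE.
    by [].
  move=> [Qx hx]; split=> //; rewrite (mkE hx).
  have : (val @^-1` Q) (SigSub (mem_set hx) : set_type (bdom s)) by [].
  by rewrite EQ.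
exists [set x | bdom s x /\ W (mk s x)]; first exact: H.
by rewrite -E.
Qed.

Lemma nbhs_mk s x W : bdom s x -> nbhs (mk s x) W -> \forall y \near x, W (mk s y).
Proof.
move=> h; rewrite nbhsE => - [Q [oQ Qx] QW].
have /open_germ/(_ s) oS := oQ.
have : nbhs x [set x | bdom s x /\ Q (mk s x)] by apply: open_nbhs_nbhs.
by apply: filterS => y [_ /QW].
Qed.

Lemma mk_cvg s x : bdom s x -> mk s @ x --> mk s x.
Proof. by move=> h W /(nbhs_mk h). Qed.

Lemma mk_eq_near s t x : bdom s x -> bdom t x -> mk s x = mk t x ->
  \forall y \near x, mk s y = mk t y.
Proof.
move=> hs ht /(mk_eqP hs ht)[_ [e xe He]]; near=> y.
have ye : ev y e by near: y; apply: filterS (near_ev x e) => y ->.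
apply: (proj2 (mk_eqI _ ye He)); near: y; exact: near_bdom.
Unshelve. all: by end_near. Qed.

(** Slices are open because an equality of germs persists: [s, y] = [t, y] on a member e of J gives
    the same equality at all points of e. *)
Lemma nbhs_mk_image s x V : bdom s x -> nbhs x V -> nbhs (mk s x) (mk s @` V).
Proof.
move=> h; rewrite nbhsE => - [Q [oQ Qx] QV].
suff oW : open (mk s @` (Q `&` bdom s)).
  have : nbhs (mk s x) (mk s @` (Q `&` bdom s)).
    by apply: open_nbhs_nbhs; split=> //; exists x.
  by apply: filterS => _ [y [/QV Vy _] <-]; exists y.
apply/open_germ => t; rewrite openE => y /= [ht [z [Qz hz] E]].
have Ez : z = y by have := congr1 (@src k C) E; rewrite !src_mk.
subst z; near=> w; split; first by near: w; exact: near_bdom.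
exists w; first split.
- by near: w; exact: open_nbhs_nbhs.
- by near: w; exact: near_bdom.
- by near: w; exact: mk_eq_near.
Unshelve. all: by end_near. Qed.

Lemma near_mk s x W : bdom s x -> (\forall y \near x, W (mk s y)) -> nbhs (mk s x) W.
Proof.
by move=> h /(nbhs_mk_image h); apply: filterS => _ [y Wy <-].
Qed.

Lemma germ_cvg (T : topologicalType) (f : germ C -> T) s x : bdom s x ->
  (fun y => f (mk s y)) @ x --> f (mk s x) -> f @ mk s x --> f (mk s x).
Proof. by move=> h H V /H nV; exact: near_mk. Qed.

Lemma germ_ind (P : germ C -> Prop) : (forall s x, bdom s x -> P (mk s x)) -> forall g, P g.
Proof. by move=> H g; rewrite -(mk_gel g); apply/H/bdom_gel. Qed.

Lemma src_continuous : continuous (@src k C).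
Proof.
elim/germ_ind => s x h; apply: germ_cvg => //.
rewrite (_ : (fun y => _) = id); first by rewrite src_mk; exact: cvg_id.
by apply/funext => y; rewrite src_mk.
Qed.

Lemma ran_continuous : continuous (@ran k C).
Proof.
elim/germ_ind => s x h; apply: germ_cvg => //.
rewrite ran_mk//; apply: cvg_trans (sact_cvg h).
have : \forall y \near x, sact s y = ran (mk s y).
  by apply: filterS (near_bdom h) => y hy; rewrite ran_mk.
by move=> /near_eq_cvg; apply.
Qed.

Lemma near_un x : \forall y \near x, un y = mk (uel x) y.
Proof.
near=> y; rewrite (mk_un (s := uel x))//; last exact: uelE.
near: y; exact/near_bdom/bdom_uel.
Unshelve. all: by end_near. Qed.

Lemma un_continuous : continuous (@un k C).
Proof.
move=> x; apply: cvg_trans (mk_cvg (bdom_uel x)).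
have : \forall y \near x, mk (uel x) y = un y.
  by apply: filterS (near_un x) => y ->.
by move=> /near_eq_cvg; apply.
Qed.

Hypothesis halign : finitely_aligned C.

Lemma mk_neq_near s t x : bdom s x -> bdom t x -> mk s x <> mk t x ->
  \forall y \near x, mk s y <> mk t y.
Proof.
move=> hs ht ne; have [e xe He] := mk_neq_loc halign hs ht ne.
by apply: filterS (near_ev x e) => y; rewrite xe => /He[].
Qed.

Lemma near_dg g : \forall h \near g, dg halign h = dg halign g.
Proof.
elim/germ_ind: g => s x h; apply: near_mk => //.
have [e xe He] := dg_loc halign h.
by apply: filterS (near_ev x e) => y; rewrite xe => /He[].
Qed.

(** The unit space is clopen: equality with a unit persists nearby, and so does inequality, by
    [mk_neq_near]. *)
Lemma near_unit g : \forall h \near g, (h == un (src h)) = (g == un (src g)).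
Proof.
elim/germ_ind: g => s x h; apply: near_mk => //; rewrite src_mk.
have [E|/eqP ne] := eqVneq (mk s x) (un x).
  apply: filterS2 (near_un x) (mk_eq_near h (bdom_uel x) E) => y E1 E2.
  by rewrite src_mk E1 E2 eqxx.
apply: filterS2 (near_un x) (mk_neq_near h (bdom_uel x) ne) => y Ey ney.
by rewrite src_mk Ey; apply/negbTE/eqP.
Qed.

Lemma open_image_mk s V : open V -> V `<=` bdom s -> open (mk s @` V).
Proof.
move=> oV Vs; rewrite openE => _ [x Vx <-]; apply: nbhs_mk_image; first exact: Vs.
exact: open_nbhs_nbhs.
Qed.

Lemma closed_image_mk s V : open V -> closed V -> V `<=` bdom s -> closed (mk s @` V).
Proof.
move=> oV cV Vs; rewrite -[mk s @` V]setCK; apply: open_closedC.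
rewrite openE; elim/germ_ind => t y ht /= nW; apply: near_mk => //.
have H z : (mk s @` V) (mk t z) -> V z /\ mk s z = mk t z.
  by move=> [z' Vz E]; have := congr1 (@src k C) E; rewrite !src_mk => Ez; subst z'.
have [Vy|nVy] := pselect (V y).
  have ne : mk s y <> mk t y by move=> E; apply: nW; exists y.
  by apply: filterS (mk_neq_near (Vs _ Vy) ht ne) => z nz /H[_ /nz].
have : nbhs y (~` V) by apply: open_nbhs_nbhs; split=> //; exact: closed_openC.
by apply: filterS => z nVz /H[/nVz].
Qed.

Lemma compact_image_mk s V : compact V -> V `<=` bdom s -> compact (mk s @` V).
Proof.
move=> cV Vs F FF FW; pose F' : set_system (bdry C) := [set B | F (mk s @` (B `&` V))].
have inj y z : V y -> mk s y = mk s z -> y = z.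
  by move=> _ E; have := congr1 (@src k C) E; rewrite !src_mk.
have FF' : ProperFilter F'.
  apply: Build_ProperFilter_ex.
    move=> B FB; have [_ [y [By _] _]] := @filter_ex _ F _ _ FB.
    by exists y.
  split; first by rewrite /F' /= setTI.
    move=> B D FB FD; apply: (@filterS _ F _ _ _ _ (@filterI _ F _ _ _ FB FD)) => _ [[y [By Vy] <-] [z [Dz Vz] E]].
    by exists y => //; split=> //; split=> //; rewrite -(inj _ _ Vz E).
  by move=> B D BD; apply: (@filterS _ F) => _ [y [/BD Dy Vy] <-]; exists y.
have [|x [Vx cl]] := cV F' FF'; first by rewrite /F' /= setIid.
exists (mk s x); split; first by exists x.
move=> A W FA /(nbhs_mk (Vs _ Vx)) nW.
have FA' : F' [set y | A (mk s y)].
  by apply: (@filterS _ F _ _ _ _ (filterI FA FW)) => z [Az [y Vy Ez]]; exists y => //; split=> //=; rewrite Ez.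
by have [y [Ay Wy]] := cl _ _ FA' nW; exists (mk s y).
Qed.

End GermTopology.

Section ComplexContinuity.
Context {R : realType} {T : topologicalType}.
Implicit Types (f g : T -> R[i]).

Lemma cvgCP f x : (f : T -> R[i]^o) @ x --> (f x : R[i]^o) <->
  forall e : R, 0 < e -> \forall y \near x, normc (f x - f y) < e.
Proof.
rewrite cvgrPdist_lt; split=> H e e0.
  have := H e%:C%C; rewrite ltcR => /(_ e0).
  by apply: filterS => y; rewrite normr_normc ltcR.
(* The norm of R[i] has values in R[i], but a positive complex number is real. *)
case: e e0 => a b; rewrite ltcE /= => /andP[/eqP b0 a0].
have := H a a0; apply: filterS => y; rewrite normr_normc.
by rewrite ltcE /= b0 eqxx.
Qed.

End ComplexContinuity.

(** * Kernels of operators *)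

Section Kernels.
Context {k : nat} {C : hrGraph k} {R : realType}.
Notation G := (germ C).
Notation E2 := (ell2 C R).
Notation op := (oper C R).
Implicit Types (xi eta : E2) (f : G -> R[i]) (A : seq G) (S T : op).
Implicit Types (x y : bdry C) (e : J C) (s t : Il C) (g h a b : G) (u : bdry C -> R[i]).

(** Solves ah = g for h, so that the convolution at g runs over the germs a with range [ran g]. *)
Lemma gprod_div a h g : gprod a h g <-> ran a = ran g /\ h = gm (Il_inv (gel a)) g.
Proof.
rewrite gprodP; split=> [[E Ea]|[E ->]].
  have sa : src a = ran h by rewrite Ea src_gdiv.
  have hb : bdom (gel a) (ran h) by rewrite -sa; exact: bdom_gel.
  split; first by rewrite Ea ran_gdiv.
  have -> : g = gm (gel a) h by apply/(gdiv_mkP E hb); rewrite -Ea -sa mk_gel.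
  by rewrite gmK.
have hb : bdom (Il_inv (gel a)) (ran g) by rewrite -E ran_gel; exact/bdom_inv/bdom_gel.
have rh : ran (gm (Il_inv (gel a)) g) = src a.
  by rewrite ran_gm// -E ran_gel sactK//; exact: bdom_gel.
have hb' : bdom (gel a) (ran (gm (Il_inv (gel a)) g)) by rewrite rh; exact: bdom_gel.
split; first by rewrite src_gm.
have := gdiv_gm hb'; rewrite rh mk_gel => Ea; rewrite -{1}Ea.
by have := gmK hb; rewrite Il_invK => ->.
Qed.

Lemma gdiv_gm_l s g h : src g = src h -> bdom s (ran g) -> gdiv (gm s g) h = gm s (gdiv g h).
Proof.
move=> E hs; have hb := gdiv_bdom E; have Eg := gdivK E.
set t := Il_mul _ _ in hb Eg.
have st : bdom s (sact t (ran h)) by rewrite -ran_gm// Eg.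
rewrite -{1}Eg gm_gm// gdiv_gm; last exact/bdom_mul.
by rewrite gm_mk.
Qed.

(** [regular] tested on basis vectors. No sum over factorizations occurs, so the notion makes sense
    for kernels with infinite range fibres, where a finitely supported sum is meaningless, and it
    passes to norm limits ([coef_closure]). *)
Definition coef f T := bounded_op T /\
  forall h g, T (delta h) g = if src g == src h then f (gdiv g h) else 0.

Lemma coef_uniq f S T : coef f S -> coef f T -> S = T.
Proof. by move=> [bS HS] [bT HT]; apply: op_ext => // h g; rewrite HS HT. Qed.

Lemma coef_ext f f' T : f =1 f' -> coef f T -> coef f' T.
Proof. by move=> E [bT H]; split=> // h g; rewrite H E. Qed.

Lemma coef_lin (c : R[i]) f f' S T : coef f S -> coef f' T ->
  coef (fun a => c * f a + f' a) (c *: S + T).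
Proof.
move=> [bS HS] [bT HT]; split.
  by apply: bounded_opD => //; exact: bounded_opZ.
move=> h g; rewrite operE ell2D operE ell2Z HS HT.
by case: ifP => //; rewrite mulr0 addr0.
Qed.

Lemma coef0 : coef (fun=> 0) 0.
Proof. by split=> [|h g]; [exact: bounded_op0|case: ifP]. Qed.

Lemma coefD f f' S T : coef f S -> coef f' T -> coef (fun a => f a + f' a) (S + T).
Proof.
move=> HS HT; have := coef_lin 1 HS HT; rewrite scale1r.
by apply: coef_ext => a; rewrite mul1r.
Qed.

Lemma coefZ (c : R[i]) f T : coef f T -> coef (fun a => c * f a) (c *: T).
Proof.
move=> HT; have := coef_lin c HT coef0; rewrite addr0.
by apply: coef_ext => a; rewrite addr0.
Qed.

Lemma coefB f f' S T : coef f S -> coef f' T -> coef (fun a => f a - f' a) (S - T).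
Proof.
move=> HS HT; have := coef_lin (-1) HT HS; rewrite scaleN1r addrC.
by apply: coef_ext => a; rewrite mulN1r addrC.
Qed.

Lemma regular_coef f T : regular f T -> coef f T.
Proof.
move=> [bT HT]; split=> // h g; rewrite HT.
case: eqVneq => [E|nE].
  rewrite -(fsbig_widen [set (gdiv g h, h)]).
  - by rewrite fsbig_set1 /= deltaE eqxx mulr1.
  - by move=> _ ->; apply/gprodP.
  - move=> [a b] /= [/gprodP[Eb Ea] nab]; rewrite deltaE; case: eqP => [Ebh|]; last by rewrite mulr0.
    by case: nab; rewrite Ea Ebh.
rewrite fsbig1// => -[a b] /gprodP[/= Eb Ea]; rewrite deltaE.
by case: eqP => [Ebh|]; rewrite ?mulr0//; rewrite Eb Ebh eqxx in nE.
Qed.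

Definition fibre_finite f := forall x, finite_set [set a | ran a = x /\ f a != 0].

(** At a fixed g the convolution sum is finite, hence a bounded functional of xi, as is T xi g; they
    agree on basis vectors, so everywhere by density. *)
Lemma coef_regular f T : fibre_finite f -> coef f T -> regular f T.
Proof.
move=> ff [bT HT]; split=> // xi g.
have [s Es] := proj1 finite_fsetP (ff (ran g)).
have sP a : a \in s <-> ran a = ran g /\ f a != 0.
  have -> : (a \in s : Prop) = [set` s] a by [].
  by rewrite -Es.
pose lq a := gm (Il_inv (gel a)) g.
pose phi xi := \sum_(a <- s) f a * xi (lq a).
have -> : \sum_(ab \in [set ab | gprod ab.1 ab.2 g]) f ab.1 * xi ab.2 = phi xi.
  rewrite -(fsbig_widen [set` [seq (a, lq a) | a <- s]]).
  - rewrite -fsbig_seq ?big_map// map_inj_uniq ?fset_uniq//.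
    by move=> a b [].
  - move=> _ /= /mapP[a /sP[ra _] ->] /=; exact/gprod_div.
  - move=> [a b] /= [/gprod_div[ra ->] nab]; have [->|fa] := eqVneq (f a) 0.
      by rewrite mul0r.
    by case: nab; apply/mapP; exists a => //; apply/sP.
have phiB xi1 xi2 : phi (xi1 - xi2) = phi xi1 - phi xi2.
  by rewrite /phi -sumrB; apply: eq_bigr => a _; rewrite ell2B mulrBr.
pose c := \sum_(a <- s) normc (f a).
have phib eta : normc (phi eta) <= c * l2norm eta.
  rewrite /c big_distrl /=; apply: le_trans (normc_sum _ _ _) _.
  apply: ler_sum => a _; rewrite normcM ler_wpM2l ?normc_ge0//.
  exact: normc_le_l2norm.
have phid h : phi (delta h) = T (delta h) g.
  rewrite HT /phi; have H a : a \in s -> (lq a == h) = (src g == src h) && (a == gdiv g h).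
    move=> /sP[ra _]; apply/eqP/andP => [E|[/eqP E /eqP Ea]].
      have /gprodP[/= E1 E2] : gprod a h g by apply/gprod_div.
      by split; apply/eqP.
    by have /gprod_div[_ ->] : gprod a h g by exact/gprodP.
  rewrite big_seq; under eq_bigr => a sa do rewrite deltaE H//.
  rewrite -big_seq; case: eqP => [E|_] /=; last by rewrite big1// => a _; rewrite mulr0.
  have [gs|gs] := boolP (gdiv g h \in s).
    rewrite (bigD1_seq (gdiv g h)) ?fset_uniq//= eqxx mulr1 big1 ?addr0//.
    by move=> a /negPf ->; rewrite mulr0.
  rewrite big_seq big1; last first.
    move=> a sa; case: eqP => [Ea|_]; last by rewrite mulr0.
    by rewrite -Ea sa in gs.
  apply/eqP; apply: contraNT gs => fa; apply/sP; split; last by rewrite eq_sym.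
  by rewrite ran_gdiv.
have [M M0 HM] := bounded_ex bT.
apply/eqP; rewrite -subr_eq0; apply/eqP/normc_eq0/le_anti; rewrite normc_ge0 andbT.
have cM : 0 <= M + c by rewrite addr_ge0// /c sumr_ge0// => a _; exact: normc_ge0.
apply/ler_addgt0Pr => e e0; rewrite add0r.
have e1 : 0 < e / (M + c + 1) by rewrite divr_gt0// ltr_pwDr.
have [A uA HA] := restr_approx xi e1.
set eta := xi - _ in HA.
have -> : T xi g - phi xi = T eta g - phi eta.
  rewrite /eta (linear_opB _ _ (proj1 bT)) ell2B phiB restr_fin//.
  rewrite (linear_op_sum _ _ _ (proj1 bT)) ell2_sum.
  have -> : phi (\sum_(g <- A) xi g *: delta g) =
      \sum_(g' <- A) T (xi g' *: delta g') g.
    rewrite /phi; under eq_bigr do rewrite ell2_sum big_distrr /=.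
    rewrite exchange_big /=; apply: eq_bigr => h _.
    rewrite (linear_opZ _ _ (proj1 bT)) ell2Z -phid /phi big_distrr /=.
    by apply: eq_bigr => a _; rewrite ell2Z mulrCA.
  by rewrite opprB addrA subrK.
apply: le_trans (normcD _ _) _; rewrite normcN.
apply: le_trans (lerD (normc_le_l2norm _ _) (phib _)) _.
apply: le_trans (_ : _ <= (M + c) * (e / (M + c + 1))) _.
  rewrite mulrDl lerD//.
    by rewrite (le_trans (HM _))// ler_wpM2l.
  by rewrite ler_wpM2l// /c sumr_ge0// => a _; exact: normc_ge0.
rewrite mulrCA; apply: ler_piMr; first exact: ltW.
by rewrite ler_pdivrMr ?ltr_pwDr// mul1r lerDl.
Qed.

Definition ker T a : R[i] := T (delta (un (src a))) a.

Lemma coef_ker f T : coef f T -> ker T =1 f.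
Proof. by move=> [_ H] a; rewrite /ker H src_un eqxx gdiv_un. Qed.

Lemma ker_le T M a : 0 <= M -> op_le T M -> normc (ker T a) <= M.
Proof.
move=> M0 HT; apply: le_trans (normc_le_l2norm _ _) _.
by rewrite (le_trans (HT _))// ler_piMr// l2norm_delta.
Qed.

Lemma kerB S T a : ker (S - T) a = ker S a - ker T a. Proof. by []. Qed.

(** Matrix entries converge uniformly under norm limits, so an entry of the limit still depends only
    on g h^-1. *)
Lemma coef_closure (X : set op) T : (forall S, X S -> exists f, coef f S) ->
  op_closure X T -> coef (ker T) T.
Proof.
move=> HX [bT HT]; split=> // h g.
apply/eqP; rewrite -subr_eq0; apply/eqP/normc_eq0/le_anti; rewrite normc_ge0 andbT.
apply/ler_addgt0Pr => e e0; rewrite add0r.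
have e2 : 0 < e / 2 by rewrite divr_gt0.
have [S XS TS] := HT _ e2; have [f [_ HS]] := HX S XS.
have H h' g' : normc (T (delta h') g' - S (delta h') g') <= e / 2.
  apply: le_trans (normc_le_l2norm ((T - S) (delta h')) g') _.
  by rewrite (le_trans (TS _))// ler_piMr ?l2norm_delta// ltW.
case: eqVneq => [E|nE]; last first.
  have := H h g; rewrite HS (negPf nE) => H1; apply: le_trans H1 _.
  by lra.
have -> : T (delta h) g - ker T (gdiv g h) = (T (delta h) g - S (delta h) g) +
   (S (delta h) g - ker T (gdiv g h)) by rewrite addrA subrK.
apply: le_trans (normcD _ _) _; rewrite [leRHS](splitr e); apply: lerD => //.
rewrite normcB HS E eqxx /ker.
have := H (un (src (gdiv g h))) (gdiv g h); rewrite HS src_un eqxx.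
by rewrite gdiv_un.
Qed.

End Kernels.

(** * Multiplication operators and slice operators *)

Section ConcreteOperators.
Context {k : nat} {C : hrGraph k} {R : realType}.
Notation G := (germ C).
Notation E2 := (ell2 C R).
Notation op := (oper C R).
Implicit Types (xi eta : E2) (f : G -> R[i]) (A : seq G) (S T : op).
Implicit Types (x y : bdry C) (e : J C) (s t : Il C) (g h a b : G) (u v : bdry C -> R[i]).

Lemma diag_opP (w : G -> R[i]) m : 0 <= m -> (forall g, normc (w g) <= m) ->
  let T := opf (fun xi g => w g * xi g) in
  [/\ bounded_op T, op_le T m & forall xi g, T xi g = w g * xi g].
Proof.
move=> m0 wm; apply: opfP => // [a xi eta g|xi A uA].
  by rewrite ell2D ell2Z mulrDr mulrCA.
apply: le_trans (_ : _ <= m ^+ 2 * \sum_(g <- A) normc (xi g) ^+ 2) _.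
  rewrite big_distrr /=; apply: ler_sum => g _; rewrite normcM exprMn.
  by rewrite ler_wpM2r ?sqr_ge0// ler_pXn2r ?nnegrE ?normc_ge0.
by rewrite exprMn ler_wpM2l ?sqr_ge0// sum_le_l2norm.
Qed.

Definition Mo u : op := opf (fun xi g => u (ran g) * xi g).

Lemma MoP u m : 0 <= m -> (forall x, normc (u x) <= m) ->
  [/\ bounded_op (Mo u), op_le (Mo u) m & forall xi g, Mo u xi g = u (ran g) * xi g].
Proof. by move=> m0 H; apply: diag_opP. Qed.

#[global] Opaque Mo.

Definition bounded_fun u := exists2 m, 0 <= m & forall x, normc (u x) <= m.

Lemma Mo_bounded u : bounded_fun u -> bounded_op (Mo u).
Proof. by move=> [m m0 H]; have [] := MoP m0 H. Qed.
Lemma MoE u xi g : bounded_fun u -> Mo u xi g = u (ran g) * xi g.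
Proof. by move=> [m m0 H]; have [] := MoP m0 H. Qed.

Lemma MoB u v : bounded_fun u -> bounded_fun v -> bounded_fun (fun x => u x - v x) ->
  Mo (fun x => u x - v x) = Mo u - Mo v.
Proof.
move=> bu bv buv; apply/funext => xi; apply: ell2_ext => g.
by rewrite oper_subE ell2B !MoE// mulrBl.
Qed.

Lemma Mo_delta u h : bounded_fun u -> Mo u (delta h) = u (ran h) *: delta h.
Proof.
move=> bu; apply: ell2_ext => g; rewrite MoE// ell2Z deltaE.
by case: eqP => [->|]; rewrite ?mulr0.
Qed.

Lemma coef_Mo_l u f T : bounded_fun u -> coef f T ->
  coef (fun a => u (ran a) * f a) (Mo u \o T).
Proof.
move=> bu [bT HT]; split; first by apply: bounded_comp => //; exact: Mo_bounded.
move=> h g; rewrite /= MoE// HT; case: eqP => [E|]; last by rewrite mulr0.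
by rewrite ran_gdiv.
Qed.

Lemma coef_Mo_r u f T : bounded_fun u -> coef f T ->
  coef (fun a => f a * u (src a)) (T \o Mo u).
Proof.
move=> bu [bT HT]; split; first by apply: bounded_comp => //; exact: Mo_bounded.
move=> h g; rewrite /= Mo_delta// (linear_opZ _ _ (proj1 bT)) ell2Z HT.
by case: eqP => [E|]; rewrite ?mulr0// mulrC src_gdiv.
Qed.

Lemma unit_extE u a : unit_ext u a = if a == un (src a) then u (src a) else 0.
Proof.
rewrite /unit_ext; case: asboolP => [/gunitP <-|n]; first by rewrite eqxx.
by case: eqP => // /gunitP.
Qed.

Lemma gdiv_unit g h : src g = src h -> (gdiv g h == un (ran h)) = (g == h).
Proof.
move=> E; apply/eqP/eqP => [Eg|->]; last exact: gdivv.
by apply: (gdiv_inj E erefl); rewrite Eg gdivv.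
Qed.

Lemma coef_Mo u : bounded_fun u -> coef (unit_ext u) (Mo u).
Proof.
move=> bu; split; first exact: Mo_bounded.
move=> h g; rewrite Mo_delta// ell2Z deltaE unit_extE src_gdiv.
case: (eqVneq g h) => [->|ne]; first by rewrite eqxx gdivv eqxx mulr1.
rewrite mulr0; case: eqP => // E.
by rewrite gdiv_unit// (negPf ne).
Qed.

Lemma unit_ext_fibre u : fibre_finite (unit_ext u).
Proof.
move=> x; apply: (sub_finite_set _ (finite_set1 (un x))) => a [<-].
rewrite unit_extE; case: (a =P un (src a)) => [E _|]; last by rewrite eqxx.
by rewrite /= {2}E ran_un.
Qed.

Lemma regular_Mo u : bounded_fun u -> regular (unit_ext u) (Mo u).
Proof. by move=> bu; apply: coef_regular; [exact: unit_ext_fibre|exact: coef_Mo]. Qed.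

(** Convolution by the indicator of the slice of s, a partial isometry implementing s. *)
Definition Wo s : op :=
  opf (fun xi g => if `[< bdom (Il_inv s) (ran g) >] then xi (gm (Il_inv s) g) else 0).

Lemma WoP s : [/\ bounded_op (Wo s), op_le (Wo s) 1 &
  forall xi g, Wo s xi g = if `[< bdom (Il_inv s) (ran g) >] then xi (gm (Il_inv s) g) else 0].
Proof.
apply: opfP => // [a xi eta g|xi A uA].
  by case: ifP => _; rewrite ?ell2D ?ell2Z// mulr0 addr0.
rewrite mul1r; pose B := [seq g <- A | `[< bdom (Il_inv s) (ran g) >]].
apply: le_trans (_ : _ <= \sum_(g <- [seq gm (Il_inv s) g | g <- B]) normc (xi g) ^+ 2) _.
  rewrite big_map big_filter [leRHS]big_mkcond /=; apply: ler_sum => g _.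
  by case: ifP => // _; rewrite normc0 expr0n.
apply: sum_le_l2norm; rewrite map_inj_in_uniq ?filter_uniq//.
move=> g h; rewrite !mem_filter => /andP[/asboolP bg _] /andP[/asboolP bh _] E.
by rewrite -(gmK bg) E gmK.
Qed.

#[global] Opaque Wo.

Lemma Wo_bounded s : bounded_op (Wo s). Proof. by have [] := WoP s. Qed.
Lemma Wo_le s : op_le (Wo s) 1. Proof. by have [] := WoP s. Qed.
Lemma WoE s xi g : Wo s xi g =
  if `[< bdom (Il_inv s) (ran g) >] then xi (gm (Il_inv s) g) else 0.
Proof. by have [] := WoP s. Qed.

Lemma coef_Wo_l s f T : coef f T ->
  coef (fun a => if `[< bdom (Il_inv s) (ran a) >] then f (gm (Il_inv s) a) else 0) (Wo s \o T).
Proof.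
move=> [bT HT]; split; first by apply: bounded_comp => //; exact: Wo_bounded.
move=> h g; rewrite /= WoE HT src_gm; case: eqP => [E|]; last by case: ifP.
rewrite ran_gdiv//; case: asboolP => // H; by rewrite gdiv_gm_l.
Qed.

Lemma Il_inv_mul s t : Il_inv (Il_mul s t) = Il_mul (Il_inv t) (Il_inv s).
Proof.
by apply: val_inj; apply/seteqP; split=> -[u v] [w H1 H2]; exists w.
Qed.

Lemma Wo_mul s t : Wo s \o Wo t = Wo (Il_mul s t).
Proof.
apply/funext => xi; apply: ell2_ext => g; rewrite /= WoE [RHS]WoE Il_inv_mul.
have -> : `[< bdom (Il_mul (Il_inv t) (Il_inv s)) (ran g) >] =
  `[< bdom (Il_inv s) (ran g) /\ bdom (Il_inv t) (sact (Il_inv s) (ran g)) >].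
  by congr asbool; apply/propext; exact: bdom_mul.
case: asboolP => [H|H]; last by case: asboolP => // -[].
rewrite WoE ran_gm//; case: asboolP => [H2|H2]; last by case: asboolP => // -[].
by case: asboolP => [_|[]//]; rewrite gm_gm.
Qed.

Definition pull s u : bdry C -> R[i] := fun y => if `[< bdom s y >] then u (sact s y) else 0.

Lemma pull_bounded s u : bounded_fun u -> bounded_fun (pull s u).
Proof.
by move=> [m m0 H]; exists m => // x; rewrite /pull; case: ifP; rewrite ?normc0.
Qed.

(** The covariance relation of the partial action. *)
Lemma Mo_Wo u s : bounded_fun u -> Mo u \o Wo s = Wo s \o Mo (pull s u).
Proof.
move=> bu; apply/funext => xi; apply: ell2_ext => g.
rewrite /= (MoE _ _ bu) (WoE s xi) [RHS]WoE; case: asboolP => [H|]; last by rewrite mulr0.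
rewrite MoE; last exact: pull_bounded.
rewrite ran_gm// /pull; case: asboolP => [_|[]]; last exact: bdom_inv'.
by rewrite sactVK.
Qed.

Lemma Mo_mul u u' : bounded_fun u -> bounded_fun u' ->
  Mo u \o Mo u' = Mo (fun x => u x * u' x).
Proof.
move=> bu bu'; have buu : bounded_fun (fun x => u x * u' x).
  have [m m0 H] := bu; have [m' m0' H'] := bu'.
  by exists (m * m'); [exact: mulr_ge0|move=> x; rewrite normcM ler_pM ?normc_ge0].
by apply/funext => xi; apply: ell2_ext => g; rewrite /= !MoE// mulrA.
Qed.

Lemma bounded_funM u u' : bounded_fun u -> bounded_fun u' -> bounded_fun (fun x => u x * u' x).
Proof.
move=> [m m0 H] [m' m0' H'].
by exists (m * m'); [exact: mulr_ge0|move=> x; rewrite normcM ler_pM ?normc_ge0].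
Qed.

Definition bas s u a : R[i] :=
  if `[< bdom s (src a) /\ a = mk s (src a) >] then u (src a) else 0.

Lemma bas_mk s u x : bdom s x -> bas s u (mk s x) = u x.
Proof. by move=> h; rewrite /bas src_mk; case: asboolP => // -[]. Qed.

Lemma coef_bas s u : bounded_fun u -> coef (bas s u) (Wo s \o Mo u).
Proof.
move=> bu; apply: coef_ext (coef_Wo_l s (coef_Mo bu)) => a.
rewrite unit_extE src_gm /bas; case: asboolP => [H|H]; last first.
  case: asboolP => // -[hs Ea]; case: H; rewrite Ea ran_mk//; exact: bdom_inv.
case: asboolP => [[hs Ea]|n].
  rewrite {1}Ea -gm_un// gmK ?eqxx//; by rewrite ran_un.
case: eqP => // E; case: n.
have hs : bdom s (src a).
  have := bdom_inv' H; rewrite -ran_gm// E ran_un//.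
split=> //; rewrite -{1}(gm_un hs) -E.
by have := gmK H; rewrite Il_invK => ->.
Qed.

(** The only passage from a uniform bound on a kernel to a norm bound: each slice contributes a
    contraction times a multiplication of norm at most m. Slices are removed one at a time, without
    continuity, so overlaps do no harm. *)
Lemma bound_ex (ss : seq (Il C)) f m : 0 <= m -> (forall a, normc (f a) <= m) ->
  (forall a, f a != 0 -> exists2 s, s \in ss & bdom s (src a) /\ a = mk s (src a)) ->
  exists2 T, coef f T & op_le T ((size ss)%:R * m).
Proof.
move=> m0; elim: ss f => [|s ss IH] f fm sf.
  exists 0; last by move=> xi; rewrite operE l2norm0 mul0r mul0r.
  apply: coef_ext coef0 => a; apply/eqP; rewrite eq_sym; apply/negPn/negP.
  by move=> /sf[].
pose u x := if `[< bdom s x >] then f (mk s x) else 0.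
have bu : bounded_fun u by exists m => // x; rewrite /u; case: ifP; rewrite ?normc0.
have um x : normc (u x) <= m by rewrite /u; case: ifP; rewrite ?normc0.
pose f2 a := if `[< bdom s (src a) /\ a = mk s (src a) >] then 0 else f a.
have [|a|T2 H2 L2] := IH f2.
- by move=> a; rewrite /f2; case: ifP; rewrite ?normc0.
- rewrite /f2; case: asboolP => [_|n]; first by rewrite eqxx.
  by move=> /sf[t]; rewrite inE => /orP[/eqP-> //|tss Ht]; exists t.
exists (Wo s \o Mo u + T2).
  apply: coef_ext (coefD (coef_bas s bu) H2) => a; rewrite /bas /f2.
  case: asboolP => [[hs Ea]|]; last by rewrite add0r.
  by rewrite addr0 /u; case: asboolP => // _; rewrite -Ea.
rewrite -natr1 addrC mulrDl mul1r; apply: op_leD => //; rewrite -[m]mul1r.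
apply: op_le_comp => //; first exact: Wo_le.
by have [] := MoP m0 um.
Qed.

Lemma finite_cover_fibre (ss : seq (Il C)) f :
  (forall a, f a != 0 -> exists2 s, s \in ss & bdom s (src a) /\ a = mk s (src a)) ->
  fibre_finite f.
Proof.
move=> H x.
apply: (@sub_finite_set _ _ [set` [seq mk s (sact (Il_inv s) x) | s <- ss]]); last first.
  exact: finite_seq.
move=> a [ra /H[s sss [hs Ea]]]; apply/mapP; exists s => //.
by rewrite -ra {2}Ea ran_mk// sactK.
Qed.

End ConcreteOperators.

(** * Gauge automorphisms as conjugation by diagonal unitaries *)

Section Gauge.
Context {k : nat} {C : hrGraph k} {R : realType}.
Hypothesis halign : finitely_aligned C.
Notation G := (germ C).
Notation E2 := (ell2 C R).
Notation op := (oper C R).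
Notation dg := (dg halign).
Implicit Types (xi eta : E2) (f : G -> R[i]) (S T : op) (z : 'I_k -> R[i]).

Definition zp z (n : {ffun 'I_k -> int}) : R[i] := \prod_i z i ^ n i.

Lemma torus_neq0 z i : torus z -> z i != 0.
Proof. by move=> /(_ i) h; rewrite -normr_eq0 h oner_eq0. Qed.

Lemma zpD z n m : torus z -> zp z (n + m) = zp z n * zp z m.
Proof.
move=> tz; rewrite /zp -big_split /=; apply: eq_bigr => i _.
by rewrite ffunE expfzDr// torus_neq0.
Qed.

Lemma zp0 z : zp z 0 = 1.
Proof. by rewrite /zp big1// => i _; rewrite ffunE. Qed.

Definition zinv z : 'I_k -> R[i] := fun i => (z i)^-1.

Lemma torus_inv z : torus z -> torus (zinv z).
Proof. by move=> tz i; rewrite /zinv normfV tz invr1. Qed.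

Lemma zinvK z : zinv (zinv z) = z.
Proof. by apply/funext => i; rewrite /zinv invrK. Qed.

Lemma zp_inv z n : torus z -> zp (zinv z) n * zp z n = 1.
Proof.
move=> tz; rewrite /zp -big_split /= big1// => i _.
by rewrite /zinv exprz_inv -expfzDr ?torus_neq0// addNr.
Qed.

Lemma normc_zp z n : torus z -> normc (zp z n) = 1.
Proof.
move=> tz; have : `|zp z n| = 1.
  rewrite /zp normr_prod big1// => i _.
  by case: (n i) => m; rewrite /exprz ?normfV normrX tz expr1n ?invr1.
by rewrite normr_normc => -[].
Qed.

Definition Vo z : op := opf (fun xi g => zp z (dg g) * xi g).

Lemma VoP z : torus z ->
  [/\ bounded_op (Vo z), op_le (Vo z) 1 & forall xi g, Vo z xi g = zp z (dg g) * xi g].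
Proof. by move=> tz; apply: diag_opP => // g; rewrite normc_zp. Qed.

#[global] Opaque Vo.

(** Conjugation is defined and contractive on all bounded operators, so gamma_z needs no extension
    from C_c by continuity; [coef_gz] identifies it on kernels through the cocycle identity dg(g
    h^-1) = dg g - dg h. *)
Definition gz z T : op := Vo z \o T \o Vo (zinv z).

Lemma gz_bounded z T : torus z -> bounded_op T -> bounded_op (gz z T).
Proof.
move=> tz bT; have [b1 _ _] := VoP tz; have [b2 _ _] := VoP (torus_inv tz).
by apply: bounded_comp b2; exact: bounded_comp.
Qed.

Lemma gz_le z T M : torus z -> 0 <= M -> op_le T M -> op_le (gz z T) M.
Proof.
move=> tz M0 HT; have [_ b1 _] := VoP tz; have [_ b2 _] := VoP (torus_inv tz).
have H := op_le_comp ler01 b1 HT.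
have M1 : 0 <= 1 * M by rewrite mul1r.
by have := op_le_comp M1 H b2; rewrite mul1r mulr1.
Qed.

Lemma gzB z S T : torus z -> gz z (S - T) = gz z S - gz z T.
Proof.
move=> tz; have [b1 _ _] := VoP tz; apply/funext => xi.
by rewrite oper_subE /gz /= oper_subE (linear_opB _ _ (proj1 b1)).
Qed.

Lemma gzK z T : torus z -> gz z (gz (zinv z) T) = T.
Proof.
move=> tz; have [_ _ v1] := VoP tz; have [_ _ v2] := VoP (torus_inv tz).
have K xi : Vo z (Vo (zinv z) xi) = xi.
  apply: ell2_ext => g; rewrite v1 v2 mulrA mulrC.
  by rewrite [X in _ * X]mulrC zp_inv// mulr1.
by apply/funext => xi; rewrite /gz /= zinvK !K.
Qed.

Lemma coef_gz z f T : torus z -> coef f T -> coef (fun a => zp z (dg a) * f a) (gz z T).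
Proof.
move=> tz [bT HT]; have [_ _ v1] := VoP tz; have [_ _ v2] := VoP (torus_inv tz).
split; first exact: gz_bounded.
move=> h g; rewrite /gz /= v1.
have -> : Vo (zinv z) (delta h) = zp (zinv z) (dg h) *: delta h.
  apply: ell2_ext => g'; rewrite v2 ell2Z deltaE.
  by case: eqP => [->|]; rewrite ?mulr0.
rewrite (linear_opZ _ _ (proj1 bT)) ell2Z HT; case: eqP => [E|]; last by rewrite !mulr0.
have -> : dg g = dg (gdiv g h) + dg h by rewrite dg_gdiv// subrK.
rewrite zpD// -mulrA; congr (_ * _).
by rewrite mulrA [X in X * _]mulrC zp_inv// mul1r.
Qed.

Lemma zpow_zp z c d x : dm c = dm d -> bdom (Il_frac c d) x ->
  zpow z c d = zp z (dg (mk (Il_frac c d) x)).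
Proof.
move=> cd h; rewrite dg_frac//; last exact: (proj1 (bdom_frac x cd)).
by apply: eq_bigr => i _; rewrite ffunE.
Qed.

Lemma gauge_funP z f f' : gauge_fun z f f' <-> forall a, f' a = zp z (dg a) * f a.
Proof.
split=> [H a|H c d p cd Ep].
  have [c [d [cd xd _ Ea]]] := germ_frac halign (bdom_gel a).
  have hf := proj2 (bdom_frac (src a) cd) xd.
  by have := H c d (mk_rep hf) cd erefl; rewrite -mkE -Ea mk_gel (zpow_zp _ cd hf) -Ea mk_gel.
have [-> h] := mkgermE p; rewrite Ep in h *; rewrite H.
by rewrite (zpow_zp _ cd h).
Qed.

End Gauge.

(** * C_c as the span of the operators [Wo s \o Mo u] *)

Section Span.
Context {k : nat} {C : hrGraph k} {R : realType}.
Hypothesis halign : finitely_aligned C.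
Notation G := (germ C).
Notation op := (oper C R).
Implicit Types (f : G -> R[i]) (S T : op) (x y : bdry C) (e : J C) (s t : Il C).
Implicit Types (a b g h : G) (u v : bdry C -> R[i]) (U Z : set (bdry C)).

Definition ccont u := continuous (u : bdry C -> R[i]^o).

Lemma near_nbhs_open x Z : open Z -> Z x -> \forall y \near x, Z y.
Proof. by move=> oZ Zx; exact: open_nbhs_nbhs. Qed.

Lemma cvgC_near (X : topologicalType) (u v : X -> R[i]) (x : X) : (\forall y \near x, u y = v y) ->
  (v : X -> R[i]^o) @ x --> (v x : R[i]^o) -> (u : X -> R[i]^o) @ x --> (u x : R[i]^o).
Proof.
move=> H /cvgCP cv; apply/cvgCP => e /cv; have Ex := nbhs_singleton H.
by apply: filterS2 H => y -> ; rewrite Ex.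
Qed.

Lemma cvgC_cst (X : topologicalType) (u : X -> R[i]) (x : X) c : (\forall y \near x, u y = c) ->
  (u : X -> R[i]^o) @ x --> (u x : R[i]^o).
Proof. by move=> H; apply: (cvgC_near (v := fun=> c)) H _; exact: cvg_cst. Qed.

Lemma open_Cbdom s : open (~` bdom s).
Proof. by apply: closed_openC; exact: closed_Zc. Qed.

Lemma ccont_ind Z : open Z -> closed Z -> ccont (fun x => (`[< Z x >])%:R).
Proof.
move=> oZ cZ x; have [Zx|nZx] := pselect (Z x).
  apply: (cvgC_cst (c := 1)); apply: filterS (near_nbhs_open oZ Zx) => y Zy.
  by case: asboolP.
apply: (cvgC_cst (c := 0)); have := @near_nbhs_open x (~` Z) (closed_openC cZ) nZx.
by apply: filterS => y nZy; case: asboolP.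
Qed.

Lemma ccontM u v : ccont u -> ccont v -> ccont (fun x => u x * v x).
Proof. by move=> cu cv x; exact: (cvgM (cu x) (cv x)). Qed.

Lemma ccont_pull s u : ccont u -> ccont (pull s u).
Proof.
move=> cu x; have [h|h] := pselect (bdom s x).
  apply: (cvgC_near (v := u \o sact s)).
    by apply: filterS (near_bdom h) => y hy; rewrite /pull; case: asboolP.
  exact: (@cvg_comp _ _ _ (sact s) (u : bdry C -> R[i]^o) _ _ _ (sact_cvg h) (cu _)).
apply: (cvgC_cst (c := 0)).
have := @near_nbhs_open x (~` bdom s) (open_Cbdom s) h.
by apply: filterS => y nZy; rewrite /pull; case: asboolP.
Qed.

Lemma ccont_compact_bounded u Z : ccont u -> compact Z ->
  exists m : R, forall x, Z x -> normc (u x) <= m.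
Proof.
move=> cu cZ.
apply: (compact_ind (P := fun Z => exists m : R, forall x, Z x -> normc (u x) <= m)) cZ _ _ _ _.
- by exists 0.
- by move=> V W [m H] WV; exists m => x /WV/H.
- move=> V W [m H] [m' H']; exists (Num.max m m') => x [/H|/H'] h.
    by rewrite le_max h.
  by rewrite le_max h orbT.
- move=> x _; exists [set y | normc (u x - u y) < 1].
    by apply: (proj1 (cvgCP _ _) (cu x)).
  exists (normc (u x) + 1) => y /= H.
  have := normcD (u x) (- (u x - u y)); rewrite normcN opprB addrC subrK => H2.
  by rewrite (le_trans H2)// lerD2l ltW.
Qed.

Lemma closed_normc_ge u (e : R) : ccont u -> closed [set x | e <= normc (u x)].
Proof.
move=> cu; rewrite -[X in closed X]setCK; apply: open_closedC; rewrite openE => x /= /negP.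
rewrite -ltNge => ux; have ue : 0 < e - normc (u x) by rewrite subr_gt0.
move: (proj1 (cvgCP _ _) (cu x) _ ue); apply: filterS => y Hy /=; apply/negP.
rewrite -ltNge; have := normcD (u x) (- (u x - u y)).
rewrite opprB addrC subrK [X in _ <= _ + X -> _]normcB; lra.
Qed.

(** C_c(U): the boundary has a base of compact open sets, so the support may be enclosed in one of
    them. *)
Definition KU U u := ccont u /\ exists Z, [/\ cko Z, Z `<=` U & forall x, ~ Z x -> u x = 0].

Lemma KU_sub U U' u : U `<=` U' -> KU U u -> KU U' u.
Proof. by move=> UU' [cu [Z [cZ ZU uZ]]]; split=> //; exists Z; split=> // x /ZU/UU'. Qed.

Lemma KU_bounded U u : KU U u -> bounded_fun u.
Proof.
move=> [cu [Z [[cZ _ _] _ uZ]]].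
have [m Hm] := ccont_compact_bounded cu cZ.
exists (Num.max 0 m); first by rewrite le_max lexx.
move=> x; have [Zx|/uZ->] := pselect (Z x); first by rewrite le_max Hm// orbT.
by rewrite normc0 le_max lexx.
Qed.

Lemma KU_ind U Z : cko Z -> Z `<=` U -> KU U (fun x => (`[< Z x >])%:R).
Proof.
move=> cZ ZU; split; first by apply: ccont_ind; case: cZ.
by exists Z; split=> // x nZ; case: asboolP.
Qed.

Lemma KU_mulr U u v : ccont u -> KU U v -> KU U (fun x => u x * v x).
Proof.
move=> cu [cv [Z [cZ ZU vZ]]]; split; first exact: ccontM.
by exists Z; split=> // x /vZ ->; rewrite mulr0.
Qed.

Lemma KU_mull U u v : KU U u -> ccont v -> KU U (fun x => u x * v x).
Proof.
move=> hu hv; have := KU_mulr hv hu; congr (KU _ _).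
by apply/funext => x; rewrite mulrC.
Qed.

Lemma invariant_sact U s x : invariant_set U -> bdom s x -> U (sact s x) <-> U x.
Proof. by move=> iU h; have := iU (mk s x); rewrite src_mk ran_mk// => H; split=> /H. Qed.

Lemma cko_preimage s Z : cko Z -> cko (bdom s `&` [set x | Z (sact s x)]).
Proof.
move=> [_ oZ dZ].
have H (W : set (bdry C)) : open W -> open (bdom s `&` [set x | W (sact s x)]).
  move=> oW; rewrite openE => x [/= hx Wx]; near=> y; split.
    by near: y; exact: near_bdom.
  near: y; apply: (sact_cvg hx); exact: near_nbhs_open.
have cl : closed (bdom s `&` [set x | Z (sact s x)]).
  rewrite -[X in closed X]setCK; apply: open_closedC.
  rewrite (_ : ~` _ = (~` bdom s) `|` (bdom s `&` [set x | (~` Z) (sact s x)])).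
    apply: openU; first exact: open_Cbdom.
    exact/H/closed_openC.
  apply/seteqP; split=> x /=.
    move=> n; have [h|h] := pselect (bdom s x); last by left.
    by right; split=> // Zx; apply: n.
  by move=> [n [h _]|[_ n] [_ /n]].
split=> //; last exact: H.
by apply: (subclosed_compact cl (compact_Zc (e := Jdom s))) => x [].
Unshelve. all: by end_near. Qed.

Lemma KU_pull U s u : invariant_set U -> KU U u -> KU U (pull s u).
Proof.
move=> iU [cu [Z [cZ ZU uZ]]]; split; first exact: ccont_pull.
exists (bdom s `&` [set x | Z (sact s x)]); split; first exact: cko_preimage.
- by move=> x [h /= /ZU]; move/(invariant_sact iU h).
- move=> x n; rewrite /pull; case: asboolP => // h; apply: uZ => Zx; exact: n.
Qed.

Inductive span U : op -> Prop :=
| span0 : span U 0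
| spanS s u T : KU U u -> span U T -> span U (Wo s \o Mo u + T).

Lemma span_bounded U T : span U T -> bounded_op T.
Proof.
elim=> [|s u {}T hu _ IH]; first exact: bounded_op0.
apply: bounded_opD => //; apply: bounded_comp; first exact: Wo_bounded.
exact/Mo_bounded/KU_bounded/hu.
Qed.

Lemma span1 U s u : KU U u -> span U (Wo s \o Mo u).
Proof. by move=> hu; rewrite -[_ \o _]addr0; apply: spanS => //; exact: span0. Qed.

Lemma spanD U S T : span U S -> span U T -> span U (S + T).
Proof.
move=> HS HT; elim: HS => [|s u {}S hu _ IH]; first by rewrite add0r.
by rewrite -addrA; exact: spanS.
Qed.

Lemma Mo_scale c u : bounded_fun u -> c *: Mo u = Mo (fun x => c * u x).
Proof.
move=> bu; apply/funext => xi; apply: ell2_ext => g.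
rewrite operE ell2Z !MoE ?mulrA//; apply: bounded_funM => //.
by exists (normc c) => //; exact: normc_ge0.
Qed.

Lemma spanZ U c T : span U T -> span U (c *: T).
Proof.
elim=> [|s u {}T hu _ IH]; first by rewrite scaler0; exact: span0.
rewrite scalerDr (_ : c *: (Wo s \o Mo u) = Wo s \o Mo (fun x => c * u x)).
  apply: spanS => //; apply: KU_mulr => // x; apply: (cvgC_cst (c := c)).
  by apply: filterE.
rewrite -Mo_scale; last exact: KU_bounded hu.
apply/funext => xi; rewrite operE /= operE.
by rewrite (linear_opZ _ _ (proj1 (Wo_bounded s))).
Qed.

Lemma WM_mul s t u v : bounded_fun u -> bounded_fun v ->
  (Wo s \o Mo u) \o (Wo t \o Mo v : op) = Wo (Il_mul s t) \o Mo (fun x => pull t u x * v x).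
Proof.
move=> bu bv; rewrite -Mo_mul//; last exact: pull_bounded.
rewrite -Wo_mul; apply/funext => xi /=; congr (Wo s _).
exact: (congr1 (fun T : op => T (Mo v xi)) (Mo_Wo t bu)).
Qed.

Lemma comp_addl S T S' : (S + T) \o S' = (S \o S') + (T \o S') :> op.
Proof. by []. Qed.

Lemma comp_addr S T S' : linear S -> S \o (T + S') = (S \o T) + (S \o S') :> op.
Proof. by move=> lS; apply/funext => xi; rewrite /= !operE linear_opD. Qed.

Lemma span_comp U1 U2 U S T :
  (forall t u v, KU U1 u -> KU U2 v -> KU U (fun x => pull t u x * v x)) ->
  span U1 S -> span U2 T -> span U (S \o T).
Proof.
move=> H HS; elim: HS => [|s u {}S hu HS IH] HT.
  by rewrite (_ : 0 \o T = 0)//; exact: span0.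
rewrite comp_addl; apply: spanD; [move: HT => {IH} HT|exact: IH].
have bu := KU_bounded hu.
elim: HT => [|t v {}T hv _ IHT].
  rewrite (_ : _ \o _ = 0); first exact: span0.
  have b : bounded_op (Wo s \o Mo u) by apply: bounded_comp; [exact: Wo_bounded|exact: Mo_bounded].
  by apply/funext => xi; exact: (linear_op0 (proj1 b)).
have b : bounded_op (Wo s \o Mo u) by apply: bounded_comp; [exact: Wo_bounded|exact: Mo_bounded].
rewrite comp_addr; last exact: (proj1 b).
apply: spanD => //; rewrite WM_mul//; last exact: KU_bounded hv.
exact/span1/H.
Qed.

Lemma span_comp_l U S T : span setT S -> span U T -> span U (S \o T).
Proof.
apply: span_comp => t u v [cu _] hv.
by apply: KU_mulr; [exact: ccont_pull|exact: hv].
Qed.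

Lemma span_comp_r U S T : invariant_set U -> span U S -> span setT T -> span U (S \o T).
Proof.
move=> iU; apply: span_comp => t u v hu [cv _].
by apply: KU_mull; [exact: KU_pull|exact: cv].
Qed.

Definition covered U (ss : seq (Il C * set (bdry C))) f :=
  (forall p, p \in ss -> [/\ cko p.2, p.2 `<=` U & p.2 `<=` bdom p.1]) /\
  forall a, f a != 0 -> exists2 p, p \in ss & p.2 (src a) /\ a = mk p.1 (src a).

Lemma Cc_covered U f : open U -> Cc U f -> exists ss, covered U ss f.
Proof.
move=> oU [cf sf sU].
have [ss [H1 H2]] : exists ss : seq (Il C * set (bdry C)),
    (forall p, p \in ss -> [/\ cko p.2, p.2 `<=` U & p.2 `<=` bdom p.1]) /\
    forall a, supp f a -> exists2 p, p \in ss & p.2 (src a) /\ a = mk p.1 (src a).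
  apply: (compact_ind (P := fun W => exists ss : seq (Il C * set (bdry C)),
    (forall p, p \in ss -> [/\ cko p.2, p.2 `<=` U & p.2 `<=` bdom p.1]) /\
    forall a, W a -> exists2 p, p \in ss & p.2 (src a) /\ a = mk p.1 (src a))) sf _ _ _ _.
  - by exists [::].
  - by move=> V W [ss [H1 H2]] WV; exists ss; split=> // a /WV/H2.
  - move=> V W [ss [H1 H2]] [ss' [H1' H2']]; exists (ss ++ ss'); split.
      by move=> p; rewrite mem_cat => /orP[/H1|/H1'].
    move=> a [/H2|/H2'] [p pss Hp]; exists p => //; rewrite mem_cat pss ?orbT//.
  - move=> a /sU[Ua _]; have h := bdom_gel a.
    have [Z [cZ Zx ZU]] : exists Z, [/\ cko Z, Z (src a) & Z `<=` U `&` bdom (gel a)].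
      apply: cko_nbhs; apply: filterI; first exact: near_nbhs_open.
      exact: near_bdom.
    exists (mk (gel a) @` Z).
      rewrite -{1}(mk_gel a); apply: nbhs_mk_image => //.
      by apply: near_nbhs_open => //; case: cZ.
    exists [:: (gel a, Z)]; split.
      by move=> p; rewrite inE => /eqP ->; split=> // x /ZU[].
    move=> b [x Zx' <-]; exists (gel a, Z); rewrite ?inE//= src_mk//.
by exists ss; split=> // a fa; apply: H2; exact: subset_closure.
Qed.

Lemma covered_fibre U ss f : covered U ss f -> fibre_finite f.
Proof.
move=> [H1 H2]; apply: (@finite_cover_fibre _ _ _ (map fst ss)) => a /H2[p pss [pa Ea]].
exists p.1; first exact: map_f.
by split=> //; have [_ _] := H1 p pss; exact.
Qed.

(** A compact open slice is also closed, so deleting f on the first slice leaves a continuous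
    function covered by the others; no partition of unity is needed. *)
Lemma covered_span U ss f : continuous (f : G -> R[i]^o) -> covered U ss f ->
  exists2 T, coef f T & span U T.
Proof.
elim: ss f => [|[s Z] ss IH] f cf [H1 H2].
  exists 0; last exact: span0.
  apply: coef_ext coef0 => a; apply/eqP; rewrite eq_sym; apply/negPn/negP.
  by move=> /H2[].
have [cZ ZU Zs] := H1 (s, Z) (mem_head _ _); rewrite /= in cZ ZU Zs.
have [_ oZ dZ] := cZ.
pose u x := if `[< Z x >] then f (mk s x) else 0.
have cu : ccont u.
  move=> x; have [Zx|nZx] := pselect (Z x).
    apply: (cvgC_near (v := fun x => f (mk s x))).
      by apply: filterS (near_nbhs_open oZ Zx) => y Zy; rewrite /u; case: asboolP.
    exact: (@cvg_comp _ _ _ (mk s) (f : G -> R[i]^o) _ _ _ (mk_cvg (Zs _ Zx)) (cf _)).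
  apply: (cvgC_cst (c := 0)); have := @near_nbhs_open x (~` Z) (closed_openC dZ) nZx.
  by apply: filterS => y nZy; rewrite /u; case: asboolP.
have hu : KU U u by split=> //; exists Z; split=> // x nZ; rewrite /u; case: asboolP.
have bu := KU_bounded hu.
pose W := mk s @` Z.
have oW : open W by exact: open_image_mk.
have dW : closed W by apply: closed_image_mk.
have basE a : bas s u a = if `[< W a >] then f a else 0.
  rewrite /bas; case: asboolP => [[hs Ea]|n].
    rewrite /u; case: (asboolP (Z _)) => Zx; case: asboolP => Wa //.
    - by rewrite -Ea.
    - by case: Wa; exists (src a).
    - by case: Wa => x Zx' E; case: Zx; rewrite -E src_mk.
  case: asboolP => // -[x Zx E]; case: n; rewrite -E src_mk; split=> //; exact: Zs.
pose f2 a := f a - bas s u a.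
have f2E a : f2 a = if `[< W a >] then 0 else f a.
  by rewrite /f2 basE; case: ifP; rewrite ?subrr ?subr0.
have [||T2 HT2 ST2] := IH f2.
- move=> a; have [Wa|nWa] := pselect (W a).
    apply: (cvgC_cst (c := 0)).
    have : nbhs a W by exact: open_nbhs_nbhs.
    by apply: filterS => b Wb; rewrite f2E; case: asboolP.
  apply: (cvgC_near (v := f)); last exact: cf.
  have : nbhs a (~` W) by apply: open_nbhs_nbhs; split=> //; exact: closed_openC.
  by apply: filterS => b Wb; rewrite f2E; case: asboolP.
- split; first by move=> p pss; apply: H1; rewrite inE pss orbT.
  move=> a; rewrite f2E; case: asboolP => [_|nW]; first by rewrite eqxx.
  move=> /H2[p]; rewrite inE => /orP[/eqP->|pss Hp]; last by exists p.
  by move=> /= [Za Ea]; case: nW; exists (src a).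
exists (Wo s \o Mo u + T2); last exact: spanS.
by apply: coef_ext (coefD (coef_bas s bu) HT2) => a; rewrite /f2 addrC subrK.
Qed.

Lemma Cc_span U f T : open U -> Cc U f -> regular f T -> span U T.
Proof.
move=> oU Hf HT; have [ss Hss] := Cc_covered oU Hf; have [cf _ _] := Hf.
have [T' HT' ST'] := covered_span cf Hss.
by rewrite (coef_uniq (regular_coef HT) HT').
Qed.

(** The extension of u by zero off its slice is continuous because slices over compact open sets are
    closed; invariance puts the ranges in U. *)
Lemma Cc_bas U s u : invariant_set U -> KU U u -> Cc U (bas s u).
Proof.
move=> iU [cu [Z [cZ ZU uZ]]].
pose V := Z `&` bdom s.
have [cV oV dV] : cko V by apply: ckoI => //; [exact: open_Zc|exact: closed_Zc].
have Vs : V `<=` bdom s by move=> x [].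
have sub : supp (bas s u) `<=` mk s @` V.
  have dW : closed (mk s @` V) by exact: closed_image_mk.
  apply: subset_trans dW; apply: closureS => a /=; rewrite /bas; case: asboolP => [[hs Ea] ua|]; last by rewrite eqxx.
  exists (src a) => //; split=> //; apply: contrapT => /uZ E; by rewrite E eqxx in ua.
split.
- apply: germ_ind => t x ht; apply: germ_cvg => //.
  have [[hs E]|n] := pselect (bdom s x /\ mk t x = mk s x).
    apply: (cvgC_near (v := u)); last exact: cu.
    apply: filterS2 (near_bdom hs) (mk_eq_near ht hs E) => y hy ->.
    exact: bas_mk.
  apply: (cvgC_cst (c := 0)); have [hs|hs] := pselect (bdom s x).
    have ne : mk t x <> mk s x by move=> E; apply: n.
    apply: filterS (mk_neq_near halign ht hs ne) => y ney.
    by rewrite /bas src_mk; case: asboolP => // -[_ /ney].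
  have := @near_nbhs_open x (~` bdom s) (open_Cbdom s) hs.
  by apply: filterS => y nZy; rewrite /bas src_mk; case: asboolP => // -[/nZy].
- apply: (subclosed_compact _ (compact_image_mk cV Vs)) => //; exact: closed_closure.
- move=> a /sub[x [Zx hs] <-]; rewrite /restriction /= src_mk ran_mk//.
  by split; [exact: ZU|apply/(invariant_sact iU hs)/ZU].
Qed.

Lemma Cc_add U f f' : Cc U f -> Cc U f' -> Cc U (fun a => f a + f' a).
Proof.
move=> [cf sf sU] [cf' sf' sU'].
have sub : supp (fun a => f a + f' a) `<=` supp f `|` supp f'.
  rewrite /supp -closureU; apply: closureS => a /= /eqP n.
  have [fa|fa] := eqVneq (f a) 0; last by left.
  by right; apply/eqP => fa'; apply: n; rewrite fa fa' addr0.
split.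
- by move=> a; exact: (cvgD (cf a) (cf' a)).
- apply: (subclosed_compact _ (compactU sf sf')) => //; exact: closed_closure.
- by move=> a /sub[/sU|/sU'].
Qed.

Lemma Cc_zero U : Cc U (fun=> 0 : R[i]).
Proof.
have E : supp (fun _ : G => 0 : R[i]) = set0.
  rewrite /supp (_ : [set _ | _] = set0) ?closure0//.
  by apply/seteqP; split=> // a /=; rewrite eqxx.
split; rewrite ?E//; first by move=> a; apply: (cvgC_cst (c := 0)); apply: filterE.
exact: compact0.
Qed.

Lemma span_Cc U T : open U -> invariant_set U -> span U T -> exists2 f, Cc U f & regular f T.
Proof.
move=> oU iU ST; suff [f Hf HT] : exists2 f, Cc U f & coef f T.
  exists f => //; apply: coef_regular => //.
  have [ss Hss] := Cc_covered oU Hf; exact: covered_fibre Hss.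
elim: ST => [|s u {}T hu _ [f Hf HT]].
  by exists (fun=> 0); [exact: Cc_zero|exact: coef0].
exists (fun a => bas s u a + f a); first by apply: Cc_add => //; exact: Cc_bas.
by apply: coefD => //; apply: coef_bas; exact: KU_bounded hu.
Qed.

Lemma CredE U : open U -> invariant_set U -> @Cred k C R U = op_closure (span U).
Proof.
move=> oU iU; congr op_closure; apply/seteqP; split=> T.
  by move=> [f Hf HT]; exact: Cc_span Hf HT.
by move=> /(span_Cc oU iU)[f Hf HT]; exists f.
Qed.

Lemma invariant_setT : invariant_set [set: bdry C].
Proof. by []. Qed.

Lemma CstarE : @Cstar k C R = op_closure (span setT).
Proof. by apply: CredE => //; exact: openT. Qed.

Lemma span_sub U U' T : U `<=` U' -> span U T -> span U' T.
Proof.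
move=> UU'; elim=> [|s u {}T hu _ IH]; first exact: span0.
by apply: spanS => //; exact: KU_sub hu.
Qed.

Lemma closure_comp (X Y W : set op) S T : X `<=` @bounded_op k C R -> Y `<=` @bounded_op k C R ->
  (forall S T, X S -> Y T -> W (S \o T)) ->
  op_closure X S -> op_closure Y T -> op_closure W (S \o T).
Proof.
move=> bX bY H [bS HS] [bT HT]; have [MS MS0 LS] := bounded_ex bS.
have [MT MT0 LT] := bounded_ex bT.
apply: (@op_closureP _ _ _ _ _ (MS + (MT + 1))); first exact: bounded_comp.
move=> e e0.
(* The cap at 1 bounds the norm of T' by [MT + 1] independently of e. *)
have e1 : 0 < Num.min e 1 by rewrite lt_min e0 ltr01.
have [S' XS' DS] := HS _ e0; have [T' YT' DT] := HT _ e1.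
exists (S' \o T'); first exact: H.
have LT' : op_le T' (MT + 1).
  move=> xi; have := op_leB LT DT xi; rewrite oper_subE opprB addrC subrK => h.
  by rewrite (le_trans h)// ler_wpM2r ?l2norm_ge0// lerD2l ge_min lexx orbT.
have DT' : op_le (T - T') e by apply: op_le_trans DT; rewrite ge_min lexx.
rewrite mulrDl [(MT + 1) * e]mulrC.
have -> : (S \o T) - (S' \o T') = (S \o (T - T')) + ((S - S') \o T') :> op.
  apply/funext => xi.
  change (S (T xi) - S' (T' xi) = S (T xi - T' xi) + (S (T' xi) - S' (T' xi))).
  rewrite (linear_opB _ _ (proj1 bS)).
  by rewrite addrA subrK.
apply: op_leD; first exact: op_le_comp.
by apply: op_le_comp => //; exact: ltW.
Qed.

Lemma Cred_ideal U : open U -> invariant_set U -> closed_ideal (@Cred k C R U).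
Proof.
move=> oU iU; rewrite (CredE oU iU); split.
- by rewrite CstarE; apply: op_closureS => T; apply: span_sub.
- by apply: sub_op_closure; [exact: span_bounded|exact: span0].
- by apply: op_closure_lin => a S T HS HT; apply: spanD => //; exact: spanZ.
- move=> S T; rewrite CstarE => HS HT; split.
    by apply: closure_comp HS HT => [S' /span_bounded//|S' /span_bounded//|]; exact: span_comp_l.
  apply: closure_comp HT HS => [S' /span_bounded//|S' /span_bounded//|].
  by move=> S' T'; exact: span_comp_r.
- exact: op_closureK.
Qed.

Lemma Cstar_coef T : Cstar T -> coef (ker T) T.
Proof. by apply: coef_closure => S [f _ /regular_coef]; exists f. Qed.

End Span.

(** * Diagonal part and gauge action *)

Section BlockLinear.
Context {k : nat} {C : hrGraph k} {R : realType} {I : finType} {K : choiceType}.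
Notation G := (germ C).
Variable kap : I -> G -> option K.
Hypothesis kap_inj : forall g i j l, kap i g = Some l -> kap j g = Some l -> i = j.
Implicit Types (S T : oper C R).

Lemma block_bounded T : bounded_op T -> bounded_op (block kap T).
Proof.
move=> bT; have [M M0 HM] := bounded_ex bT.
by have [] := blockP kap_inj M0 (proj1 bT) HM.
Qed.

Lemma block_le T M : 0 <= M -> bounded_op T -> op_le T M -> op_le (block kap T) M.
Proof. by move=> M0 bT HM; have [] := blockP kap_inj M0 (proj1 bT) HM. Qed.

Lemma blockE T xi g : bounded_op T -> block kap T xi g = block_val kap T xi g.
Proof.
move=> bT; have [M M0 HM] := bounded_ex bT.
by have [] := blockP kap_inj M0 (proj1 bT) HM.
Qed.

Lemma blockB S T : bounded_op S -> bounded_op T ->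
  block kap (S - T) = block kap S - block kap T.
Proof.
move=> bS bT; apply/funext => xi; apply: ell2_ext => g.
rewrite oper_subE ell2B !blockE//; last exact: bounded_opB.
rewrite /block_val -mulrBr -sumrB; congr (_ * _); apply: eq_bigr => i _.
by case: (kap i g) => [l|]; rewrite ?subr0.
Qed.

Lemma coef_block f T (phi : G -> R[i]) : coef f T ->
  (forall g h, src g = src h -> phi (gdiv g h) = #|I|%:R^-1 *
    \sum_i (if kap i g is Some l then (has_label kap l h)%:R else 0)) ->
  coef (fun a => phi a * f a) (block kap T).
Proof.
move=> [bT HT] Hphi; split; first exact: block_bounded.
move=> h g; rewrite (blockE _ _ bT) (block_delta _ _ _ (proj1 bT)) HT.
case: eqP => [E|_]; last by rewrite big1 ?mulr0// => i _; rewrite mulr0.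
by rewrite Hphi// -mulrA big_distrl.
Qed.

End BlockLinear.

Section Labels1.
Context {k : nat} {C : hrGraph k} {R : realType} {K : choiceType}.
Variable lab : germ C -> K.

Definition lab1 (i : 'I_1) (g : germ C) : option K := Some (lab g).

Lemma lab1_inj g i j l : lab1 i g = Some l -> lab1 j g = Some l -> i = j.
Proof. by move=> _ _; rewrite !ord1. Qed.

Lemma lab1_sum g h : (#|'I_1|%:R^-1 *
  \sum_i (if lab1 i g is Some l then (has_label lab1 l h)%:R else 0) : R[i]) =
  (lab g == lab h)%:R.
Proof.
rewrite card_ord invr1 mul1r big_ord1 /=; congr (_%:R); congr nat_of_bool.
by apply/existsP/eqP => [[_ /eqP[->]]//|->]; exists ord0; rewrite /lab1.
Qed.
End Labels1.

(** * The diagonal part as a function on the boundary *)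

Section Expectation.
Context {k : nat} {C : hrGraph k} {R : realType}.
Hypothesis halign : finitely_aligned C.
Notation G := (germ C).
Notation op := (oper C R).
Implicit Types (f : G -> R[i]) (S T : op) (x y : bdry C) (e : J C) (s t : Il C).
Implicit Types (a b g h : G) (u v : bdry C -> R[i]) (U Z : set (bdry C)).

Lemma Mo_span U u : KU U u -> span U (Mo u).
Proof.
move=> hu; have bu := KU_bounded hu; have [cu [Z [ckZ ZU uZ]]] := hu; have [cZ oZ dZ] := ckZ.
have [ss [H1 H2]] : exists ss : seq (Il C * set (bdry C)),
    (forall p, p \in ss -> [/\ cko p.2, p.2 `<=` U & p.2 `<=` bdom p.1]) /\
    forall x, Z x -> exists2 p, p \in ss & p.2 x /\ un x = mk p.1 x.
  (* The condition [Z x] is doubled so that one copy can vary in the compactness induction while the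
     other stays fixed. *)
  suff [ss [H1 H2]] : exists ss : seq (Il C * set (bdry C)),
    (forall p, p \in ss -> [/\ cko p.2, p.2 `<=` U & p.2 `<=` bdom p.1]) /\
    forall x, Z x -> Z x -> exists2 p, p \in ss & p.2 x /\ un x = mk p.1 x.
    by exists ss; split=> // x Zx; exact: H2.
  apply: (compact_ind (P := fun W => exists ss : seq (Il C * set (bdry C)),
    (forall p, p \in ss -> [/\ cko p.2, p.2 `<=` U & p.2 `<=` bdom p.1]) /\
    forall x, W x -> Z x -> exists2 p, p \in ss & p.2 x /\ un x = mk p.1 x)) cZ _ _ _ _.
  - by exists [::].
  - by move=> V W [ss [H1 H2]] WV; exists ss; split=> // a /WV/H2.
  - move=> V W [ss [H1 H2]] [ss' [H1' H2']]; exists (ss ++ ss'); split.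
      by move=> p; rewrite mem_cat => /orP[/H1|/H1'].
    move=> a [/H2|/H2'] H /H[p pss Hp]; exists p => //; rewrite mem_cat pss ?orbT//.
  - move=> x Zx; exists (bdom (uel x)); first exact: near_bdom (bdom_uel x).
    exists [:: (uel x, Z `&` bdom (uel x))]; split.
      move=> p; rewrite inE => /eqP ->; split=> /=.
      + by apply: ckoI => //; [exact: open_Zc|exact: closed_Zc].
      + by move=> y [/ZU].
      + by move=> y [].
    move=> y hy Zy; exists (uel x, Z `&` bdom (uel x)); rewrite ?inE//=.
    by split; [split|rewrite (mk_un hy)//; exact: uelE].
have cov : covered U ss (unit_ext u).
  split=> // a; rewrite unit_extE; case: (a =P un (src a)) => [Ea ua|]; last by rewrite eqxx.
  have Za : Z (src a) by apply: contrapT => /uZ E; rewrite E eqxx in ua.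
  by have [p pss [pa Ep]] := H2 _ Za; exists p => //; split=> //; rewrite {1}Ea.
have cf : continuous (unit_ext u : G -> R[i]^o).
  move=> a; have := near_unit halign a; have [Ea|na] := eqVneq a (un (src a)) => H.
    apply: (cvgC_near (v := u \o @src k C)).
      apply: filterS H => b Eb; rewrite unit_extE Eb//.
    exact: (@cvg_comp _ _ _ (@src k C) (u : bdry C -> R[i]^o) _ _ _ (src_continuous (x:=a)) (cu _)).
  by apply: (cvgC_cst (c := 0)); apply: filterS H => b Eb; rewrite unit_extE Eb.
have [T HT ST] := covered_span halign cf cov.
by rewrite (coef_uniq (coef_Mo bu) HT).
Qed.

Lemma Mo_Cstar u : KU setT u -> Cstar (Mo u : op).
Proof.
move=> hu; rewrite CstarE//; apply: sub_op_closure; first exact: span_bounded.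
exact: Mo_span.
Qed.

(** The domain of s is compact open, so its indicator is in C_c and multiplying by it does not
    change [Wo s]. *)
Lemma Wo_Cstar s : Cstar (Wo s : op).
Proof.
pose u x : R[i] := (`[< bdom s x >])%:R.
have hu : KU setT u by apply: KU_ind => //; exact: cko_bdom.
rewrite CstarE//; apply: sub_op_closure; first exact: span_bounded.
rewrite (_ : Wo s = Wo s \o Mo u); first exact: span1.
apply/funext => xi; apply: ell2_ext => g; rewrite /= (WoE s xi) [RHS]WoE.
case: asboolP => // H; rewrite MoE; last exact: KU_bounded hu.
rewrite ran_gm// /u; case: asboolP => [_|[]]; first by rewrite mul1r.
exact: bdom_inv'.
Qed.

(** The conditional expectation onto the diagonal: each germ is labelled by itself, so only the
    entries with g = h survive. *)
Definition diagE T : op := block (lab1 (fun g : G => g)) T.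

Lemma coef_diagE f T : coef f T ->
  coef (fun a => (a == un (src a))%:R * f a) (diagE T).
Proof.
move=> HT; apply: (coef_block _ HT); first exact: lab1_inj.
by move=> g h E; rewrite lab1_sum src_gdiv gdiv_unit.
Qed.

Lemma diagE_le T M : 0 <= M -> bounded_op T -> op_le T M -> op_le (diagE T) M.
Proof. by apply: block_le; exact: lab1_inj. Qed.

Lemma diagEB S T : bounded_op S -> bounded_op T -> diagE (S - T) = diagE S - diagE T.
Proof. by apply: blockB; exact: lab1_inj. Qed.

Lemma Cstar_approx T (e : R) : Cstar T -> 0 < e -> exists f S,
  [/\ Cc setT f, regular f S, Cstar S & op_le (T - S) e].
Proof.
move=> [bT HT] /HT[S [f Hf HS] TS]; exists f, S; split=> //.
by apply: sub_op_closure => [_ [f' _ []]//|]; exists f.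
Qed.

Lemma ker_dist f S T (e : R) a : 0 <= e -> regular f S -> op_le (T - S) e ->
  normc (ker T a - f a) <= e.
Proof.
move=> e0 HS TS; have := ker_le a e0 TS.
by rewrite kerB (coef_ker (regular_coef HS)).
Qed.

Lemma Cstar_ker_bounded T : Cstar T -> bounded_fun (fun x => ker T (un x)).
Proof. by move=> [bT _]; have [M M0 HM] := bounded_ex bT; exists M => // x; exact: ker_le. Qed.

Lemma diagE_Mo T : Cstar T -> diagE T = Mo (fun x => ker T (un x)).
Proof.
move=> CT; apply: (coef_uniq (coef_diagE (Cstar_coef CT))).
apply: coef_ext (coef_Mo (Cstar_ker_bounded CT)) => a.
rewrite unit_extE; case: (a =P un (src a)) => [E|_]; last by rewrite mul0r.
by rewrite mul1r {2}E.
Qed.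

(** Continuity holds as for a uniform limit of the functions f(un x) with f in C_c; a set where the
    modulus is at least e lies in the compact image of the support of an f within e/2. *)
Lemma expectation_C0 U T : Cstar T -> (forall x, ~ U x -> ker T (un x) = 0) ->
  C0 U (fun x => ker T (un x)).
Proof.
move=> CT U0; have cu : ccont (fun x => ker T (un x)).
  move=> x; apply/cvgCP => e e0; have e3 : 0 < e / 3%:R by rewrite divr_gt0.
  have [f [S [[cf _ _] HS _ TS]]] := Cstar_approx CT e3.
  have cfu : ((fun x => f (un x)) : bdry C -> R[i]^o) @ x --> (f (un x) : R[i]^o).
    exact: (@cvg_comp _ _ _ (@un k C) (f : G -> R[i]^o) _ _ _ (un_continuous (x:=x)) (cf _)).
  move: (proj1 (cvgCP _ _) cfu _ e3); apply: filterS => y Hy.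
  have H1 := ker_dist (un x) (ltW e3) HS TS.
  have H2 := ker_dist (un y) (ltW e3) HS TS.
  rewrite (_ : _ - _ = (ker T (un x) - f (un x)) + ((f (un x) - f (un y)) +
     (f (un y) - ker T (un y)))); last by rewrite !addrA !subrK.
  apply: le_lt_trans (normcD _ _) _.
  have := normcD (f (un x) - f (un y)) (f (un y) - ker T (un y)).
  rewrite [in X in _ <= _ + X]normcB; lra.
split=> // e e0; split; last first.
  move=> x /= H; apply: contrapT => /U0 E; move: H; rewrite E normc0; lra.
have e2 : 0 < e / 2%:R by rewrite divr_gt0.
have [f [S [[cf sf _] HS _ TS]]] := Cstar_approx CT e2.
have cs : compact (@src k C @` supp f).
  by apply: continuous_compact => //; apply: continuous_subspaceT; exact: src_continuous.
apply: (subclosed_compact _ cs); first exact: closed_normc_ge cu.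
move=> x /= Hx; exists (un x); last by rewrite src_un.
apply: subset_closure => /=; apply/eqP => E.
by have := ker_dist (un x) (ltW e2) HS TS; rewrite E subr0; lra.
Qed.

Lemma C0_bounded U u : C0 U u -> bounded_fun u.
Proof.
move=> [cu /(_ 1 ltr01)[cK _]].
have [m Hm] := ccont_compact_bounded cu cK.
exists (Num.max 1 m); first by rewrite le_max ler01.
move=> x; have [h|h] := leP 1 (normc (u x)); first by rewrite le_max Hm// orbT.
by rewrite le_max ltW.
Qed.

Lemma C0_approx U u (e : R) : open U -> C0 U u -> 0 < e -> exists Z, [/\ cko Z, Z `<=` U &
  forall x, normc (u x - u x * (`[< Z x >])%:R) <= e].
Proof.
move=> oU [cu H] e0; have [cK KU_] := H e e0.
have [Z [cZ KZ ZU]] := cko_cover cK oU KU_.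
exists Z; split=> // x; case: asboolP => [_|nZ].
  by rewrite mulr1 subrr normc0 ltW.
rewrite mulr0 subr0 leNgt; apply/negP => h; apply/nZ/KZ; exact: ltW.
Qed.

Lemma Mo_C0_Cred U u : open U -> invariant_set U -> C0 U u -> Cred U (Mo u : op).
Proof.
move=> oU iU hu; have bu := C0_bounded hu; rewrite CredE//.
split; first exact: Mo_bounded.
move=> e e0; have [Z [cZ ZU HZ]] := C0_approx oU hu e0.
pose v x := u x * (`[< Z x >])%:R : R[i].
have hv : KU U v by apply: KU_mulr; [case: hu|exact: KU_ind].
exists (Mo v); first exact: Mo_span.
have bv := KU_bounded hv.
have [_ H _] := MoP (ltW e0) HZ.
by rewrite -MoB//; exists e; [exact: ltW|].
Qed.

Lemma C0_opsP U T : open U -> C0_ops U T <-> exists2 u, C0 U u & T = Mo u.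
Proof.
move=> oU; split=> [[u hu HT]|[u hu ->]].
  exists u => //; apply: (coef_uniq (regular_coef HT)); apply: coef_Mo.
  exact: C0_bounded hu.
by exists u => //; apply: regular_Mo; exact: C0_bounded hu.
Qed.

End Expectation.

(** * Gauge invariance of ideals expressed by conjugation *)

Section GaugeInvariance.
Context {k : nat} {C : hrGraph k} {R : realType}.
Hypothesis halign : finitely_aligned C.
Notation G := (germ C).
Notation op := (oper C R).
Notation dg := (dg halign).
Notation gz := (gz halign).
Implicit Types (f : G -> R[i]) (S T : op) (U : set (bdry C)) (z : 'I_k -> R[i]).

(** The factor is nonzero and, as [dg] is locally constant, locally constant: support and continuity
    are kept. *)
Lemma Cc_gauge U z f : torus z -> Cc U f -> Cc U (fun a => zp z (dg a) * f a).
Proof.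
move=> tz [cf sf sU].
have E : supp (fun a => zp z (dg a) * f a) = supp f.
  rewrite /supp; congr closure; apply/seteqP; split=> a /=; rewrite mulf_eq0 negb_or.
    by move=> /andP[].
  move=> ->; rewrite andbT; apply/eqP => E0.
  by have := normc_zp (dg a) tz; rewrite E0 normc0 => /eqP; rewrite eq_sym oner_eq0.
split; rewrite ?E// => a; apply: (cvgC_near (v := fun b => zp z (dg a) * f b)).
  by apply: filterS (near_dg halign a) => b ->.
exact: (cvgM (cvg_cst _) (cf a)).
Qed.

Lemma gz_fibre z f : fibre_finite f -> fibre_finite (fun a => zp z (dg a) * f a).
Proof.
move=> ff x; apply: sub_finite_set (ff x) => a /= [ra]; rewrite mulf_eq0 negb_or.
by move=> /andP[].
Qed.

Lemma Cred_gz U z T : torus z -> open U -> Cred U T -> Cred U (gz z T).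
Proof.
move=> tz oU [bT HT]; split; first exact: gz_bounded.
move=> e e0; have [S [f Hf HS] TS] := HT e e0.
exists (gz z S).
  exists (fun a => zp z (dg a) * f a); first exact: Cc_gauge.
  apply: coef_regular; last exact/coef_gz/regular_coef.
  by apply: gz_fibre; have [ss] := Cc_covered oU Hf; exact: covered_fibre.
by rewrite -gzB//; apply: gz_le => //; exact: ltW.
Qed.

Lemma gauge_op_gz z T T' : torus z -> gauge_op z T T' -> T' = gz z T.
Proof.
move=> tz H; apply: (@op_eqP _ _ _ _ _ 2) => e e0.
have [f [f' [S [S' [[Hf Hf' /(gauge_funP halign) E HS HS'] [TS TS']]]]]] := H e e0.
have ES : S' = gz z S.
  apply: (coef_uniq (regular_coef HS')).
  by apply: coef_ext (coef_gz halign tz (regular_coef HS)) => a; rewrite E.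
have -> : 2 * e = e + e by rewrite mulr_natl.
apply: op_le_dist TS' _; rewrite ES -gzB//; apply: gz_le => //; first exact: ltW.
exact: op_leC.
Qed.

Lemma gz_gauge_op z T : torus z -> Cstar T -> gauge_op z T (gz z T).
Proof.
move=> tz CT e e0; have [f [S [Hf HS _ TS]]] := Cstar_approx CT e0.
have Hf' := Cc_gauge tz Hf.
exists f, (fun a => zp z (dg a) * f a), S, (gz z S); split.
  split=> //; first exact/(gauge_funP halign).
  apply: coef_regular; last exact/coef_gz/regular_coef.
  by have [ss] := Cc_covered openT Hf'; exact: covered_fibre.
by split=> //; rewrite -gzB//; apply: gz_le => //; exact: ltW.
Qed.

Lemma Cred_Cstar U T : Cred U T -> Cstar T.
Proof.
apply: op_closureS => S [f [cf sf sU] HS]; exists f => //; split=> //.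
Qed.

Lemma Cred_gauge_invariant U : open U -> gauge_invariant (@Cred k C R U).
Proof.
move=> oU z tz; apply/seteqP; split=> T.
  by move=> [_ [S HS /(gauge_op_gz tz) ->]]; exact: Cred_gz.
move=> HT; split; first exact: Cred_Cstar HT.
exists (gz (zinv z) T); first by apply: Cred_gz => //; exact: torus_inv.
have := gz_gauge_op tz (Cred_Cstar (Cred_gz (torus_inv tz) oU HT)).
by rewrite gzK.
Qed.

Lemma gauge_invariant_gz (I : set op) z T : closed_ideal I -> gauge_invariant I ->
  torus z -> I T -> I (gz z T).
Proof.
move=> [IC _ _ _ _] gI tz IT; rewrite -(gI z tz); split.
  exact/(Cred_gz tz openT)/IC.
by exists T => //; apply/gz_gauge_op/IC.
Qed.

End GaugeInvariance.

(** * Contractions that preserve a gauge-invariant ideal *)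

Section Multipliers.
Context {k : nat} {C : hrGraph k} {R : realType}.
Hypothesis halign : finitely_aligned C.
Notation G := (germ C).
Notation op := (oper C R).
Notation dg := (dg halign).
Notation gz := (gz halign).
Implicit Types (f q : G -> R[i]) (S T : op) (Q : op -> op) (x y : bdry C) (e : J C).
Implicit Types (a b g h : G) (z : 'I_k -> R[i]).
Variable I : set op.
Hypothesis (idI : closed_ideal I) (gaugeI : gauge_invariant I).

Lemma ideal_Cstar T : I T -> Cstar T. Proof. by case: idI => H _ _ _ _; exact: H. Qed.
Lemma ideal_lin (c : R[i]) S T : I S -> I T -> I (c *: S + T).
Proof. by case: idI => _ _ H _ _; exact: H. Qed.
Lemma ideal0 : I 0. Proof. by case: idI. Qed.
Lemma idealZ (c : R[i]) T : I T -> I (c *: T).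
Proof. by move=> IT; rewrite -[_ *: _]addr0; apply: ideal_lin => //; exact: ideal0. Qed.
Lemma idealD S T : I S -> I T -> I (S + T).
Proof. by move=> IS IT; rewrite -[S]scale1r; exact: ideal_lin. Qed.
Lemma idealB S T : I S -> I T -> I (S - T).
Proof. by move=> IS IT; rewrite addrC -scaleN1r; exact: ideal_lin. Qed.
Lemma ideal_l S T : Cstar S -> I T -> I (S \o T).
Proof. by case: idI => _ _ _ H _ CS IT; case: (H S T CS IT). Qed.
Lemma ideal_r S T : I S -> Cstar T -> I (S \o T).
Proof. by case: idI => _ _ _ H _ IS CT; case: (H T S CT IS). Qed.
Lemma ideal_closed T : op_closure I T -> I T.
Proof. by case: idI => _ _ _ _; exact. Qed.

(* Contractions of operators which preserve I, multiply kernels by q and fix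
   the kernel on the unit space. *)
Definition multiplier q Q := [/\ forall T, I T -> I (Q T),
  forall S T, bounded_op S -> bounded_op T -> Q (S - T) = Q S - Q T,
  forall T M, 0 <= M -> bounded_op T -> op_le T M -> op_le (Q T) M,
  forall f T, coef f T -> coef (fun a => q a * f a) (Q T) &
  forall x, q (un x) = 1].

Lemma multiplier_id : multiplier (fun=> 1) id.
Proof.
split=> // f T; apply: coef_ext => a; by rewrite mul1r.
Qed.

Lemma multiplier_comp q Q q' Q' : multiplier q Q -> multiplier q' Q' ->
  (forall T, bounded_op T -> bounded_op (Q T)) ->
  multiplier (fun a => q' a * q a) (Q' \o Q).
Proof.
move=> [I1 B1 L1 C1 U1] [I2 B2 L2 C2 U2] bQ; split=> /=.
- by move=> T /I1/I2.
- by move=> S T bS bT; rewrite B1// B2//; exact: bQ.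
- by move=> T M M0 bT HT; apply: L2 => //; [exact: bQ|exact: L1].
- move=> f T /C1/C2; apply: coef_ext => a; by rewrite mulrA.
- by move=> x; rewrite U1 U2 mulr1.
Qed.

Lemma multiplier_gauge z : torus z ->
  let Q T := 2%:R^-1 *: (T + gz z T) in
  multiplier (fun a => (1 + zp z (dg a)) / 2%:R) Q /\
  forall T, bounded_op T -> bounded_op (Q T).
Proof.
move=> tz Q; split; last first.
  by move=> T bT; apply: bounded_opZ; apply: bounded_opD => //; exact: gz_bounded.
split.
- move=> T IT; apply: idealZ; apply: idealD => //.
  exact: gauge_invariant_gz.
- by move=> S T bS bT; rewrite /Q gzB// -scalerBr opprD addrACA.
- move=> T M M0 bT HT; have -> : M = normc (2%:R^-1 : R[i]) * (M + M).
    by rewrite normc_invn; field.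
  by apply: op_leZ; apply: op_leD => //; exact: gz_le.
- move=> f T HT; have := coefZ 2%:R^-1 (coefD HT (coef_gz halign tz HT)).
  by apply: coef_ext => a; field.
- by move=> x; rewrite dg_un zp0; field.
Qed.

Definition sep_lab e := lab1 (fun g : G => ev (ran g) e).

Lemma multiplier_sep e :
  multiplier (fun a => (ev (ran a) e == ev (src a) e)%:R) (block (sep_lab e)) /\
  forall T, bounded_op T -> bounded_op (block (sep_lab e) T).
Proof.
have inj := @lab1_inj k C bool (fun g : G => ev (ran g) e).
have Hcoef f T : coef f T ->
    coef (fun a => (ev (ran a) e == ev (src a) e)%:R * f a) (block (sep_lab e) T).
  move=> HT; apply: (coef_block inj HT) => g h E.
  by rewrite lab1_sum ran_gdiv// src_gdiv.
split; last by move=> T bT; exact: block_bounded.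
split=> //.
- move=> T IT; pose u x : R[i] := (`[< Zc e x >])%:R.
  have hu : KU setT u by apply: KU_ind => //; exact: cko_Zc.
  have bu := KU_bounded hu.
  have CM : Cstar (Mo u : op) by exact: Mo_Cstar.
  have HT := Cstar_coef (ideal_Cstar IT).
  have HL := coef_Mo_l bu HT; have HR := coef_Mo_r bu HT; have HLR := coef_Mo_r bu HL.
  have Hsum := coefD (coefB HT (coefD HL HR)) (coefD HLR HLR).
  (* With p = [Mo u] the projection onto the germs with range in e, the two-block compression is pTp
     + (1-p)T(1-p) = T - (pT + Tp) + 2pTp. Written so, it needs no unit in C*_r. *)
  have -> : block (sep_lab e) T = (T - ((Mo u \o T) + (T \o Mo u))) +
     (((Mo u \o T) \o Mo u) + ((Mo u \o T) \o Mo u)).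
    apply: (coef_uniq (Hcoef _ _ HT)); apply: coef_ext Hsum => a.
    have uE x : u x = (ev x e)%:R.
      by rewrite /u; case: asboolP; rewrite /Zc /= => H; [rewrite H|case: (ev x e) H].
    rewrite !uE; case: (ev (ran a) e); case: (ev (src a) e); rewrite /=; ring.
  have IL : I (Mo u \o T) by exact: ideal_l.
  apply: idealD; last by apply: idealD; exact: ideal_r.
  by apply: idealB => //; apply: idealD => //; exact: ideal_r.
- by move=> S T bS bT; exact: blockB.
- by move=> T M M0 bT HT; exact: block_le.
- by move=> x; rewrite ran_un src_un eqxx.
Qed.

Lemma torus_root (n : {ffun 'I_k -> int}) : n != 0 ->
  exists2 z : 'I_k -> R[i], torus z & zp z n = -1.
Proof.
move=> n0; have [j nj] : exists j, n j != 0.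
  apply: contrapT => /forallNP H; move/eqP: n0; apply; apply/ffunP => i.
  by rewrite ffunE; have /negP := H i; rewrite negbK => /eqP.
have m0 : (0 < `|n j|)%N by rewrite absz_gt0.
have [w wN w1] : exists2 w : R[i], w ^+ `|n j|%N = -1 & `|w| = 1.
  exists (`|n j|%N.-root (-1)); first by rewrite rootCK.
  apply/eqP; rewrite -(pexpr_eq1 m0)// -normrX rootCK//.
  by rewrite normrN1.
(* Only a coordinate j with n_j nonzero is moved, by a root w of w^|n_j| = -1 or its inverse,
   according to the sign of n_j. *)
pose z i : R[i] := if i == j then (if 0 <= n j then w else w^-1) else 1.
exists z.
  move=> i; rewrite /z; case: ifP => _; last by rewrite normr1.
  by case: ifP => _; rewrite ?normfV w1// invr1.
rewrite /zp (bigD1 j)//= big1 ?mulr1 /z ?eqxx; last first.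
  by move=> i /negPf ->; rewrite exp1rz.
case: (n j) wN => m /= <-; first by [].
by rewrite /exprz exprVn invrK.
Qed.

Lemma kill_nonunits f : Cc setT f -> exists q Q, [/\ multiplier q Q,
  forall T, bounded_op T -> bounded_op (Q T) &
  forall a, q a * f a = (a == un (src a))%:R * f a].
Proof.
move=> [cf sf _]; pose N := [set a : G | a != un (src a)].
have cN : closed N.
  rewrite -[N]setCK; apply: open_closedC; rewrite openE => a /= na.
  by apply: filterS (near_unit halign a) => b Eb /=; rewrite /N /= Eb.
have cK : compact (supp f `&` N).
  apply: (subclosed_compact _ sf); last by move=> a [].
  by apply: closedI => //; exact: closed_closure.
(* Multipliers killing two sets compose to one killing their union, and every composite is 1 at the
   units; so local killing suffices on the compact set of non-units in the support. *)
have [q [Q [mQ bQ qN]]] : exists q Q, [/\ multiplier q Q,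
    forall T, bounded_op T -> bounded_op (Q T) & forall a, (supp f `&` N) a -> q a = 0].
  apply: (compact_ind (P := fun W => exists q Q, [/\ multiplier q Q,
    forall T, bounded_op T -> bounded_op (Q T) & forall a, W a -> q a = 0])) cK _ _ _ _.
  - by exists (fun=> 1), id; split=> //; exact: multiplier_id.
  - by move=> V W [q [Q [mQ bQ H]]] WV; exists q, Q; split=> // a /WV/H.
  - move=> V W [q [Q [mQ bQ H]]] [q' [Q' [mQ' bQ' H']]].
    exists (fun a => q' a * q a), (Q' \o Q); split; first exact: multiplier_comp.
      by move=> T bT; apply/bQ'/bQ.
    by move=> a [/H->|/H'->]; rewrite ?mulr0 ?mul0r.
  - move=> a [_ Na]; have [d0|/torus_root[z tz zn]] := eqVneq (dg a) 0.
      have [e ne] := nonunit_sep d0 Na.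
      have [m b] := multiplier_sep e.
      exists [set b | ev (ran b) e = ev (ran a) e /\ ev (src b) e = ev (src a) e].
        apply: filterI; first exact: (ran_continuous (x:=a) (near_ev (ran a) e)).
        exact: (src_continuous (x:=a) (near_ev (src a) e)).
      by eexists; eexists; split; [exact: m|exact: b|move=> g /= [-> ->]; rewrite (negPf ne)].
    have [m b] := multiplier_gauge tz.
    exists [set b | dg b = dg a]; first exact: near_dg.
    by eexists; eexists; split; [exact: m|exact: b|move=> g /= ->; rewrite zn subrr mul0r].
exists q, Q; split=> // a; case: (eqVneq a (un (src a))) => [E|nE].
  by have [_ _ _ _ q1] := mQ; rewrite {1}E q1.
rewrite mul0r; have [->|fa] := eqVneq (f a) 0; first by rewrite mulr0.
by rewrite qN ?mul0r//; split=> //; exact: subset_closure.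
Qed.

(** For an approximant S choose a multiplier with Q S = [diagE S]. Then Q T is in I and differs from
    [diagE T] by at most twice the distance of T and S, both maps being contractive. *)
Lemma ideal_diagE T : I T -> I (diagE T).
Proof.
move=> IT; have CT := ideal_Cstar IT; have [bT _] := CT.
have CE : bounded_op (diagE T) by have [] := coef_diagE (Cstar_coef CT).
apply: ideal_closed; apply: (@op_closureP _ _ _ _ _ 2) => // e e0.
have [f [S [Hf HS CS TS]]] := Cstar_approx CT e0; have [bS _] := CS.
have [q [Q [mQ bQ qE]]] := kill_nonunits Hf.
have cS := regular_coef HS.
exists (Q T); first by case: mQ => H _ _ _ _; exact: H.
have [_ QB Qle Qc _] := mQ.
have ES : diagE S = Q S.
  apply: (coef_uniq (coef_diagE cS)); apply: coef_ext (Qc _ _ cS) => a.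
  exact: qE.
have -> : 2 * e = e + e by rewrite mulr_natl.
apply: (op_le_dist (T := diagE S)).
  rewrite -diagEB//; apply: diagE_le => //; first exact: ltW.
  exact: bounded_opB.
rewrite ES -QB//; apply: Qle; [exact: ltW|exact: bounded_opB|exact: op_leC].
Qed.

End Multipliers.

(** * Path labels and approximation *)

Section Peel.
Context {k : nat} {C : hrGraph k} {R : realType}.
Hypothesis halign : finitely_aligned C.
Notation G := (germ C).
Notation op := (oper C R).
Implicit Types (S T X : op) (U : set (bdry C)) (s : Il C).

Lemma Cstar_ideal : closed_ideal (@Cstar k C R).
Proof. exact: (Cred_ideal halign openT (@invariant_setT k C)). Qed.

(** The diagonal of W_s^-1 X is the function x -> ker X [s, x], which is in C_0(U) since the kernel
    vanishes over the complement of U. Translated back by W_s it lies in [Cred U], and subtracting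
    it clears the slice of s exactly; only the finiteness of the number of slices is used, not an
    estimate. *)
Lemma peel U (ss : seq (Il C)) X : open U -> invariant_set U -> Cstar X ->
  (forall a, ker X a != 0 -> exists2 s, s \in ss & bdom s (src a) /\ a = mk s (src a)) ->
  (forall a, ~ U (src a) -> ker X a = 0) -> Cred U X.
Proof.
move=> oU iU; have idU := Cred_ideal (R := R) halign oU iU.
elim: ss X => [|s ss IH] X CX Hs HU.
  rewrite (_ : X = 0); first exact: (ideal0 idU).
  apply: (coef_uniq (Cstar_coef CX)); apply: coef_ext coef0 => a.
  by apply/eqP; rewrite eq_sym; apply/negPn/negP => /Hs[].
pose Y : op := Wo (Il_inv s) \o X.
have CY : Cstar Y := ideal_l Cstar_ideal (Wo_Cstar halign (Il_inv s)) CX.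
have kY x : ker Y (un x) = if `[< bdom s x >] then ker X (mk s x) else 0.
  rewrite (coef_ker (coef_Wo_l (Il_inv s) (Cstar_coef CX))) Il_invK ran_un.
  by case: asboolP => // h; rewrite gm_un.
have Y0 x : ~ U x -> ker Y (un x) = 0.
  by move=> nU; rewrite kY; case: asboolP => // h; apply: HU; rewrite src_mk.
have C0u := expectation_C0 CY Y0; set u := (fun x => _) in C0u.
have bu := C0_bounded C0u.
pose X1 : op := Wo s \o Mo u.
have CX1 : Cred U X1.
  exact: (ideal_l idU (Wo_Cstar halign s) (Mo_C0_Cred halign oU iU C0u)).
have CXX : Cstar (X - X1) := idealB Cstar_ideal CX (Cred_Cstar CX1).
have E a : ker (X - X1) a = if `[< bdom s (src a) /\ a = mk s (src a) >] then 0 else ker X a.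
  rewrite kerB (coef_ker (coef_bas s bu)) /bas; case: asboolP => [[h Ea]|]; last by rewrite subr0.
  rewrite /u kY; case: asboolP => // _; by rewrite -Ea subrr.
rewrite -(subrK X1 X); apply: (idealD idU _ CX1); apply: (IH _ CXX) => a.
  rewrite E; case: asboolP => [_|n]; first by rewrite eqxx.
  by move=> /Hs[t]; rewrite inE => /orP[/eqP->//|tss Ht]; exists t.
by rewrite E => /HU ->; case: ifP.
Qed.

End Peel.

(** * Labels by longest prefixes and the multipliers phi *)

Section PathLabels.
Context {k : nat} {C : hrGraph k} {R : realType}.
Hypothesis halign : finitely_aligned C.
Notation G := (germ C).
Notation op := (oper C R).
Notation dg := (dg halign).
Variables (L : set (C * C)) (N : nat).
Hypothesis finL : finite_set L.
Hypothesis symL : forall a b, L (a, b) -> L (b, a).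
Hypothesis dmL : forall a b, L (a, b) -> dm a = dm b.
Implicit Types (x y : bdry C) (c d : C) (p q : {ffun 'I_k -> nat}) (a g h : G).
Implicit Types (S T : op) (f : G -> R[i]).

Notation fam := (fam L N).

Definition best p x c := [/\ fam p c, ev x (cyl c) &
  forall d, fam p d -> ev x (cyl d) -> rideal d c].

Lemma rideal_anti c d : rideal c d -> rideal d c -> c = d.
Proof.
move=> cd dc; apply: rideal_eq => //; apply/ffunP => i; apply/eqP.
by rewrite eqn_leq !deg_rideal.
Qed.

Lemma best_uniq p x c d : best p x c -> best p x d -> c = d.
Proof. by move=> [Fc xc mc] [Fd xd md]; apply: rideal_anti; [exact: md|exact: mc]. Qed.

(** A member under x that is not a prefix of c has with c a minimal common extension under x, again
    in the family and of larger [tsz]; [fam_bound] stops the process. *)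
Lemma best_ex p x c : fam p c -> ev x (cyl c) -> exists d, best p x d.
Proof.
have [B HB] := fam_bound N finL.
have [n] := ubnP (B - tsz (p, c)); elim: n c => // n IH c; rewrite ltnS => le Fc xc.
have [H|] := pselect (forall d, fam p d -> ev x (cyl d) -> rideal d c); first by exists c.
move=> /existsNP[d /not_implyP[Fd /not_implyP[xd nd]]].
have [f mf xf] := ev_mce halign xc xd; have Ff : fam p f by exact: fam_mce mf.
have [cf df _] := mf; apply: (IH f) => //.
have := tsz_rideal p cf; rewrite leq_eqVlt => /orP[/eqP E|lt].
  by case: nd; rewrite (tsz_eq cf E).
have := HB p f Ff; lia.
Qed.

(** The family is finite, so the longest prefix depends on finitely many values of the character. *)
Lemma near_best p x : \forall y \near x, forall c, best p y c <-> best p x c.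
Proof.
have [es Ees] := proj1 (finite_seqP _) (finite_image cyl (@finite_fam k C halign L N finL symL p)).
apply: filterS (near_evs x es) => y Hy.
have {}Hy c : fam p c -> ev y (cyl c) = ev x (cyl c).
  move=> Fc; apply: Hy; have : (cyl @` [set c | fam p c]) (cyl c) by exists c.
  by rewrite Ees.
move=> c; split=> -[Fc xc mc]; split=> //.
- by rewrite -Hy.
- by move=> d Fd; rewrite -Hy//; exact: mc.
- by rewrite Hy.
- by move=> d Fd; rewrite Hy//; exact: mc.
Qed.

Definition Iset := {ffun 'I_k -> 'I_N}.
Definition off (i : Iset) : {ffun 'I_k -> nat} := [ffun j => i j : nat].
Definition offz p : {ffun 'I_k -> int} := [ffun j => (p j)%:Z].

Lemma off_box i : box N (off i).
Proof. by move=> j; rewrite ffunE. Qed.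

Lemma box_off p : box N p -> exists i, p = off i.
Proof.
move=> bp; exists [ffun j => Ordinal (bp j)].
by apply/ffunP => j; rewrite !ffunE.
Qed.

Lemma off_inj i j : off i = off j -> i = j.
Proof. by move=> /ffunP E; apply/ffunP => l; apply: val_inj; have := E l; rewrite !ffunE. Qed.

Lemma offz_inj p q : offz p = offz q -> p = q.
Proof. by move=> /ffunP E; apply/ffunP => l; have := E l; rewrite !ffunE => -[]. Qed.

Definition lel c : Il C := mkIl (inIl_gen c).

(** The degree component makes the index recoverable from g and the label, as [kap_inj] requires;
    the remainder alone would not do so. There is no label when no member of the family is a prefix
    of the range. *)
Definition kap (i : Iset) g : option ({ffun 'I_k -> int} * G) :=
  if pselect (exists c, best (off i) (ran g) c) is left H then
    Some (dg g + offz (off i), gm (Il_inv (lel (projT1 (cid H)))) g) else None.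

Lemma kapP i g l : kap i g = Some l <-> exists2 c, best (off i) (ran g) c &
  l = (dg g + offz (off i), gm (Il_inv (lel c)) g).
Proof.
rewrite /kap; case: pselect => [H|n]; last by split=> // -[c Hc]; case: n; exists c.
case: cid => c Hc /=; split=> [[<-]|[d Hd ->]]; first by exists c.
by rewrite (best_uniq Hd Hc).
Qed.

Lemma kap_inj g i j l : kap i g = Some l -> kap j g = Some l -> i = j.
Proof.
move=> /kapP[c Hc ->] /kapP[d Hd [/addrI E _]].
exact/off_inj/offz_inj.
Qed.

Definition meets (i : Iset) a := exists j c d, [/\ best (off i) (ran a) c,
  best (off j) (src a) d, dm c = dm d, a = mk (Il_frac c d) (src a) &
  dg a + offz (off i) = offz (off j)].

Lemma lel_frac c d : Il_mul (lel c) (Il_inv (lel d)) = Il_frac c d.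
Proof. exact: val_inj. Qed.

(** A common remainder t means g = ct and h = dt, so g h^-1 = [c d^-1, ran h], and the degree
    components give the equation between offsets. Thus the Schur multiplier depends on g h^-1 alone
    and acts on kernels by the function [phi]. *)
Lemma kap_meets i g h : src g = src h ->
  (if kap i g is Some l then (has_label kap l h)%:R else 0 : R[i]) = (`[< meets i (gdiv g h) >])%:R.
Proof.
move=> E; have rg := ran_gdiv E; have sg := src_gdiv g h.
case Ek : (kap i g) => [l|]; last first.
  case: asboolP => // -[j [c [d [Hc _ _ _ _]]]]; rewrite rg in Hc.
  have : kap i g = Some (dg g + offz (off i), gm (Il_inv (lel c)) g) by apply/kapP; exists c.
  by rewrite Ek.
have [c Hc El] := proj1 (kapP _ _ _) Ek.
have bc : bdom (Il_inv (lel c)) (ran g) by case: Hc.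
congr (_%:R); congr nat_of_bool; apply/existsP/asboolP.
  move=> [j /eqP /kapP[d Hd El']]; have bd : bdom (Il_inv (lel d)) (ran h) by case: Hd.
  move: El'; rewrite El => -[Ed Et].
  have Eg : g = gm (lel c) (gm (Il_inv (lel d)) h).
    by rewrite -Et; have := gmK bc; rewrite Il_invK.
  have b1 : bdom (lel c) (ran (gm (Il_inv (lel d)) h)).
    by rewrite -Et ran_gm//; exact: bdom_inv'.
  have b2 : bdom (lel d) (ran (gm (Il_inv (lel d)) h)).
    by rewrite ran_gm//; exact: bdom_inv'.
  have cd : dm c = dm d.
    have : ev (ran (gm (Il_inv (lel d)) h)) (Jcap (Jdom (lel c)) (Jdom (lel d))).
      by rewrite ev_cap; apply/andP; split.
    by move=> /ev_ne[w [[v1 [/= -> _]] [v2 [/= -> _]]]].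
  exists j, c, d; rewrite rg sg; split=> //.
    have rd : sact (Il_inv (lel d)) (ran h) = ran (gm (Il_inv (lel d)) h) by rewrite ran_gm.
    have bf : bdom (Il_frac c d) (ran h).
      by rewrite -lel_frac; apply/bdom_mul; split=> //; rewrite rd.
    apply/gdiv_mkP => //; rewrite {1}Eg gm_gm ?lel_frac//.
    by rewrite rd.
  by rewrite dg_gdiv// addrAC Ed addrAC subrr add0r.
move=> [j [c' [d [Hc' Hd cd Ea Edg]]]]; rewrite rg in Hc'; rewrite sg in Hd Ea.
rewrite (best_uniq Hc' Hc) in cd Ea.
have bd : bdom (Il_inv (lel d)) (ran h) by case: Hd.
have bf : bdom (Il_frac c d) (ran h) by apply/bdom_frac => //; case: Hd.
have := bf; rewrite -lel_frac => /bdom_mul[_ b1].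
have Eg : g = gm (Il_frac c d) h by apply/gdiv_mkP.
exists j; apply/eqP/kapP; exists d => //; rewrite El; congr (_, _).
  by move: Edg; rewrite dg_gdiv// => <-; rewrite addrA; congr (_ + _); rewrite addrC subrK.
rewrite Eg -lel_frac -gm_gm// gmK//.
by rewrite ran_gm.
Qed.

(** The offset j is determined by i and the degree, c and d by the longest prefixes, all locally
    constant. For fixed c and d, both equality with [c d^-1, src] and its failure persist nearby. *)
Lemma near_meets i a : \forall b \near a, `[< meets i b >] = `[< meets i a >].
Proof.
have FF : Filter (nbhs a) := @nbhs_filter (germ C) a.
have n1 : \forall b \near a, forall c, best (off i) (ran b) c <-> best (off i) (ran a) c.
  exact: (ran_continuous (x:=a) (near_best (off i) (ran a))).
have n2 := near_dg halign a.
have n3 : \forall b \near a, forall j : Iset, forall c,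
    best (off j) (src b) c <-> best (off j) (src a) c.
  have H j := src_continuous (x:=a) (near_best (off j) (src a)).
  exact: (@filter_forall _ Iset (fun j b => forall c,
    best (off j) (src b) c <-> best (off j) (src a) c) _ _ H).
have n := @filterI _ (nbhs a) FF _ _ (@filterI _ (nbhs a) FF _ _ n1 n2) n3.
have [M|nM] := pselect (meets i a).
  have [j [c [d [Hc Hd cd Ea Edg]]]] := M.
  have bf : bdom (Il_frac c d) (src a) by apply/bdom_frac => //; case: Hd.
  have n4 : \forall b \near a, b = mk (Il_frac c d) (src b).
    rewrite {1}Ea; apply: near_mk => //.
    by apply: filterE => y; rewrite src_mk.
  apply: (@filterS _ (nbhs a) FF _ _ _ (@filterI _ (nbhs a) FF _ _ n n4)) => b [[[/= h1 h2] h3] h4].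
  rewrite (asboolT M); apply: asboolT; exists j, c, d; split=> //.
  - exact/h1.
  - exact/h3.
  - by rewrite h2.
have [[j [c [d [Hc Hd cd Edg]]]]|no] := pselect (exists j c d, [/\ best (off i) (ran a) c,
  best (off j) (src a) d, dm c = dm d & dg a + offz (off i) = offz (off j)]); last first.
  apply: (@filterS _ (nbhs a) FF _ _ _ n) => b [[/= h1 h2] h3].
  rewrite (asboolF nM); apply: asboolF => -[j [c [d [Hc Hd cd _ Edg]]]].
  by apply: no; exists j, c, d; split=> //; [exact/h1|exact/h3|rewrite -h2].
have bf : bdom (Il_frac c d) (src a) by apply/bdom_frac => //; case: Hd.
have na : mk (gel a) (src a) <> mk (Il_frac c d) (src a).
  by rewrite mk_gel => E; apply: nM; exists j, c, d.
have n4 : \forall b \near a, b <> mk (Il_frac c d) (src b).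
  have : nbhs (mk (gel a) (src a)) [set b | b <> mk (Il_frac c d) (src b)].
    apply: near_mk; first exact: bdom_gel.
    by apply: filterS (mk_neq_near halign (bdom_gel a) bf na) => y; rewrite /= src_mk.
  by rewrite mk_gel.
apply: (@filterS _ (nbhs a) FF _ _ _ (@filterI _ (nbhs a) FF _ _ n n4)) => b [[[/= h1 h2] h3] h4].
rewrite (asboolF nM); apply: asboolF => -[j' [c' [d' [Hc' Hd' _ Eb Edg']]]].
rewrite h2 Edg in Edg'; have Ej := off_inj (offz_inj Edg'); subst j'.
rewrite (best_uniq (proj1 (h1 _) Hc') Hc) (best_uniq (proj1 (h3 _ _) Hd') Hd) in Eb.
exact: h4 Eb.
Qed.

Definition phi a : R[i] := #|Iset|%:R^-1 * \sum_i (`[< meets i a >])%:R.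

Lemma near_phi a : \forall b \near a, phi b = phi a.
Proof.
have FF : Filter (nbhs a) := @nbhs_filter (germ C) a.
have : \forall b \near a, forall i, `[< meets i b >] = `[< meets i a >].
  exact: (@filter_forall _ Iset (fun i b => `[< meets i b >] = `[< meets i a >]) _ _
    (fun i => near_meets i a)).
by apply: filterS => b H; rewrite /phi; congr (_ * _); apply: eq_bigr => i _; rewrite H.
Qed.

Lemma phiE a : phi a = #|Iset|%:R^-1 * (#|[pred i : Iset | `[< meets i a >]]|)%:R.
Proof.
rewrite /phi -natr_sum; congr (_ * _%:R); rewrite -sum1_card [RHS]big_mkcond /=.
by apply: eq_bigr => i _; rewrite -topredE /=; case: asboolP.
Qed.

Lemma coef_kap f T : coef f T -> coef (fun a => phi a * f a) (block kap T).
Proof.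
move=> HT; apply: (coef_block kap_inj HT) => g h E.
by congr (_ * _); apply: eq_bigr => i _; rewrite kap_meets.
Qed.

Lemma phi_cover : exists ss : seq (Il C), forall a, phi a != 0 ->
  exists2 s, s \in ss & bdom s (src a) /\ a = mk s (src a).
Proof.
pose A : set (Il C) := \bigcup_(ij in [set: Iset * Iset])
  ((fun cd : C * C => Il_frac cd.1 cd.2) @`
    ([set c | fam (off ij.1) c] `*` [set c | fam (off ij.2) c])).
have finA : finite_set A.
  apply: bigcup_finite; first exact: finite_finset.
  by move=> ij _; apply/finite_image/finite_setX; exact: finite_fam.
have [ss Ess] := proj1 (finite_seqP _) finA; exists ss => a; rewrite phiE.
have [->|] := posnP #|[pred i : Iset | `[< meets i a >]]|; first by rewrite mulr0 eqxx.
move=> /card_gt0P[i0]; rewrite -topredE /= => /asboolP[j [c [d [Hc Hd cd Ea _]]]] _.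
exists (Il_frac c d).
  have : A (Il_frac c d).
    exists (i0, j) => //; exists (c, d) => //; split; first by case: Hc.
    by case: Hd.
  by rewrite Ess.
by split=> //; apply/bdom_frac => //; case: Hd.
Qed.

Lemma Cc_phi f : Cc setT f -> Cc setT (fun a => phi a * f a).
Proof.
move=> [cf sf _].
have sub : supp (fun a => phi a * f a) `<=` supp f.
  by apply: closureS => a /=; rewrite mulf_eq0 negb_or => /andP[].
split=> //; last first.
  by apply: (subclosed_compact _ sf) => //; exact: closed_closure.
move=> a; apply: (cvgC_near (v := fun b => phi a * f b)).
  by apply: filterS (near_phi a) => b ->.
exact: (cvgM (cvg_cst _) (cf a)).
Qed.

Lemma block_kap_Cstar T : Cstar T -> Cstar (block kap T).
Proof.
move=> CT; have [bT _] := CT; split; first exact: (block_bounded kap_inj).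
move=> e e0; have [f [S [Hf HS [bS _] TS]]] := Cstar_approx CT e0.
exists (block kap S).
  exists (fun a => phi a * f a); first exact: Cc_phi.
  apply: coef_regular; last exact/coef_kap/regular_coef.
  by have [ss] := Cc_covered openT (Cc_phi Hf); exact: covered_fibre.
rewrite -(blockB kap_inj)//; apply: (block_le kap_inj) => //; first exact: ltW.
exact: bounded_opB.
Qed.

(** [phi] lives on the finitely many slices of fractions of members of the family, so [peel]
    applies. *)
Lemma block_kap_Cred U T : open U -> invariant_set U -> Cstar T ->
  (forall a, ~ U (src a) -> ker T a = 0) -> Cred U (block kap T).
Proof.
move=> oU iU CT HU; have CB := block_kap_Cstar CT.
have E a : ker (block kap T) a = phi a * ker T a.
  exact: (coef_ker (coef_kap (Cstar_coef CT))).
have [ss Hss] := phi_cover; apply: (peel halign (ss := ss) oU iU CB) => a; rewrite E.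
  by rewrite mulf_eq0 negb_or => /andP[/Hss].
by move=> /HU ->; rewrite mulr0.
Qed.

End PathLabels.

(** * Labels agree at interior offsets *)

Section PhiLarge.
Context {k : nat} {C : hrGraph k} {R : realType}.
Hypothesis halign : finitely_aligned C.
Notation G := (germ C).
Notation op := (oper C R).
Variables (L : set (C * C)) (N : nat).
Hypothesis finL : finite_set L.
Hypothesis symL : forall a b, L (a, b) -> L (b, a).
Hypothesis dmL : forall a b, L (a, b) -> dm a = dm b.
Implicit Types (x y : bdry C) (c d w : C) (p q : {ffun 'I_k -> nat}) (a g h : G).

Lemma ev_frac c d x w : dm c = dm d -> ev x (cyl d) -> dm d = tg w ->
  ev (sact (Il_frac c d) x) (cyl (comp c w)) = ev x (cyl (comp d w)).
Proof.
move=> cd xd dw; have cw : dm c = tg w by rewrite cd.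
rewrite ev_sact; last exact/bdom_frac.
congr (ev x); apply: J_eq; apply/seteqP; split=> u.
  move=> [v /fracE[z [dz -> cz ->]] /cylE H]; apply/cylE.
  have /ridealE[r [wr ->]] := rideal_cancel cw cz H.
  by rewrite compA//; apply: rideal_comp; rewrite dm_comp.
move=> /cylE/ridealE[r [+ ->]]; rewrite dm_comp// => wr.
exists (comp c (comp w r)).
  by apply/fracE; exists (comp w r); rewrite !tg_comp// compA.
by apply/cylE; rewrite compA//; apply: rideal_comp; rewrite dm_comp.
Qed.

(** If dw is the longest prefix of x, exchange puts cw in the family below the image. A longer cw'
    would exchange back to a member dw' below x, so w' is a prefix of w, and equality follows. *)
Lemma best_exchange c d x p q : L (c, d) -> box N p -> box N q ->
  deg c + p = deg d + q -> ev x (cyl d) -> exists w,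
  [/\ dm d = tg w, dm c = tg w, best L N q x (comp d w) &
      best L N p (sact (Il_frac c d) x) (comp c w)].
Proof.
move=> Lcd bp bq E xd; have cd := dmL Lcd.
have Fd : fam L N q d by exact: fam_base Lcd.
have Fc : fam L N p c by apply: fam_base (symL Lcd).
have [m Hm] := best_ex halign finL Fd xd.
have [Fm xm mm] := Hm; have /ridealE[w [dw Em]] := mm d Fd xd; subst m.
have cw : dm c = tg w by rewrite cd.
exists w; split=> //.
have Fcw : fam L N p (comp c w) by exact: fam_move Fm.
have ycw : ev (sact (Il_frac c d) x) (cyl (comp c w)) by rewrite ev_frac.
have [m' Hm'] := best_ex halign finL Fcw ycw.
have [Fm' ym' mm'] := Hm'; have cwm := mm' _ Fcw ycw.
have /ridealE[w' [cw' Em']] := rideal_trans (rideal_comp cw) cwm; subst m'.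
have dw' : dm d = tg w' by rewrite -cd.
have Fdw' : fam L N q (comp d w') by apply: (fam_move (symL Lcd)) Fm'.
have xdw' : ev x (cyl (comp d w')) by rewrite -(ev_frac cd).
have H1 := rideal_cancel cw cw' cwm.
have H2 := rideal_cancel dw' dw (mm _ Fdw' xdw').
by rewrite (rideal_anti H1 H2).
Qed.

Lemma meets_frac (i j : @Iset k N) c d x : L (c, d) -> ev x (cyl d) ->
  deg c + off i = deg d + off j -> meets halign L i (mk (Il_frac c d) x).
Proof.
move=> Lcd xd E; have cd := dmL Lcd.
have [w [dw cw Hd Hc]] := best_exchange Lcd (off_box i) (off_box j) E xd.
have bf : bdom (Il_frac c d) x by apply/bdom_frac.
exists j, (comp c w), (comp d w); rewrite src_mk ran_mk//; split=> //.
- by rewrite !dm_comp.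
- apply: (proj2 (mk_eqI (e := cyl (comp d w)) bf _ _)); first by case: Hd.
  move=> u v /cylE/ridealE[r [+ ->]]; rewrite dm_comp// => wr.
  have dwr : dm d = tg (comp w r) by rewrite tg_comp.
  have cwr : dm c = tg (comp w r) by rewrite tg_comp.
  have cwr' : dm (comp c w) = tg r by rewrite dm_comp.
  have dwr' : dm (comp d w) = tg r by rewrite dm_comp.
  split=> /fracE[z [h1 E1 h2 ->]]; apply/fracE.
    exists r; split=> //; rewrite -compA//; congr comp.
    by apply: (comp_lcan h1 dwr); rewrite -E1 compA.
  exists (comp w r); rewrite !compA//; split=> //; congr comp.
  by apply: (comp_lcan h1 dwr'); rewrite -E1.
- rewrite dg_frac//; apply/ffunP => l; move/ffunP/(_ l): E; rewrite !ffun_natD !ffunE; lia.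
Qed.

Lemma card_good (D M : nat) (P : pred (@Iset k (M + D + D))) :
  (forall i : @Iset k (M + D + D), (forall l, (D <= i l < M + D)%N) -> P i) ->
  (M ^ k <= #|P|)%N.
Proof.
move=> HP; have lt (r : 'I_M) : (r + D < M + D + D)%N by have := ltn_ord r; lia.
(* A cube of side M, shifted by D, embeds into the interior of the box. *)
pose F (r : {ffun 'I_k -> 'I_M}) : @Iset k (M + D + D) := [ffun l => Ordinal (lt (r l))].
have injF : injective F.
  move=> r r' /ffunP E; apply/ffunP => l; apply: val_inj; have := E l.
  by rewrite !ffunE => /(congr1 val) /= /addIn.
have -> : (M ^ k = #|{ffun 'I_k -> 'I_M}|)%N by rewrite card_ffun !card_ord.
rewrite -(card_codom injF); apply: subset_leq_card; apply/fintype.subsetP => i.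
move=> /codomP[r ->]; by apply: HP => l; rewrite ffunE /= leq_addl ltn_add2r ltn_ord.
Qed.

End PhiLarge.

Section Bernoulli.
Context {R : realType}.
Lemma bernoulli (t : R) n : 0 <= t <= 1 -> 1 - n%:R * t <= (1 - t) ^+ n.
Proof.
move=> /andP[t0 t1]; elim: n => [|n IH]; first by rewrite mul0r subr0 expr0.
have t1' : 0 <= 1 - t by rewrite subr_ge0.
rewrite exprSr; apply: le_trans (ler_wpM2r t1' IH).
rewrite -natr1 -subr_ge0 [X in 0 <= X](_ : _ = n%:R * t ^+ 2); last by ring.
by rewrite mulr_ge0// sqr_ge0.
Qed.
End Bernoulli.

(** * Approximation by multipliers: kernels vanishing off U *)

Section Approximation.
Context {k : nat} {C : hrGraph k} {R : realType}.
Hypothesis halign : finitely_aligned C.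
Notation G := (germ C).
Notation op := (oper C R).
Implicit Types (f : G -> R[i]) (S T : op) (U : set (bdry C)) (a : G) (c d : C).

Lemma supp_frac f : Cc setT f -> exists L : set (C * C), [/\ finite_set L,
  forall c d, L (c, d) -> L (d, c), forall c d, L (c, d) -> dm c = dm d &
  forall a, f a != 0 -> exists c d,
    [/\ L (c, d), ev (src a) (cyl d) & a = mk (Il_frac c d) (src a)]].
Proof.
move=> [_ sf _]; have [L [finL dL HL]] : exists L : set (C * C), [/\ finite_set L,
    forall c d, L (c, d) -> dm c = dm d &
    forall a, supp f a -> exists c d,
    [/\ L (c, d), ev (src a) (cyl d) & a = mk (Il_frac c d) (src a)]].
  apply: (compact_ind (P := fun W => exists L : set (C * C), [/\ finite_set L,
    forall c d, L (c, d) -> dm c = dm d & forall a, W a -> exists c d,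
    [/\ L (c, d), ev (src a) (cyl d) & a = mk (Il_frac c d) (src a)]])) sf _ _ _ _.
  - by exists set0; split=> //; exact: finite_set0.
  - by move=> V W [L [h1 h2 h3]] WV; exists L; split=> // a /WV/h3.
  - move=> V W [L [h1 h2 h3]] [L' [h1' h2' h3']]; exists (L `|` L'); split.
    + by rewrite finite_setU.
    + by move=> c d [/h2|/h2'].
    + move=> a [/h3|/h3'] [c [d [Lcd ad Ea]]]; exists c, d; split=> //; [by left|by right].
  - move=> a _; have [c [d [cd ad _ Ea]]] := germ_frac halign (bdom_gel a).
    rewrite mk_gel in Ea; have bf : bdom (Il_frac c d) (src a) by exact/bdom_frac.
    exists (mk (Il_frac c d) @` bdom (Il_frac c d)).
      rewrite {1}Ea; apply: nbhs_mk_image => //.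
      by apply: near_nbhs_open => //; exact: open_Zc.
    exists [set (c, d)]; split; [exact: finite_set1|by move=> c' d' [-> ->]|].
    move=> b [x bx <-]; exists c, d; rewrite src_mk; split=> //.
    exact: (proj1 (bdom_frac x cd) bx).
exists (L `|` [set cd | L (cd.2, cd.1)]); split.
- rewrite finite_setU; split=> //.
  apply: (@sub_finite_set _ _ ((fun cd => (cd.2, cd.1)) @` L)); last exact: finite_image.
  by move=> [c d] /= Ldc; exists (d, c).
- by move=> c d [Lcd|Ldc]; [right|left].
- by move=> c d [/dL|/= /dL].
- move=> a fa; have [|c [d [Lcd ad Ea]]] := HL a; first exact: subset_closure.
  by exists c, d; split=> //; left.
Qed.

Lemma deg_bound (L : set (C * C)) : finite_set L ->
  exists D, forall c d l, L (c, d) -> (deg c l <= D)%N /\ (deg d l <= D)%N.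
Proof.
move=> finL; have [s Es] := proj1 (finite_seqP _)
  (finite_image (fun cd : C * C => deg cd.1 + deg cd.2) finL).
exists (\sum_(q <- s) \sum_l q l)%N => c d l Lcd.
have : ((fun cd : C * C => deg cd.1 + deg cd.2) @` L) (deg c + deg d) by exists (c, d).
rewrite Es /= => bs; rewrite (big_rem _ bs) /= (bigD1 l)//= ffun_natD; lia.
Qed.

(** With N = M + 1 + 2D, offsets at distance at least D from the faces of the box keep j = d(c) + i
    - d(d) inside it. Their share is (1 - 2D/N)^k, at least 1 - 2kD/N by the Bernoulli
    inequality. *)
Lemma phi_near1 (L : set (C * C)) (D M : nat) a c d : finite_set L ->
  (forall c d, L (c, d) -> L (d, c)) -> (forall c d, L (c, d) -> dm c = dm d) ->
  (forall c d l, L (c, d) -> (deg c l <= D)%N /\ (deg d l <= D)%N) ->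
  L (c, d) -> ev (src a) (cyl d) -> a = mk (Il_frac c d) (src a) ->
  normc (1 - phi (R := R) halign L (M.+1 + D + D) a) <=
    k%:R * (D + D)%:R / (M.+1 + D + D)%:R.
Proof.
move=> finL symL dmL HD Lcd ad Ea; rewrite phiE; set P := [pred i | _].
set N := (M.+1 + D + D)%N; set n := #|@Iset k N|.
have nE : n = (N ^ k)%N by rewrite /n card_ffun !card_ord.
have n0 : (0 < n)%N by rewrite nE expn_gt0.
have mP : (M.+1 ^ k <= #|P|)%N.
  apply: card_good => i Hi; rewrite /P /=; apply/asboolP; rewrite Ea.
  have bq : box N [ffun l => (deg c l + off i l - deg d l)%N].
    by move=> l; rewrite !ffunE; have := Hi l; have := HD c d l Lcd; rewrite /N; lia.
  have [j Ej] := box_off bq; apply: (@meets_frac k C halign L N finL symL dmL i j) => //.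
  rewrite -Ej; apply/ffunP => l; rewrite !ffun_natD !ffunE.
  have [_ h1] := HD c d l Lcd; have /andP[h2 _] := Hi l.
  by rewrite subnKC// (leq_trans h1)// (leq_trans h2)// leq_addl.
have Pn : (#|P| <= n)%N by exact: max_card.
have nz : (n%:R : R[i]) != 0 by rewrite pnatr_eq0 -lt0n.
have -> : 1 - n%:R^-1 * #|P|%:R = n%:R^-1 * (n - #|P|)%:R :> R[i].
  by rewrite natrB// mulrBr mulVf.
rewrite normcM normc_invn.
have -> : normc ((n - #|P|)%:R : R[i]) = (n - #|P|)%:R.
  have := @normr_normc R (n - #|P|)%:R; rewrite ger0_norm//.
  by rewrite -(rmorph_nat (real_complex R)) => /complexI.
have N0 : 0 < N%:R :> R by rewrite ltr0n /N; lia.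
have NC : N%:R = M.+1%:R + (D + D)%:R :> R by rewrite -natrD /N addnA.
pose t : R := (D + D)%:R / N%:R.
have t01 : 0 <= t <= 1.
  rewrite divr_ge0 ?ler0n//= ler_pdivrMr// mul1r NC.
  by rewrite lerDr ler0n.
have := bernoulli k t01; have -> : 1 - t = M.+1%:R / N%:R.
  apply: (mulIf (lt0r_neq0 N0)).
  by rewrite mulrBl mul1r !divfK ?lt0r_neq0// NC addrK.
rewrite expr_div_n -!natrX => Hb.
have nR : 0 < n%:R :> R by rewrite ltr0n.
have mP' : (M.+1 ^ k)%:R <= #|P|%:R :> R by rewrite ler_nat.
rewrite natrB// mulrBr mulVf ?gt_eqF// -mulrA -/t.
suff : (M.+1 ^ k)%:R / (N ^ k)%:R <= n%:R^-1 * #|P|%:R :> R by move: Hb; lra.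
by rewrite -nE mulrC ler_wpM2l// invr_ge0 ltW.
Qed.

Lemma Cstar_vanish_Cred U T : open U -> invariant_set U -> Cstar T ->
  (forall a, ~ U (src a) -> ker T a = 0) -> Cred U T.
Proof.
move=> oU iU CT HU; have [bT _] := CT.
apply: (ideal_closed (Cred_ideal halign oU iU)).
apply: (@op_closureP _ _ _ _ _ 3) => // e e0.
have [f [S [Hf HS CS TS]]] := Cstar_approx CT e0; have [bS _] := CS.
have cS := regular_coef HS.
have [L [finL symL dmL HL]] := supp_frac Hf; have [D HD] := deg_bound finL.
have [ss [H1 H2]] := Cc_covered openT Hf.
have [B B0 HB] := bounded_ex bS.
have fB a : normc (f a) <= B by rewrite -(coef_ker cS); exact: ker_le.
(* All of K is fixed by f before the box is chosen: the number of slices, the degree bound and a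
   bound of f. The error of the multiplier on S is at most K/N, so N can be taken large last. *)
pose K := (size ss)%:R * (k%:R * (D + D)%:R * B).
have K0 : 0 <= K by rewrite !mulr_ge0.
pose M := Num.truncn (K / e); pose N := (M.+1 + D + D)%N.
have KN : K / N%:R <= e.
  have N0 : 0 < N%:R :> R by rewrite ltr0n.
  rewrite ler_pdivrMr// mulrC -ler_pdivrMr//.
  have := truncnS_gt (K / e); rewrite -/M => h; rewrite (le_trans (ltW h))//.
  by rewrite ler_nat /N; lia.
have inj := @kap_inj k C halign L N.
exists (block (kap halign L (N := N)) T).
  exact: block_kap_Cred.
have dS : op_le (S - block (kap halign L (N := N)) S) e.
  have cD := coefB cS (@coef_kap k C R halign L N f S cS).
  pose m := k%:R * (D + D)%:R / N%:R * B.
  have m0 : 0 <= m by rewrite mulr_ge0// divr_ge0// mulr_ge0.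
  have fE a : f a - phi halign L N a * f a = (1 - phi halign L N a) * f a.
    by rewrite mulrBl mul1r.
  have [|a fa|X HX LX] := @bound_ex k C R (map fst ss)
      (fun a => f a - phi halign L N a * f a) m m0.
  - move=> a; have [->|fa] := eqVneq (f a) 0; first by rewrite mulr0 subrr normc0.
    have [c [d [Lcd ad Ea]]] := HL a fa.
    rewrite fE normcM /m; apply: ler_pM; rewrite ?normc_ge0//.
    exact: phi_near1 Lcd ad Ea.
  - have fa' : f a != 0 by apply: contra fa => /eqP ->; rewrite mulr0 subrr.
    have [p pss [pa Ea]] := H2 a fa'; exists p.1; first exact: map_f.
    by split=> //; have [_ _] := H1 p pss; exact.
  rewrite (coef_uniq cD HX); apply: op_le_trans LX; rewrite size_map.
  rewrite (_ : _ * m = K / N%:R)// /K /m; ring.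
(* Three errors: T to S, S to its multiple, and back from S to T under the contraction [block]. *)
have -> : 3 * e = e + (e + e) by rewrite -[3]/(1 + 2) mulrDl mul1r mulr_natl.
apply: (op_le_dist TS); apply: (op_le_dist dS).
rewrite -(blockB inj)//; apply: (block_le inj); [exact: ltW|exact: bounded_opB|].
exact: op_leC TS.
Qed.

End Approximation.

(** * Ideals *)

Section IdealSupport.
Context {k : nat} {C : hrGraph k} {R : realType}.
Hypothesis halign : finitely_aligned C.
Notation G := (germ C).
Notation op := (oper C R).
Implicit Types (S T : op) (U Z : set (bdry C)) (x y : bdry C) (u v : bdry C -> R[i]) (a g : G).

Lemma KU_indT Z : cko Z -> KU setT (fun x => (`[< Z x >])%:R : R[i]).
Proof. by move=> cZ; apply: KU_ind. Qed.

Lemma KU_C0 U u : KU U u -> C0 U u.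
Proof.
move=> [cu [Z [[cZ _ _] ZU uZ]]]; split=> // e e0.
have sub : [set x | e <= normc (u x)] `<=` Z.
  by move=> x /= h; apply: contrapT => /uZ E; move: h; rewrite E normc0; lra.
split; last by move=> x /sub/ZU.
by apply: (subclosed_compact _ cZ) => //; exact: closed_normc_ge.
Qed.

Lemma span_in_ideal (J : set op) U T : closed_ideal J -> open U ->
  C0_ops U `<=` J -> span U T -> J T.
Proof.
move=> idJ oU sub; elim=> [|s u {}T hu _ IH]; first exact: (ideal0 idJ).
apply: (idealD idJ _ IH); apply: (ideal_l idJ (Wo_Cstar halign s)).
by apply: sub; apply/(C0_opsP _ oU); exists u => //; exact: KU_C0.
Qed.

Lemma Cred_in_ideal (J : set op) U T : closed_ideal J -> open U -> invariant_set U ->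
  C0_ops U `<=` J -> Cred U T -> J T.
Proof.
move=> idJ oU iU sub; rewrite (CredE halign oU iU) => HT; apply: (ideal_closed idJ).
by apply: op_closureS HT => S; exact: span_in_ideal.
Qed.

Variable I : set op.
Hypothesis (idI : closed_ideal I) (gaugeI : gauge_invariant I).

(** The open set belonging to the ideal of C_0 of the boundary formed by its functions in I: the
    union of the sets where they are nonzero. *)
Definition ideal_support : set (bdry C) :=
  [set x | exists2 u, C0 setT u /\ I (Mo u) & u x != 0].
Local Notation U := ideal_support.

Lemma near_neq0 u x : ccont u -> u x != 0 -> \forall y \near x, u y != 0.
Proof.
move=> cu ux; have n0 : 0 < normc (u x).
  by rewrite lt_def normc_ge0 andbT; apply: contra ux => /eqP/normc_eq0 ->.
move: (proj1 (cvgCP _ _) (cu x) _ n0); apply: filterS => y; apply: contraTN => /eqP ->.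
by rewrite subr0 ltxx.
Qed.

Lemma open_support : open U.
Proof.
rewrite openE => x [u [hu Iu] ux]; have [cu _] := hu.
by apply: filterS (near_neq0 cu ux) => y uy; exists u.
Qed.

Lemma ker_support T x : I T -> ker T (un x) != 0 -> U x.
Proof.
move=> IT kx; have CT := ideal_Cstar idI IT.
exists (fun x => ker T (un x)) => //; split.
  by apply: (expectation_C0 (U := setT) CT) => y [].
by rewrite -diagE_Mo//; exact: (ideal_diagE halign).
Qed.

(** Translating T by the inverse of a slice through a brings the value at a to the unit at [src a],
    without leaving I. *)
Lemma ideal_vanish T a : I T -> ~ U (src a) -> ker T a = 0.
Proof.
move=> IT nU; apply/eqP/negPn/negP => ka; apply: nU.
have IY : I (Wo (Il_inv (gel a)) \o T) by exact: (ideal_l idI (Wo_Cstar halign _) IT).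
apply: ker_support IY _.
rewrite (coef_ker (coef_Wo_l (Il_inv (gel a)) (Cstar_coef (ideal_Cstar idI IT)))).
rewrite Il_invK ran_un; case: asboolP => [h|[]]; last exact: bdom_gel.
by rewrite gm_un// mk_gel.
Qed.

(** Conjugating [Mo u] by the slice operator of g stays in I and has the value u(src g) at the unit
    over [ran g]. *)
Lemma invariant_support : invariant_set U.
Proof.
have H g : U (src g) -> U (ran g).
  move=> [u [hu Iu] ux]; have bu := C0_bounded hu; set s := gel g.
  have hs : bdom s (src g) := bdom_gel g.
  have IT : I (Wo s \o (Mo u \o Wo (Il_inv s))).
    apply: (ideal_l idI (Wo_Cstar halign s)).
    exact: (ideal_r idI Iu (Wo_Cstar halign _)).
  apply: ker_support IT _.
  have E : Wo s \o (Mo u \o Wo (Il_inv s)) =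
      Wo (Il_mul s (Il_inv s)) \o Mo (pull (Il_inv s) u).
    by rewrite (Mo_Wo (Il_inv s) bu) -Wo_mul.
  have hr : bdom (Il_inv s) (ran g) by rewrite ran_gel; exact: bdom_inv.
  have hss : bdom (Il_mul s (Il_inv s)) (ran g).
    by apply/bdom_mul; split=> //; exact: bdom_inv'.
  rewrite E (coef_ker (coef_bas _ (pull_bounded _ bu))) -(mk_un hss); last first.
    by move=> c d [w h1 h2]; exact: (Il_fun (h1 : val s (w, c)) h2).
  rewrite bas_mk// /pull; case: asboolP => [_|[]//].
  by rewrite ran_gel sactK.
move=> g; split; first exact: H.
by have := H (ginv g); rewrite src_ginv ran_ginv.
Qed.

(** Locally some u in I is invertible, and v = u (v/u) there; compactness of Z leaves finitely many
    such neighbourhoods to be combined. The induction carries all functions v at once, since the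
    union step changes v. *)
Lemma support_local Z v : cko Z -> Z `<=` U -> ccont v ->
  I (Mo (fun x => v x * (`[< Z x >])%:R)).
Proof.
move=> [cZ oZ dZ] ZU cv.
have [W [cW ZW HW]] : exists W, [/\ cko W, Z `<=` W &
    forall v, ccont v -> I (Mo (fun x => v x * (`[< W x >])%:R))].
  apply: (compact_ind (P := fun V => exists W, [/\ cko W, V `<=` W &
    forall v, ccont v -> I (Mo (fun x => v x * (`[< W x >])%:R))])) cZ _ _ _ _.
  - exists set0; split=> //; first exact: cko0.
    move=> w _; rewrite (_ : Mo _ = 0); first exact: (ideal0 idI).
    have -> : (fun x => w x * (`[< set0 x >])%:R) = (fun=> 0).
      by apply/funext => x; case: asboolP => // _; rewrite mulr0.
    have b0 : bounded_fun (fun _ : bdry C => 0 : R[i]) by exists 0 => // x; rewrite normc0.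
    by apply/funext => xi; apply: ell2_ext => g; rewrite MoE// mul0r operE.
  - by move=> V V' [W [cW VW HW]] V'V; exists W; split=> // x /V'V/VW.
  - move=> V V' [W [cW VW HW]] [W' [cW' VW' HW']]; exists (W `|` W'); split.
    + exact: ckoU.
    + by move=> x [/VW|/VW']; [left|right].
    + move=> w cw; have [_ oW dW] := cW.
      (* The indicator of the union is that of W plus that of W' cut off by the complement of W. *)
      pose w1 x := w x * (`[< W x >])%:R; pose w2 x := w x * (`[< (~` W) x >])%:R.
      have cw2 : ccont w2.
        exact (ccontM cw (ccont_ind (closed_openC dW) (open_closedC oW))).
      have k1 : KU setT w1 := KU_mulr cw (KU_indT cW).
      have k2 : KU setT (fun x => w2 x * (`[< W' x >])%:R) := KU_mulr cw2 (KU_indT cW').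
      have k3 : KU setT (fun x => w x * (`[< (W `|` W') x >])%:R).
        exact: (KU_mulr cw (KU_indT (ckoU cW cW'))).
      rewrite (_ : Mo _ = Mo w1 + Mo (fun x => w2 x * (`[< W' x >])%:R)).
        by apply: (idealD idI); [exact: HW|exact: HW'].
      apply/funext => xi; apply: ell2_ext => g.
      rewrite oper_addE ell2D (MoE _ _ (KU_bounded k1)) (MoE _ _ (KU_bounded k2)).
      rewrite (MoE _ _ (KU_bounded k3)) -mulrDl; congr (_ * _).
      rewrite /w1 /w2 /= asbool_or asbool_neg.
      by case: `[< W _ >]; case: `[< W' _ >]; rewrite ?mulr1 ?mulr0 ?addr0 ?add0r.
  - move=> x Zx; have [u [hu Iu] ux] := ZU x Zx; have [cu _] := hu.
    have [W [cW Wx WU]] := cko_nbhs (near_neq0 cu ux); have [_ oW dW] := cW.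
    exists W; first exact: near_nbhs_open.
    exists W; split=> // w cw.
    pose r y : R[i] := if `[< W y >] then w y / u y else 0.
    have cr : ccont r.
      move=> y; have [Wy|nWy] := pselect (W y).
        apply: (cvgC_near (v := fun y => w y / u y)).
          by apply: filterS (near_nbhs_open oW Wy) => z Wz; rewrite /r; case: asboolP.
        apply: (cvgM (cw y)); apply: cvgV; [exact: WU|exact: cu].
      apply: (cvgC_cst (c := 0)); have := @near_nbhs_open _ _ y (~` W) (closed_openC dW) nWy.
      by apply: filterS => z nWz; rewrite /r; case: asboolP.
    have kr : KU setT r.
      by split=> //; exists W; split=> // y nWy; rewrite /r; case: asboolP.
    rewrite (_ : (fun x => _) = fun y => u y * r y).
      rewrite -(Mo_mul (C0_bounded hu) (KU_bounded kr)).
      exact: (ideal_r idI Iu (Mo_Cstar halign kr)).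
    apply/funext => y; rewrite /r; case: asboolP => [Wy|_]; last by rewrite !mulr0.
    by rewrite mulr1 mulrC divfK//; exact: WU.
(* W may exceed Z; applying the result to v times the indicator of Z cuts it back. *)
have cI : ccont (fun x => v x * (`[< Z x >])%:R) := ccontM cv (ccont_ind oZ dZ).
have := HW _ cI; congr (I (Mo _)); apply/funext => x.
case: (asboolP (Z x)) => Zx; last by rewrite mulr0 mul0r.
by case: asboolP => [_|[]]; [rewrite !mulr1|exact: ZW].
Qed.

Lemma C0_support_ideal : C0_ops U `<=` I.
Proof.
move=> T /(C0_opsP _ open_support)[u hu ->]; have bu := C0_bounded hu.
apply: (ideal_closed idI); split; first exact: Mo_bounded.
move=> e e0; have [Z [cZ ZU HZ]] := C0_approx open_support hu e0.
have [cu _] := hu; exists (Mo (fun x => u x * (`[< Z x >])%:R)).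
  exact: support_local.
have kv : KU setT (fun x => u x * (`[< Z x >])%:R).
  exact: (KU_mulr cu (KU_indT cZ)).
have bd : bounded_fun (fun x => u x - u x * (`[< Z x >])%:R) by exists e => //; exact: ltW.
have [_ H _] := MoP (ltW e0) HZ.
by rewrite -(MoB bu (KU_bounded kv) bd).
Qed.

Lemma ideal_sub_Cred : I `<=` Cred U.
Proof.
move=> T IT; apply: (Cstar_vanish_Cred halign open_support invariant_support).
  exact: (ideal_Cstar idI IT).
by move=> a; exact: ideal_vanish.
Qed.

End IdealSupport.

Theorem lemma7p5 (R : realType) (k : nat) (hk : (0 < k)%N) (C : hrGraph k)
    (hcount : countable [set: C]) (halign : finitely_aligned C)
    (I : set (oper C R)) (hI : closed_ideal I) :
  gauge_invariant I <->
  exists U : set (bdry C), [/\ open U, invariant_set U,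
    I = gen_ideal (C0_ops U) & I = Cred U].
Proof.
split=> [gI|[U [oU _ _ ->]]]; last exact: Cred_gauge_invariant.
have oU := open_support I; have iU := invariant_support halign hI gI.
have sub := ideal_sub_Cred halign hI gI; have C0I := C0_support_ideal halign hI.
exists (ideal_support I); split=> //; apply/seteqP; split=> T.
(* Any closed ideal containing C_0(U) contains the operators [Wo s \o Mo u], hence [Cred U], hence
   I; conversely I is itself such an ideal. *)
- by move=> IT J idJ C0J; apply: (Cred_in_ideal halign idJ oU iU C0J); exact: sub.
- by move=> HT; apply: HT.
- exact: sub.
- exact: Cred_in_ideal.
Qed.
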